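(* Let $v=(v_1,v_2,v_3):\mathbb{R}^3\to\mathbb{R}^3$ and $p:\mathbb{R}^3\to\mathbb{R}$ be smooth functions solving the stationary Navier-Stokes equations $$v\cdot\nabla v=-\nabla p+\Delta v,\qquad \nabla\cdot v=0\qquad\text{in }\mathbb{R}^3,$$ and suppose that $v(x)\to 0$ uniformly as $|x|\to+\infty$ and $\int_{\mathbb{R}^3}|\nabla v|^2\,dx<+\infty$. Let $\bar p=\lim_{|x|\to\infty}p(x)$, let $Q=\frac12|v|^2+p-\bar p$ be the (normalized) head pressure, and let $\omega=\nabla\times v$. Then $$\lim_{\lambda\to 0^+}\bigl(\log(1/\lambda)\bigr)^{-1}\int_{\{x\in\mathbb{R}^3:\,|Q(x)|>\lambda\}}\frac{|\nabla Q|^2}{|Q|}\,dx=\int_{\mathbb{R}^3}|\omega|^2\,dx ,$$ and if $$\int_{\{x\in\mathbb{R}^3:\,|Q(x)|>\lambda\}}\frac{|\nabla Q|^2}{|Q|}\,dx=o\bigl(\log(1/\lambda)\bigr)\qquad\text{as }\lambda\to 0^+,$$ then $v=0$ on $\mathbb{R}^3$.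
   Context: Here $|\nabla v|^2=\sum_{i,j}|\partial_i v_j|^2$ and $\log$ is the natural logarithm. Normalization of the pressure: it is a known fact that, under the stated hypotheses (decay of $v$ at infinity and finite Dirichlet integral), $p(x)$ converges to a constant $\bar p$ as $|x|\to\infty$. The head pressure is normalized by subtracting this constant, so $Q(x)\to0$ as $|x|\to\infty$. If $Q\equiv 0$, the set $\{|Q|>\lambda\}$ is empty and the integral over it is $0$. *)

(* Defs.v *)
From HB Require Import structures.
From mathcomp Require Import all_boot all_order all_algebra.
From mathcomp Require Import all_classical all_reals all_analysis.

Set Implicit Arguments.
Unset Strict Implicit.
Unset Printing Implicit Defensive.

Import Order.TTheory GRing.Theory Num.Theory.
Import numFieldNormedType.Exports.

Local Open Scope classical_set_scope.
Local Open Scope ring_scope.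

(* Functions live on 'rV[R]_3, whose library norm `|x| is the maximum norm; it
   is used only for topological notions (continuity, derivatives, |x| -> oo).
   Euclidean lengths are the explicit sums of squares [sqnorm]. *)

Section VectorCalculus.
Context {R : realType}.

Definition partial {W : normedModType R} (i : 'I_3) (f : 'rV[R]_3 -> W) :
  'rV[R]_3 -> W := 'D_(delta_mx 0 i) f.

Definition iter_partial {W : normedModType R} (s : seq 'I_3)
  (f : 'rV[R]_3 -> W) : 'rV[R]_3 -> W := foldr partial f s.

(* C^oo: partial derivatives of all orders exist everywhere and are continuous *)
Definition smooth {W : normedModType R} (f : 'rV[R]_3 -> W) : Prop :=
  forall s : seq 'I_3,
    continuous (iter_partial s f) /\
    forall (i : 'I_3) (x : 'rV[R]_3),
      derivable (iter_partial s f) x (delta_mx 0 i).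

Definition grad (f : 'rV[R]_3 -> R) (x : 'rV[R]_3) : 'rV[R]_3 :=
  \row_i partial i f x.

Definition divergence (v : 'rV[R]_3 -> 'rV[R]_3) (x : 'rV[R]_3) : R :=
  \sum_i partial i (fun y => v y 0 i) x.

Definition laplacian {W : normedModType R} (f : 'rV[R]_3 -> W)
  (x : 'rV[R]_3) : W := \sum_i partial i (partial i f) x.

(* the index arithmetic is modulo 3 *)
Definition curl (v : 'rV[R]_3 -> 'rV[R]_3) (x : 'rV[R]_3) : 'rV[R]_3 :=
  \row_(i < 3) (partial (i + 1) (fun y => v y 0 (i + 2%:R)) x
                - partial (i + 2%:R) (fun y => v y 0 (i + 1)) x).

(* (v . nabla) v *)
Definition convection (v : 'rV[R]_3 -> 'rV[R]_3) (x : 'rV[R]_3) : 'rV[R]_3 :=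
  \sum_i v x 0 i *: partial i v x.

Definition sqnorm (u : 'rV[R]_3) : R := \sum_i u 0 i ^+ 2.

Definition sqnorm_grad (v : 'rV[R]_3 -> 'rV[R]_3) (x : 'rV[R]_3) : R :=
  \sum_i \sum_j partial i (fun y => v y 0 j) x ^+ 2.

(* the filter of |x| -> oo *)
Definition at_infinity : set_system 'rV[R]_3 :=
  filter_from [set: R] (fun M => [set x | M < `|x|]).

(* Lebesgue measure on R^3 is taken on the product R * R * R, identified with
   'rV[R]_3 through [vec3]. *)
Definition vec3 (t : R * R * R) : 'rV[R]_3 :=
  \row_(i < 3) [:: t.1.1; t.1.2; t.2]`_i.

Definition lebesgue3 :=
  ((@lebesgue_measure R \x @lebesgue_measure R) \x @lebesgue_measure R)%E.

Definition integral3 (D : set 'rV[R]_3) (f : 'rV[R]_3 -> R) : \bar R :=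
  (\int[lebesgue3]_(t in vec3 @^-1` D) (f (vec3 t))%:E)%E.

Definition stationary_NS (v : 'rV[R]_3 -> 'rV[R]_3) (p : 'rV[R]_3 -> R) : Prop :=
  forall x, convection v x = - grad p x + laplacian v x /\ divergence v x = 0.

Definition head_pressure (v : 'rV[R]_3 -> 'rV[R]_3) (p : 'rV[R]_3 -> R)
  (x : 'rV[R]_3) : R :=
  2^-1 * sqnorm (v x) + p x - lim (p y @[y --> at_infinity]).

Definition superlevel_integral (Q : 'rV[R]_3 -> R) (lam : R) : \bar R :=
  integral3 [set x | lam < `|Q x|] (fun x => sqnorm (grad Q x) / `|Q x|).

(* f = o(g) as lam -> 0+; the library's =o is not available for functions with
   values in \bar R, so this is its definition with `|f| taken in \bar R. *)
Definition littleo_right0 (f : R -> \bar R) (g : R -> R) : Prop :=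
  forall e : R, 0 < e ->
    \forall lam \near 0^'+, (`|f lam| <= (e * `|g lam|)%:E)%E.

End VectorCalculus.

(* Main.v *)
(* The head pressure satisfies [lap Q - v . grad Q = |omega|^2], so the maximum
   principle gives [Q <= 0], with omega = 0 wherever Q = 0. Testing this equation
   against a truncated logarithm of [q = - Q], which is compactly supported since Q
   vanishes at infinity, turns the integral of |grad Q|^2 / |Q| over {q > lam} into
   that of |omega|^2 * ln (q / lam), up to a bounded error in the logarithm. Dividing
   by ln (1 / lam) and letting lam -> 0, monotone convergence yields the integral of
   |omega|^2. If it vanishes, v is harmonic and decays, hence v = 0.
   That the pressure has a limit at infinity follows from p having gradient and pure
   second derivatives in L^2: Caccioppoli estimates bound the vorticity gradient,
   then the second derivatives of v; an interpolation puts the gradient of v in L^4,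
   so that the Laplacian of p is in L^2. *)

(* [head_pressure] subtracts a [lim], which carries information only once [p] is known to converge,
   while the hypotheses bound nothing beyond first derivatives of [v] in L^2. The vorticity is
   estimated first because its equation is free of the pressure. In dimension three, a gradient in
   L^2 controls the change of averages between cubes of size r by r^(-1/2), which is summable over
   large dyadic scales only; second derivatives in L^2 give r^(1/2), which is summable over small
   ones. Hence both are required of [p]. All integrations by parts come from one fact: the integral
   over a box of the i-th partial derivative vanishes when the function vanishes on the two faces
   orthogonal to the i-th axis. This is the fundamental theorem of calculus on lines combined with
   Tonelli, so a cutoff may be a polynomial that vanishes on the faces of a cube. That omega = 0 on
   {Q = 0} is what lets the sets {|Q| > d} capture the whole enstrophy as d -> 0, although the
   logarithm gives no weight to the points where Q = 0. *)
From HB Require Import structures.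
Require Import Defs.
From mathcomp Require Import all_boot all_order all_algebra.
From mathcomp Require Import ring lra.
From mathcomp Require Import all_classical all_reals all_analysis.
From mathcomp Require Import measurable_realfun.
Import Order.TTheory GRing.Theory Num.Theory.
Import numFieldNormedType.Exports.
Local Open Scope classical_set_scope.
Local Open Scope ring_scope.
Set Implicit Arguments.
Unset Strict Implicit.
Unset Printing Implicit Defensive.

(** * Continuously differentiable functions *)

Section Calculus.
Context {R : realType}.
Local Notation V := 'rV[R]_3.
Implicit Types (i j : 'I_3).

Definition ebase i : V := delta_mx 0 i.

Lemma is_derive_line (f : V -> R) (x : V) i t : derivable f (x + t *: ebase i) (ebase i) ->
  is_derive t (1 : R) (fun s => f (x + s *: ebase i))
    (partial i f (x + t *: ebase i)).
Proof.
move=> df; have E : (fun h : R => h^-1 *: (((fun s => f (x + s *: ebase i)) \o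
    shift t) (h *: (1 : R)) - f (x + t *: ebase i))) =
  (fun h : R => h^-1 *: ((f \o shift (x + t *: ebase i)) (h *: ebase i)
    - f (x + t *: ebase i))).
  apply/funext => h /=; congr (_ *: (f _ - _)).
  by rewrite [h *: 1]mulr1 scalerDl addrCA addrA addrC.
apply: DeriveDef; first by rewrite /derivable E.
by rewrite /derive E.
Qed.

(** Only derivatives along the axes are recorded: the arguments below move along one coordinate line
    at a time. *)
Definition C1 (f : V -> R) := continuous f /\
  forall i, (forall x, derivable f x (ebase i)) /\ continuous (partial i f).

Lemma C1_cont f : C1 f -> continuous f. Proof. by case. Qed.
Lemma C1_der f : C1 f -> forall x i, derivable f x (ebase i).
Proof. by move=> [_ h] x i; have [] := h i. Qed.
Arguments C1_der [f] _ x i.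
Lemma C1_partial f : C1 f -> forall i, continuous (partial i f).
Proof. by move=> [_ h] i; have [] := h i. Qed.

Arguments C1_partial [f] _ i.
(** Regularity and the formula for the partials are returned together; the calculus rules below
    follow this pattern, so that a product or a composite is differentiated and shown continuous in
    one go. *)
Lemma C1_of (f : V -> R) (df : 'I_3 -> V -> R) : continuous f ->
  (forall i x, is_derive x (ebase i) f (df i x)) ->
  (forall i, continuous (df i)) -> C1 f /\ forall i, partial i f = df i.
Proof.
move=> cf fd cdf; have E i : partial i f = df i.
  by apply/funext => x; rewrite /partial derive_val.
by split=> //; split=> // i; split=> [x|]; [exact: ex_derive|rewrite E].
Qed.

Lemma C1_isder f : C1 f -> forall x i, is_derive x (ebase i) f (partial i f x).
Proof. by move=> cf x i; apply: derivableP; exact: C1_der. Qed.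

Lemma C1_cstP (c : R) : C1 (fun=> c) /\ forall i, partial i (fun=> c) = fun=> 0.
Proof.
by apply: C1_of => [|i]; exact: cst_continuous.
Qed.

Lemma cont_add (T : topologicalType) (f g : T -> R) : continuous f -> continuous g ->
  continuous (fun x : T => f x + g x).
Proof. by move=> cf cg x; apply: continuousD; [exact: cf|exact: cg]. Qed.

Lemma cont_opp (T : topologicalType) (f : T -> R) : continuous f -> continuous (fun x : T => - f x).
Proof. by move=> cf x; apply: continuousN; exact: cf. Qed.

Lemma cont_mul (T : topologicalType) (f g : T -> R) : continuous f -> continuous g ->
  continuous (fun x : T => f x * g x).
Proof. by move=> cf cg x; apply: continuousM; [exact: cf|exact: cg]. Qed.

Lemma C1_addP f g : C1 f -> C1 g -> C1 (fun x => f x + g x) /\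
  forall i, partial i (fun x => f x + g x) = fun x => partial i f x + partial i g x.
Proof.
move=> cf cg; apply: C1_of => [|i x|i].
- by apply: cont_add; exact: C1_cont.
- by have Hf := C1_isder cf x i; have Hg := C1_isder cg x i; exact: is_deriveD.
- by apply: cont_add; exact: C1_partial.
Qed.

Lemma C1_oppP f : C1 f -> C1 (fun x => - f x) /\
  forall i, partial i (fun x => - f x) = fun x => - partial i f x.
Proof.
move=> cf; apply: C1_of => [|i x|i].
- by apply: cont_opp; exact: C1_cont.
- by have Hf := C1_isder cf x i; exact: is_deriveN.
- by apply: cont_opp; exact: C1_partial.
Qed.

Lemma C1_mulP f g : C1 f -> C1 g -> C1 (fun x => f x * g x) /\
  forall i, partial i (fun x => f x * g x) =
    fun x => f x * partial i g x + g x * partial i f x.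
Proof.
move=> cf cg; apply: C1_of => [|i x|i].
- by apply: cont_mul; exact: C1_cont.
- by have Hf := C1_isder cf x i; have Hg := C1_isder cg x i; exact: is_deriveM.
- by apply: cont_add; apply: cont_mul;
  [exact: C1_cont|exact: C1_partial|exact: C1_cont|exact: C1_partial].
Qed.

Lemma is_derive_continuous (f df : R -> R) :
  (forall s, is_derive s (1 : R) f (df s)) -> continuous f.
Proof.
move=> fd s; apply: differentiable_continuous; apply/derivable1_diffP.
by have [] := fd s.
Qed.

Lemma C1_compP f (phi dphi : R -> R) : C1 f ->
  (forall s, is_derive s (1 : R) phi (dphi s)) -> continuous dphi ->
  C1 (fun x => phi (f x)) /\
  forall i, partial i (fun x => phi (f x)) = fun x => dphi (f x) * partial i f x.
Proof.
move=> cf pd cdp.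
have cphi := is_derive_continuous pd.
apply: C1_of => [|i x|i].
- by move=> x; apply: continuous_comp; [exact: (C1_cont cf)|exact: cphi].
- have H := is_derive_line (C1_der cf (x + 0 *: ebase i) i).
  have H2 : is_derive (0 : R) (1 : R) (phi \o (fun s : R => f (x + s *: ebase i)))
    (partial i f x * dphi (f x)).
    have := @is_derive1_comp R phi (fun s : R => f (x + s *: ebase i)) 0
       (dphi (f (x + 0 *: ebase i))) _ (pd _) H.
    by rewrite scale0r addr0 mulrC.
  have E : (fun h : R => h^-1 *: ((phi \o (fun s : R => f (x + s *: ebase i)) \o
      shift 0) (h *: (1 : R)) - (phi \o (fun s : R => f (x + s *: ebase i))) 0)) =
    (fun h : R => h^-1 *: (((fun y => phi (f y)) \o shift x) (h *: ebase i)
      - phi (f x))).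
    apply/funext => h /=; rewrite scale0r !addr0 [h *: 1]mulr1.
    by rewrite [x + _]addrC.
  apply: DeriveDef.
    by have := @ex_derive _ _ _ _ _ _ _ H2; rewrite /derivable E.
  by have := @derive_val _ _ _ _ _ _ _ H2; rewrite /derive E mulrC.
- apply: cont_mul; last exact: C1_partial.
  by move=> x; apply: continuous_comp; [exact: (C1_cont cf)|exact: cdp].
Qed.

Lemma cont_comp (T U W : topologicalType) (h : T -> U) (k : U -> W) :
  continuous h -> continuous k -> continuous (fun x => k (h x)).
Proof. by move=> ch ck x; apply: (@continuous_comp _ _ _ h k); [exact: ch|exact: ck]. Qed.

Lemma C1_coordP j : C1 (fun x : V => x 0 j) /\
  forall i, partial i (fun x : V => x 0 j) = fun=> (i == j)%:R.
Proof.
apply: C1_of => [|i x|i].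
- by move=> x; exact: coord_continuous.
- have E (h : R) : h != 0 ->
    h^-1 *: (((fun x : V => x 0 j) \o shift x) (h *: ebase i) - x 0 j) = (i == j)%:R.
    move=> h0 /=; rewrite !mxE addrK eqxx /= [_ *: _]mulrA mulVf // mul1r.
    by rewrite eq_sym.
  have H : h^-1 *: (((fun x : V => x 0 j) \o shift x) (h *: ebase i) - x 0 j)
      @[h --> 0^'] --> ((i == j)%:R : R).
    apply: cvg_near_cst; near=> h; apply: E.
    by near: h; exact: nbhs_dnbhs_neq.
  apply: DeriveDef; first by apply/cvg_ex; exists (i == j)%:R.
  exact: cvg_lim.
- exact: cst_continuous.
Unshelve. all: by end_near. Qed.

Lemma mvt_partial f x i (h : R) : C1 f -> 0 < h ->
  exists2 t, 0 < t < h & f (x + h *: ebase i) - f x = h * partial i f (x + t *: ebase i).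
Proof.
move=> cf h0.
have D t : is_derive t (1 : R) (fun s => f (x + s *: ebase i))
    (partial i f (x + t *: ebase i)).
  by apply: is_derive_line; exact: C1_der.
have C : {within `[0, h], continuous (fun s => f (x + s *: ebase i))}.
  by apply: derivable_within_continuous => t _; exact: ex_derive.
have [t] := MVT h0 (fun t _ => D t) C.
rewrite in_itv /= => th; rewrite scale0r addr0 subr0 => E.
by exists t => //; rewrite E mulrC.
Qed.

Lemma norm_coord_le (x : V) j : `|x 0 j| <= `|x|.
Proof.
by rewrite [leRHS]/Num.norm /= mx_normrE; apply/bigmax_geP; right => /=; exists (0, j).
Qed.

Lemma norm_le_coord (x : V) (M : R) : 0 <= M -> (forall j, `|x 0 j| <= M) -> `|x| <= M.
Proof.
move=> M0 h; rewrite [leLHS]/Num.norm /= mx_normrE; apply/bigmax_leP.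
by split=> // -[a b] _ /=; rewrite (ord1 a).
Qed.

Lemma norm_ebase i : `|ebase i| <= 1.
Proof.
by apply: norm_le_coord => // j; rewrite mxE /=; case: eqP; rewrite ?normr1 ?normr0.
Qed.

Lemma dist_le_halves (a b c e : R) :
  `|a - c| < e / 2 -> `|b - c| < e / 2 -> `|a - b| <= e.
Proof.
move=> h1 h2; have -> : a - b = (a - c) - (b - c) by ring.
by apply: (le_trans (ler_normB _ _)); lra.
Qed.

(** Schwarz's theorem: the mean value theorem, applied twice in either order, writes the second
    difference of [f] over a square of side [h] as [h * h] times a mixed derivative at a nearby
    point. Continuity then compares both values with those at [x]. *)
Lemma partialC f i j : C1 f -> C1 (partial i f) -> C1 (partial j f) ->
  partial i (partial j f) = partial j (partial i f).
Proof.
move=> cf cfi cfj; apply/funext => x; apply/eqP; rewrite -subr_eq0 -normr_le0.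
apply/ler_addgt0Pr => e e0; rewrite add0r.
have e2 : 0 < e / 2 by rewrite divr_gt0.
have /cvgrPdist_lt/(_ _ e2)/nbhs_ballP [d1 /= d10 H1] := C1_partial cfj i x.
have /cvgrPdist_lt/(_ _ e2)/nbhs_ballP [d2 /= d20 H2] := C1_partial cfi j x.
(* Two displacements smaller than [h] stay within both balls. *)
pose h := Num.min d1 d2 / 4.
have h0 : 0 < h by rewrite divr_gt0 // lt_min d10 d20.
have near_ball (s t : R) k l d : 0 < s < h -> 0 < t < h -> h * 4 <= d ->
    ball x d (x + s *: ebase k + t *: ebase l).
  move=> /andP[s0 sh] /andP[t0 th] hd; rewrite -ball_normE /ball_ /=.
  rewrite -addrA opprD addNKr normrN.
  apply: (le_lt_trans (ler_normD _ _)); rewrite !normrZ.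
  have := norm_ebase k; have := norm_ebase l.
  rewrite (gtr0_norm s0) (gtr0_norm t0) => a b.
  have : s * `|ebase k| <= s by rewrite ler_piMr // ltW.
  have : t * `|ebase l| <= t by rewrite ler_piMr // ltW.
  lra.
have incr k l : C1 (partial k f) -> C1 (partial l f) ->
   exists s t : R, [/\ 0 < s < h, 0 < t < h &
   f (x + h *: ebase k + h *: ebase l) - f (x + h *: ebase k)
   - (f (x + h *: ebase l) - f x)
   = h * (h * partial l (partial k f) (x + s *: ebase k + t *: ebase l))].
  move=> ck cl.
  have [cg pg] : C1 (fun y => f (y + h *: ebase l) - f y) /\
     forall i, partial i (fun y => f (y + h *: ebase l) - f y) =
      fun y => partial i f (y + h *: ebase l) - partial i f y.
    have [cs ps] : C1 (fun y => f (y + h *: ebase l)) /\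
      forall i, partial i (fun y => f (y + h *: ebase l)) =
        fun y => partial i f (y + h *: ebase l).
      have cadd : continuous (fun y : V => y + h *: ebase l).
        move=> y; apply: (@continuousD R V V id (cst (h *: ebase l)) y).
          exact: cvg_id.
        exact: (@cst_continuous V V _ y).
      apply: C1_of => [y|i0 y|i0 y].
      - exact: (@cont_comp _ _ _ _ f cadd (C1_cont cf) y).
      - have := C1_isder cf (y + h *: ebase l) i0.
        have E : (fun t : R => t^-1 *: (((fun y => f (y + h *: ebase l)) \o shift y)
           (t *: ebase i0) - f (y + h *: ebase l))) =
           (fun t : R => t^-1 *: ((f \o shift (y + h *: ebase l))
           (t *: ebase i0) - f (y + h *: ebase l))).
          by apply/funext => t /=; rewrite addrA.
        move=> [ed ev]; apply: DeriveDef; first by rewrite /derivable E.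
        by rewrite /derive E.
      - exact: (@cont_comp _ _ _ _ _ cadd (C1_partial cf i0) y).
    have [cn pn] := C1_oppP cf; have [ca pa] := C1_addP cs cn.
    by split=> // i0; rewrite pa ps pn.
  (* The increment of [f] in direction [l] is a function of the base point; its own increment in
     direction [k] is the second difference. *)
  have [s sh Es] := mvt_partial x k cg h0.
  have [t th Et] := mvt_partial (x + s *: ebase k) l ck h0.
  by exists s, t; split=> //; rewrite Es pg Et.
have [s [t [sh th E1]]] := incr j i cfj cfi.
have [s' [t' [sh' th' E2]]] := incr i j cfi cfj.
have hd1 : h * 4 <= d1 by rewrite /h divfK // ge_min lexx.
have hd2 : h * 4 <= d2 by rewrite /h divfK // ge_min lexx orbT.
have A1 := H1 _ (near_ball _ _ j i _ sh th hd1).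
have A2 := H2 _ (near_ball _ _ i j _ sh' th' hd2).
have E3 : partial i (partial j f) (x + s *: ebase j + t *: ebase i) =
   partial j (partial i f) (x + s' *: ebase i + t' *: ebase j).
  have hN : h != 0 by rewrite gt_eqF.
  move: E1 E2; rewrite [x + _ + _]addrAC.
  move: (partial i _ _) (partial j _ _) (f _) (f (_ + _)) (f (_ + _)) (f x).
  move=> P Q a b c d E1 E2.
  have E : h * (h * P) = h * (h * Q) by rewrite -E1 -E2; ring.
  exact: (mulfI hN (mulfI hN E)).
rewrite /= E3 in A1; exact: dist_le_halves A1 A2.
Qed.

Lemma smooth_partial {W : normedModType R} (f : V -> W) i :
  smooth f -> smooth (partial i f).
Proof.
move=> sf s; have -> : iter_partial s (partial i f) = iter_partial (rcons s i) f.
  by rewrite /iter_partial foldr_rcons.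
exact: sf.
Qed.

Lemma smooth_C1 f : smooth f -> C1 f.
Proof.
move=> sf; split; first by have [] := sf [::].
by move=> i; split=> [x|]; [have [_ ] := sf [::]; apply|have [] := sf [:: i]].
Qed.

Lemma partial_coord (v : V -> V) i j : (forall x, derivable v x (ebase i)) ->
  partial i (fun y => v y 0 j) = fun x => partial i v x 0 j.
Proof. by move=> dv; apply/funext => x; rewrite /partial derive_mx // mxE. Qed.

Lemma smooth_coord (v : V -> V) j : smooth v -> smooth (fun y => v y 0 j).
Proof.
move=> sv s.
have E : iter_partial s (fun y => v y 0 j) = fun x => iter_partial s v x 0 j.
  elim: s => //= i s ->; rewrite partial_coord // => x.
  by have [_] := sv s; apply.
rewrite E; split=> [x|i x].
  apply: (@continuous_comp _ _ _ (iter_partial s v) (fun M : V => M 0 j)).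
    by have [c _] := sv s; exact: (c x).
  exact: coord_continuous.
by have [_ /(_ i x) /derivable_mxP] := sv s; apply.
Qed.

End Calculus.
Arguments C1_cont {R f} _.
Arguments C1_der {R f} _ x i.
Arguments C1_partial {R f} _ i.
Arguments C1_isder {R f} _ x i.

(** * Lebesgue measure on R^3 and integration over boxes *)

Section Integral.
Context {R : realType}.
Local Notation V := 'rV[R]_3.
Local Notation mR := (measurableTypeR R).
Local Notation T := (mR * mR * mR)%type.
Local Notation leb := (@lebesgue_measure R).
Local Notation mu := (@lebesgue3 R).
Implicit Types (i j : 'I_3).

Lemma ord3P (P : 'I_3 -> Prop) : P 0 -> P 1 -> P 2%:R -> forall i, P i.
Proof.
move=> h0 h1 h2 [[|[|[|//]]] h].
- by have -> : Ordinal h = 0 by exact: val_inj.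
- by have -> : Ordinal h = 1 by exact: val_inj.
- by have -> : Ordinal h = 2%:R by exact: val_inj.
Qed.

Lemma sum_ord3 (W : nmodType) (F : 'I_3 -> W) :
  \sum_i F i = F 0 + F 1 + F 2%:R.
Proof.
rewrite !big_ord_recl big_ord0 addr0 addrA.
by congr (F _ + F _ + F _); apply: val_inj.
Qed.

Lemma vec3_0 (t : R * R * R) : vec3 t 0 0 = t.1.1. Proof. by rewrite mxE. Qed.
Lemma vec3_1 (t : R * R * R) : vec3 t 0 1 = t.1.2. Proof. by rewrite mxE. Qed.
Lemma vec3_2 (t : R * R * R) : vec3 t 0 2%:R = t.2. Proof. by rewrite mxE. Qed.
Definition vec3E := (vec3_0, vec3_1, vec3_2).

(** The sigma-algebra on triples is a product one, so the link with the topology of row vectors goes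
    through rational boxes: an open set is the countable union of those it contains. *)
Lemma measurable_vec3_open (U : set V) : open U -> measurable (vec3 @^-1` U : set T).
Proof.
move=> oU.
pose I := ((rat * rat) * (rat * rat) * (rat * rat))%type.
pose oi (p : rat * rat) : set mR := [set` `]ratr p.1, ratr p.2[].
pose B (p : I) : set T := oi p.1.1 `*` oi p.1.2 `*` oi p.2.
pose F (p : I) := if `[< B p `<=` vec3 @^-1` U >] then B p else set0.
have -> : vec3 @^-1` U = \bigcup_p F p.
  apply/seteqP; split=> [t Ut|t [p _]]; last first.
    by rewrite /F; case: asboolP => // + Bt; apply.
  have /nbhs_ballP[e /= e0 eU] : nbhs (vec3 t) U by exact: open_nbhs_nbhs.
  have H (s : R) : exists p : rat * rat, oi p s /\
      forall s', oi p s' -> `|s - s'| <= e / 2.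
    have [q] := @rat_in_itvoo R (s - e / 2) s ltac:(lra).
    have [q'] := @rat_in_itvoo R s (s + e / 2) ltac:(lra).
    rewrite !in_itv /= => /andP[h1 h2] /andP[h3 h4].
    exists (q, q'); rewrite /oi /= !in_itv /= h1 h4; split=> // s'.
    by rewrite in_itv /= => /andP[h5 h6]; rewrite ler_norml; lra.
  have [p0 [p0t p0e]] := H t.1.1.
  have [p1 [p1t p1e]] := H t.1.2.
  have [p2 [p2t p2e]] := H t.2.
  exists (p0, p1, p2) => //; rewrite /F; case: asboolP; first by [].
  case=> s [[/= s0 s1] s2]; apply: eU; rewrite -ball_normE /ball_ /=.
  apply: (@le_lt_trans _ _ (e / 2)); last by lra.
  apply: norm_le_coord; first by lra.
  by apply: ord3P; rewrite !mxE /=; [exact: p0e|exact: p1e|exact: p2e].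
apply: countable_bigcupT_measurable => [|p]; first exact: countableP.
rewrite /F; case: asboolP => _ //.
by apply: measurableX; [apply: measurableX|]; exact: measurable_itv.
Qed.

Lemma measurable_vec3_fun (f : V -> R) : continuous f ->
  measurable_fun [set: T] (f \o vec3).
Proof.
move=> /continuousP cf.
apply: (measurability _ (RGenOpens.measurableE R)).
move=> _ [_ [a [b ->] <-]]; rewrite setTI.
apply: (@measurable_vec3_open (f @^-1` `]a, b[%classic)); apply: cf.
exact: interval_open.
Qed.

Lemma ftc_itv (g dg : R -> R) a b : a < b ->
  (forall t, is_derive t (1 : R) g (dg t)) -> continuous dg ->
  (\int[leb]_(t in `[a, b]) (dg t)%:E = (g b - g a)%:E)%E.
Proof.
move=> ab gd cdg; rewrite (@continuous_FTC2 _ dg g _ _ ab) //.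
- exact: continuous_subspaceT.
- have cg t : {for t, continuous g}.
    by apply/differentiable_continuous/derivable1_diffP; exact: ex_derive.
  split=> [t _||]; first exact: ex_derive.
  - exact/cvg_at_right_filter/cg.
  - exact/cvg_at_left_filter/cg.
- by move=> t _; rewrite derive1E derive_val.
Qed.

(** The first factor of the nested product [lebesgue3], named so that it can carry the
    sigma-finiteness demanded by Tonelli. *)
Definition lebesgue2 : set (mR * mR) -> \bar R := (leb \x leb)%E.
HB.instance Definition _ := Measure.on lebesgue2.
Lemma lebesgue2_sigma_finite : sigma_finite [set: mR * mR] lebesgue2.
Proof.
have /sigma_finiteP[F [TF ndF Foo]] := sigma_finiteT leb.
exists (fun n => F n `*` F n).
  apply/esym/seteqP; split=> // -[x y] _.
  have [n _ Fnx] : (\bigcup_k F k) x by rewrite -TF.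
  have [k _ Gky] : (\bigcup_k F k) y by rewrite -TF.
  exists (maxn n k) => //; split.
  - by move: x Fnx; exact/subsetPset/ndF/leq_maxl.
  - by move: y Gky; exact/subsetPset/ndF/leq_maxr.
move=> k; have [? ?] := Foo k.
split; first exact: measurableX.
by rewrite /lebesgue2 product_measure1E// lte_mul_pinfty// ge0_fin_numE.
Qed.
HB.instance Definition _ := Measure_isSigmaFinite.Build _ _ _ lebesgue2 lebesgue2_sigma_finite.
Lemma fubini3_G (F : T -> \bar R) : measurable_fun [set: T] F ->
  (forall t, (0 <= F t)%E) ->
  (\int[mu]_t F t = \int[leb]_c \int[lebesgue2]_s F (s, c))%E.
Proof. by move=> mF F0; exact: (fubini_tonelli2 (m1 := lebesgue2) (m2 := leb) F mF F0). Qed.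

Lemma fubini3_F (F : T -> \bar R) : measurable_fun [set: T] F ->
  (forall t, (0 <= F t)%E) ->
  (\int[mu]_t F t = \int[lebesgue2]_s \int[leb]_c F (s, c))%E.
Proof. by move=> mF F0; exact: (fubini_tonelli1 (m1 := lebesgue2) (m2 := leb) F mF F0). Qed.

(** A comparison on every line parallel to an axis integrates to a comparison in space. The nesting
    of the product separates the three axes: the first two take two applications of Tonelli in
    different orders, the last takes one. *)
Lemma tonelli_slice0 (F G : T -> \bar R) :
  measurable_fun [set: T] F -> measurable_fun [set: T] G ->
  (forall t, (0 <= F t)%E) -> (forall t, (0 <= G t)%E) ->
  (forall b c, (\int[leb]_a F (a, b, c) <= \int[leb]_a G (a, b, c))%E) ->
  (\int[mu]_t F t <= \int[mu]_t G t)%E.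
Proof.
move=> mF mG F0 G0 h; rewrite (fubini3_G mF F0) (fubini3_G mG G0).
apply: ge0_le_integral => //.
- by move=> c _; apply: integral_ge0 => s _.
- exact: (measurable_fun_fubini_tonelli_G (m1 := lebesgue2) F).
- exact: (measurable_fun_fubini_tonelli_G (m1 := lebesgue2) G).
move=> c _; have mF1 : measurable_fun [set: mR * mR] (fun s : mR * mR => F (s, c)).
  exact: measurableT_comp.
have mG1 : measurable_fun [set: mR * mR] (fun s : mR * mR => G (s, c)).
  exact: measurableT_comp.
rewrite /lebesgue2 (fubini_tonelli2 _ mF1) // (fubini_tonelli2 _ mG1) //.
apply: ge0_le_integral => //.
- by move=> b _; apply: integral_ge0 => s _.
- exact: measurable_fun_fubini_tonelli_G.
- exact: measurable_fun_fubini_tonelli_G.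
- by move=> b _; exact: h.
Qed.

Lemma tonelli_slice1 (F G : T -> \bar R) :
  measurable_fun [set: T] F -> measurable_fun [set: T] G ->
  (forall t, (0 <= F t)%E) -> (forall t, (0 <= G t)%E) ->
  (forall a c, (\int[leb]_b F (a, b, c) <= \int[leb]_b G (a, b, c))%E) ->
  (\int[mu]_t F t <= \int[mu]_t G t)%E.
Proof.
move=> mF mG F0 G0 h; rewrite (fubini3_G mF F0) (fubini3_G mG G0).
apply: ge0_le_integral => //.
- by move=> c _; apply: integral_ge0 => s _.
- exact: (measurable_fun_fubini_tonelli_G (m1 := lebesgue2) F).
- exact: (measurable_fun_fubini_tonelli_G (m1 := lebesgue2) G).
move=> c _; have mF1 : measurable_fun [set: mR * mR] (fun s : mR * mR => F (s, c)).
  exact: measurableT_comp.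
have mG1 : measurable_fun [set: mR * mR] (fun s : mR * mR => G (s, c)).
  exact: measurableT_comp.
rewrite /lebesgue2 (fubini_tonelli1 _ mF1) // (fubini_tonelli1 _ mG1) //.
apply: ge0_le_integral => //.
- by move=> b _; apply: integral_ge0 => s _.
- exact: measurable_fun_fubini_tonelli_F.
- exact: measurable_fun_fubini_tonelli_F.
- by move=> b _; exact: h.
Qed.

Lemma tonelli_slice2 (F G : T -> \bar R) :
  measurable_fun [set: T] F -> measurable_fun [set: T] G ->
  (forall t, (0 <= F t)%E) -> (forall t, (0 <= G t)%E) ->
  (forall a b, (\int[leb]_c F (a, b, c) <= \int[leb]_c G (a, b, c))%E) ->
  (\int[mu]_t F t <= \int[mu]_t G t)%E.
Proof.
move=> mF mG F0 G0 h; rewrite (fubini3_F mF F0) (fubini3_F mG G0).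
apply: ge0_le_integral => //.
- by move=> s _; apply: integral_ge0 => c _.
- exact: (measurable_fun_fubini_tonelli_F (m2 := leb) F).
- exact: (measurable_fun_fubini_tonelli_F (m2 := leb) G).
- by move=> [a b] _; exact: h.
Qed.

Definition upd i (x : V) (s : R) : V := \row_j (if j == i then s else x 0 j).

Lemma updE i x s : upd i x s = upd i x 0 + s *: ebase i.
Proof.
apply/rowP => j; rewrite !mxE eqxx /=; case: eqP => _; first by rewrite add0r mulr1.
by rewrite mulr0 addr0.
Qed.

Lemma tonelli_slice i (F G : V -> \bar R) :
  measurable_fun [set: T] (F \o vec3) -> measurable_fun [set: T] (G \o vec3) ->
  (forall x, (0 <= F x)%E) -> (forall x, (0 <= G x)%E) ->
  (forall x, (\int[leb]_s F (upd i x s) <= \int[leb]_s G (upd i x s))%E) ->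
  (\int[mu]_t F (vec3 t) <= \int[mu]_t G (vec3 t))%E.
Proof.
move=> mF mG F0 G0; move: i; apply: ord3P => h.
- apply: tonelli_slice0 => // b c; have := h (vec3 (0, b, c)).
  rewrite (_ : upd 0 (vec3 (0, b, c)) = fun a => vec3 (a, b, c)) //.
  by apply/funext => a; apply/rowP; apply: ord3P; rewrite mxE /= !vec3E.
- apply: tonelli_slice1 => // a c; have := h (vec3 (a, 0, c)).
  rewrite (_ : upd 1 (vec3 (a, 0, c)) = fun b => vec3 (a, b, c)) //.
  by apply/funext => b; apply/rowP; apply: ord3P; rewrite mxE /= !vec3E.
- apply: tonelli_slice2 => // a b; have := h (vec3 (a, b, 0)).
  rewrite (_ : upd 2%:R (vec3 (a, b, 0)) = fun c => vec3 (a, b, c)) //.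
  by apply/funext => c; apply/rowP; apply: ord3P; rewrite mxE /= !vec3E.
Qed.

End Integral.

(** * Real-valued integrals of continuous functions over boxes and intervals *)

Section Box.
Context {R : realType}.
Local Notation V := 'rV[R]_3.
Local Notation mR := (measurableTypeR R).
Local Notation T := (mR * mR * mR)%type.
Local Notation leb := (@lebesgue_measure R).
Local Notation mu := (@lebesgue3 R).
Implicit Types (i j : 'I_3).

Definition box (a b : V) : set V := [set x | forall i, a 0 i <= x 0 i <= b 0 i].

Definition boxint (a b : V) (f : V -> R) : R :=
  (\int[mu]_(t in vec3 @^-1` box a b) f (vec3 t))%R.

Lemma boxE (a b : V) : vec3 @^-1` box a b =
  [set` `[a 0 0, b 0 0]] `*` [set` `[a 0 1, b 0 1]] `*` [set` `[a 0 2%:R, b 0 2%:R]].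
Proof.
apply/seteqP; split=> t /=.
  move=> h; rewrite !in_itv /=.
  by have := h 0; have := h 1; have := h 2%:R; rewrite !vec3E.
by move=> [[h0 h1] h2]; apply: ord3P; rewrite vec3E; rewrite in_itv /= in h0 h1 h2.
Qed.

Lemma measurable_box (a b : V) : measurable (vec3 @^-1` box a b : set T).
Proof.
rewrite boxE; apply: measurableX; last exact: measurable_itv.
by apply: measurableX; exact: measurable_itv.
Qed.

Lemma mu_box (a b : V) : (forall i, a 0 i <= b 0 i) ->
  mu (vec3 @^-1` box a b) = (\prod_i (b 0 i - a 0 i))%:E.
Proof.
move=> ab; rewrite boxE /lebesgue3 product_measure1E; last 2 first.
- by apply: measurableX; exact: measurable_itv.
- exact: measurable_itv.
rewrite [X in (X * _)%E]product_measure1E; [|exact: measurable_itv..].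
rewrite /= !lebesgue_measure_itv /= !lte_fin.
have E (i : 'I_3) : (if a 0 i < b 0 i then ((b 0%R i)%:E - (a 0%R i)%:E)%E else 0%E)
    = (b 0 i - a 0 i)%:E.
  by case: ltgtP (ab i) => // -> _; rewrite subrr.
rewrite !E -!EFinM; congr EFin; rewrite !big_ord_recl big_ord0 mulr1 mulrA.
by congr ((b 0 _ - a 0 _) * (b 0 _ - a 0 _) * (b 0 _ - a 0 _)); exact: val_inj.
Qed.

Lemma mu_box_lty (a b : V) : (mu (vec3 @^-1` box a b) < +oo)%E.
Proof.
have [h|] := pselect (forall i, a 0 i <= b 0 i); first by rewrite mu_box // ltry.
move=> /existsNP[i /negP]; rewrite -ltNge => h.
have -> : vec3 @^-1` box a b = set0; last by rewrite /lebesgue3 measure0 ltry.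
by apply/seteqP; split=> // t /(_ i) /andP[h1 h2] /=; have := le_trans h1 h2; rewrite leNgt h.
Qed.

Lemma closed_box (a b : V) : closed (box a b).
Proof.
rewrite (_ : box a b = \bigcap_i ((fun x : V => x 0 i) @^-1` [set` `[a 0 i, b 0 i]])).
  apply: closed_bigI => i _; apply: closed_comp; last exact: itv_closed.
  by move=> x _; exact: coord_continuous.
by apply/seteqP; split=> x h i => [_|]; [have := h i|have := h i I]; rewrite /= in_itv.
Qed.

Lemma compact_box (a b : V) : compact (box a b).
Proof.
apply: bounded_closed_compact; last exact: closed_box.
exists (`|a| + `|b|); split; first exact: num_real.
move=> M hM x hx; apply: norm_le_coord.
  by apply: le_trans (ltW hM); rewrite addr_ge0.
move=> j; apply: le_trans (ltW hM).
have /andP[h1 h2] := hx j; rewrite ler_norml.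
have := ler_norm (b 0 j); have := lerNnormlW (lexx `|a 0 j|).
have := norm_coord_le a j; have := norm_coord_le b j.
have := normr_ge0 a; have := normr_ge0 b.
by move: `|a| `|b| `|a 0 j| `|b 0 j| => *; apply/andP; split; lra.
Qed.

Lemma cont_bounded_box (f : V -> R) a b : continuous f ->
  exists M, 0 <= M /\ forall x, box a b x -> `|f x| <= M.
Proof.
move=> cf; have [[x0 hx0]|h] := pselect (box a b !=set0); last first.
  by exists 0; split=> // x hx; exfalso; apply: h; exists x.
have cn : continuous (fun x => `|f x|).
  by move=> x; apply: (continuous_comp (cf x)); exact: norm_continuous.
have [//||c _ hc] := @EVT_max_rV _ _ (fun x => `|f x|) (box a b) _ (@compact_box a b).
- by exists x0.
- exact: continuous_subspaceT.
by exists `|f c|; split=> // x hx; apply: hc; rewrite inE.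
Qed.

Lemma cont_integrable (f : V -> R) a b : continuous f ->
  mu.-integrable (vec3 @^-1` box a b) (EFin \o (f \o vec3)).
Proof.
move=> cf; apply: measurable_bounded_integrable.
- exact: measurable_box.
- exact: mu_box_lty.
- exact: measurable_funTS (measurable_vec3_fun cf).
- have [M [M0 hM]] := cont_bounded_box a b cf.
  exists M; split; first exact: num_real.
  by move=> N MN t ht /=; apply: le_trans (ltW MN); exact: hM.
Qed.

Lemma EFin_boxint (f : V -> R) a b : continuous f ->
  (boxint a b f)%:E = (\int[mu]_(t in vec3 @^-1` box a b) (f (vec3 t))%:E)%E.
Proof.
move=> cf; rewrite /boxint /Rintegral fineK //.
by apply: (@integrable_fin_num _ _ _ mu); [exact: measurable_box|exact: cont_integrable].
Qed.

Lemma boxint_le (f g : V -> R) a b : continuous f -> continuous g ->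
  (forall x, box a b x -> f x <= g x) -> boxint a b f <= boxint a b g.
Proof.
move=> cf cg fg; apply: (@le_Rintegral _ _ _ mu).
- exact: measurable_box.
- exact: cont_integrable.
- exact: cont_integrable.
- by move=> t ht; exact: fg.
Qed.

Lemma boxint_eq (f g : V -> R) a b :
  (forall x, box a b x -> f x = g x) -> boxint a b f = boxint a b g.
Proof.
by move=> fg; apply: eq_Rintegral => t; rewrite inE => ht; exact: fg.
Qed.

Lemma boxint_ge0 (f : V -> R) a b : (forall x, box a b x -> 0 <= f x) ->
  0 <= boxint a b f.
Proof. by move=> f0; apply: (@Rintegral_ge0 _ _ _ mu) => t ht; exact: f0. Qed.

Lemma boxintD (f g : V -> R) a b : continuous f -> continuous g ->
  boxint a b (fun x => f x + g x) = boxint a b f + boxint a b g.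
Proof.
move=> cf cg; apply: (@RintegralD _ _ _ mu); first exact: measurable_box.
- exact: cont_integrable.
- exact: cont_integrable.
Qed.

Lemma boxintZ (k : R) (f : V -> R) a b : continuous f ->
  boxint a b (fun x => k * f x) = k * boxint a b f.
Proof.
move=> cf; apply: (@RintegralZl _ _ _ mu); first exact: measurable_box.
exact: cont_integrable.
Qed.

Lemma boxint_cst (k : R) (a b : V) : (forall i, a 0 i <= b 0 i) ->
  boxint a b (fun=> k) = k * \prod_i (b 0 i - a 0 i).
Proof.
move=> ab; rewrite /boxint (@Rintegral_cst _ _ _ mu); last exact: measurable_box.
by congr (k * _); exact: (congr1 fine (mu_box ab)).
Qed.

Definition itvint (a b : R) (f : R -> R) : R := (\int[leb]_(s in `[a, b]) f s)%R.

Lemma itv_integrable (f : R -> R) a b : continuous f ->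
  leb.-integrable `[a, b] (EFin \o f).
Proof.
move=> cf; apply: continuous_compact_integrable; first exact: segment_compact.
exact: continuous_subspaceT.
Qed.

Lemma EFin_itvint (f : R -> R) a b : continuous f ->
  (itvint a b f)%:E = (\int[leb]_(t in `[a, b]) (f t)%:E)%E.
Proof.
move=> cf; rewrite /itvint /Rintegral fineK //.
by apply: (@integrable_fin_num _ _ _ leb) => //; exact: itv_integrable.
Qed.

Lemma itvintD (f g : R -> R) a b : continuous f -> continuous g ->
  itvint a b (fun x => f x + g x) = itvint a b f + itvint a b g.
Proof. by move=> cf cg; apply: RintegralD => //; exact: itv_integrable. Qed.

Lemma itvintZ (k : R) (f : R -> R) a b : continuous f ->
  itvint a b (fun x => k * f x) = k * itvint a b f.
Proof. by move=> cf; apply: RintegralZl => //; exact: itv_integrable. Qed.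

Lemma itvint_cst (k : R) a b : a <= b -> itvint a b (fun=> k) = k * (b - a).
Proof.
move=> ab; rewrite /itvint Rintegral_cst //; congr (_ * _).
rewrite /= lebesgue_measure_itv /= lte_fin.
by case: ltgtP ab => // -> _; rewrite subrr.
Qed.

Lemma itvint_le (f g : R -> R) a b : continuous f -> continuous g ->
  (forall x, a <= x <= b -> f x <= g x) -> itvint a b f <= itvint a b g.
Proof.
by move=> cf cg fg; apply: le_Rintegral => //; exact: itv_integrable.
Qed.

Lemma itvint_ftc (g dg : R -> R) a b : a < b ->
  (forall t, is_derive t (1 : R) g (dg t)) -> continuous dg ->
  itvint a b dg = g b - g a.
Proof. by move=> ab gd cdg; rewrite /itvint /Rintegral (ftc_itv ab gd cdg). Qed.

Lemma upd_cont i (x : V) : continuous (upd i x).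
Proof.
move=> s A /nbhs_ballP[e /= e0 eA]; apply/nbhs_ballP; exists e => //= s' ss'.
apply: eA; split=> // j k; rewrite !mxE.
by case: eqP => _ //; exact: ballxx.
Qed.

Lemma is_derive_upd (f : V -> R) i (x : V) t : C1 f ->
  is_derive t (1 : R) (fun s => f (upd i x s)) (partial i f (upd i x t)).
Proof.
move=> cf; have := is_derive_line (C1_der cf (upd i x 0 + t *: ebase i) i).
by rewrite -updE (_ : (fun s => f (upd i x 0 + s *: ebase i)) = (fun s => f (upd i x s)))//;
  apply/funext => s; rewrite -updE.
Qed.

Definition off_box i (a b x : V) := forall j, j != i -> a 0 j <= x 0 j <= b 0 j.

Lemma box_upd i (a b x : V) s :
  box a b (upd i x s) <-> off_box i a b x /\ a 0 i <= s <= b 0 i.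
Proof.
split=> [h|[h hs] j].
  split=> [j ji|]; first by have := h j; rewrite mxE (negbTE ji).
  by have := h i; rewrite mxE eqxx.
by rewrite mxE; case: eqP => [->//|/eqP]; exact: h.
Qed.

Lemma slice_patch i (a b : V) (f : V -> R) x : continuous f ->
  (\int[leb]_s ((EFin \o f) \_ (box a b)) (upd i x s) =
   if `[< off_box i a b x >] then (itvint (a 0%R i) (b 0%R i) (fun s => f (upd i x s)))%:E
   else 0)%E.
Proof.
move=> cf; case: asboolP => h.
  rewrite EFin_itvint; last by apply: cont_comp cf; exact: upd_cont.
  rewrite [RHS]integral_mkcond; apply: eq_integral => s _; rewrite !patchE.
  have -> : (upd i x s \in box a b) = (s \in [set` `[a 0 i, b 0 i]]); last by [].
  by apply/idP/idP; rewrite !inE /= in_itv /= box_upd; tauto.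
rewrite integral0_eq // => s _; rewrite patchE memNset // box_upd.
by move=> [].
Qed.

Lemma boxint_patch (f : V -> R) a b : continuous f ->
  ((boxint a b f)%:E = \int[mu]_t ((EFin \o f) \_ (box a b)) (vec3 t))%E.
Proof.
move=> cf; rewrite EFin_boxint //.
apply: (etrans (@integral_mkcond _ _ _ mu _ _)).
apply: eq_integral => t _; rewrite !patchE.
by have -> : (t \in vec3 @^-1` box a b) = (vec3 t \in box a b) by apply/idP/idP; rewrite !inE.
Qed.

(** The two boxes share their cross-section orthogonal to the i-th axis but may have different
    lengths along it; this is what later enlarges a box one coordinate at a time. *)
Lemma boxint_slice_ge0 i (a b a' b' : V) (f g : V -> R) :
  continuous f -> continuous g ->
  (forall x, box a b x -> 0 <= f x) -> (forall x, box a' b' x -> 0 <= g x) ->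
  (forall j, j != i -> a 0 j = a' 0 j /\ b 0 j = b' 0 j) ->
  (forall x, off_box i a b x -> itvint (a 0 i) (b 0 i) (fun s => f (upd i x s)) <=
     itvint (a' 0 i) (b' 0 i) (fun s => g (upd i x s))) ->
  boxint a b f <= boxint a' b' g.
Proof.
move=> cf cg f0 g0 ab h; have M (k : V -> R) c d : continuous k ->
   measurable_fun [set: T] (((EFin \o k) \_ (box c d)) \o vec3).
  move=> ck; rewrite (_ : _ \o _ = (EFin \o (k \o vec3)) \_ (vec3 @^-1` box c d)).
    apply: (measurable_restrictT _ (@measurable_box c d)).1.
    apply: measurable_funTS; apply/measurable_EFinP.
    exact: measurable_vec3_fun.
  apply/funext => t; rewrite /= !patchE /=.
  by have -> : (t \in vec3 @^-1` box c d) = (vec3 t \in box c d) by apply/idP/idP; rewrite !inE.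
have P (k : V -> R) c d : (forall x, box c d x -> 0 <= k x) ->
   forall x, (0 <= ((EFin \o k) \_ (box c d)) x)%E.
  by move=> k0 x; rewrite patchE; case: ifPn => //; rewrite inE => /k0; rewrite lee_fin.
rewrite -lee_fin (boxint_patch a b cf) (boxint_patch a' b' cg).
apply: (tonelli_slice (i := i)); [exact: M|exact: M|exact: P|exact: P|].
move=> x; rewrite !slice_patch //.
have -> : `[< off_box i a' b' x >] = `[< off_box i a b x >].
  by apply: asbool_equiv_eq; split=> H j ji; have := H j ji; have [-> ->] := ab j ji.
by case: asboolP => // /h; rewrite lee_fin.
Qed.

End Box.

Section BoxTheory.
Context {R : realType}.
Local Notation V := 'rV[R]_3.
Local Notation mR := (measurableTypeR R).
Local Notation T := (mR * mR * mR)%type.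
Local Notation mu := (@lebesgue3 R).
Implicit Types (i j : 'I_3).

Lemma cont_cst (T : topologicalType) (k : R) : continuous (fun _ : T => k).
Proof. exact: cst_continuous. Qed.

(** Signed functions are reduced to nonnegative ones by adding constants [K] to [f] and [K * r] to
    [g]. The ratio [r] of the lengths gives the constants equal integrals on every slice, so they
    cancel at the end. *)
Lemma boxint_slice i (a b a' b' : V) (f g : V -> R) :
  continuous f -> continuous g -> a 0 i < b 0 i -> a' 0 i < b' 0 i ->
  (forall j, j != i -> a 0 j = a' 0 j /\ b 0 j = b' 0 j) ->
  (forall x, off_box i a b x -> itvint (a 0 i) (b 0 i) (fun s => f (upd i x s)) <=
     itvint (a' 0 i) (b' 0 i) (fun s => g (upd i x s))) ->
  boxint a b f <= boxint a' b' g.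
Proof.
move=> cf cg abi abi' ab h.
have [M [M0 hM]] := cont_bounded_box a b cf.
have [M' [M'0 hM']] := cont_bounded_box a' b' cg.
pose r := (b 0 i - a 0 i) / (b' 0 i - a' 0 i).
have d0 : 0 < b' 0 i - a' 0 i by lra.
have r0 : 0 < r by rewrite divr_gt0 //; lra.
pose K := M + M' / r.
have K0 : 0 <= K by rewrite addr_ge0 // divr_ge0 // ltW.
have Kr0 : 0 <= K * r by rewrite mulr_ge0 // ltW.
have KM : M <= K by rewrite lerDl divr_ge0 // ltW.
have KM' : M' <= K * r by rewrite mulrDl divfK ?gt_eqF // lerDr mulr_ge0 // ltW.
have EK : K * (b 0 i - a 0 i) = K * r * (b' 0 i - a' 0 i).
  by rewrite -mulrA /r divfK // gt_eqF.
clearbody K.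
have cu (k : V -> R) x : continuous k -> continuous (fun s => k (upd i x s)).
  by move=> ck; apply: cont_comp ck; exact: upd_cont.
have h1 : boxint a b (fun x => f x + K) <= boxint a' b' (fun x => g x + K * r).
  apply: (boxint_slice_ge0 (i := i)) => //.
  - by apply: cont_add => //; exact: cont_cst.
  - by apply: cont_add => //; exact: cont_cst.
  - by move=> x /hM; rewrite ler_norml => /andP[h1 h2]; lra.
  - by move=> x /hM'; rewrite ler_norml => /andP[h1 h2]; lra.
  - move=> x hx; rewrite !itvintD; try exact: cont_cst; try exact: cu.
    by rewrite (itvint_cst _ (ltW abi)) (itvint_cst _ (ltW abi')) EK lerD2r; exact: h.
have h2 : boxint a' b' (fun=> K * r) <= boxint a b (fun=> K).
  apply: (boxint_slice_ge0 (i := i)) => //; try exact: cont_cst.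
  - by move=> j /ab[-> ->].
  - by move=> x _; rewrite (itvint_cst _ (ltW abi)) (itvint_cst _ (ltW abi')) EK.
by move: h1; rewrite !boxintD; try exact: cont_cst; try by []; lra.
Qed.

(** The source of all integrations by parts: each slice integral is a difference of two boundary
    values, hence zero, and the slice comparison is applied in both directions against the zero
    function. *)
Lemma boxint_partial_le0 i (a b : V) (f : V -> R) : C1 f -> a 0 i < b 0 i ->
  (forall x, box a b x -> x 0 i = a 0 i \/ x 0 i = b 0 i -> f x = 0) ->
  boxint a b (partial i f) = 0.
Proof.
move=> cf ab f0.
have c0 : continuous (fun _ : V => 0 : R) by exact: cont_cst.
have cfi := C1_partial cf i.
have Z x : off_box i a b x ->
    itvint (a 0 i) (b 0 i) (fun s => partial i f (upd i x s)) = 0.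
  move=> hx; have D t := is_derive_upd i x t cf.
  rewrite (itvint_ftc ab D); last by apply: cont_comp cfi; exact: upd_cont.
  have B s : a 0 i <= s <= b 0 i -> box a b (upd i x s) by move=> hs; rewrite box_upd.
  have := ltW ab => ab'.
  rewrite !f0 ?subrr //; try by apply: B; rewrite lexx ab'.
    by left; rewrite mxE eqxx.
  by right; rewrite mxE eqxx.
have E0 : itvint (a 0 i) (b 0 i) (fun=> 0 : R) = 0 by rewrite itvint_cst ?mul0r // ltW.
have J0 : boxint a b (fun=> 0 : R) = 0.
  by have := boxintZ 0 a b c0; rewrite !mul0r.
apply/eqP; rewrite eq_le -[X in _ <= X]J0 -[X in X <= boxint a b (partial i f)]J0.
apply/andP; split; apply: (boxint_slice (i := i)) => // x hx; rewrite Z // E0 //.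
Qed.

Lemma boxint_subset (a b a' b' : V) (f : V -> R) : continuous f ->
  box a b `<=` box a' b' -> (forall x, box a' b' x -> 0 <= f x) ->
  boxint a b f <= boxint a' b' f.
Proof.
move=> cf sub f0; rewrite -lee_fin !EFin_boxint //.
apply: (@ge0_subset_integral _ _ _ mu).
- exact: measurable_box.
- exact: measurable_box.
- by apply: measurable_funTS; apply/measurable_EFinP; exact: measurable_vec3_fun.
- by move=> t /f0; rewrite lee_fin.
- by move=> t; exact: sub.
Qed.

Lemma boxint_disjoint (a b a' b' c d : V) (f : V -> R) : continuous f ->
  box a b `<=` box c d -> box a' b' `<=` box c d ->
  (forall x, box a b x -> box a' b' x -> False) ->
  (forall x, 0 <= f x) ->
  boxint a b f + boxint a' b' f <= boxint c d f.
Proof.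
move=> cf s1 s2 dis f0; rewrite -lee_fin EFinD !EFin_boxint //.
have mf (D : set T) : measurable_fun D (fun t : T => (f (vec3 t))%:E).
  by apply: measurable_funTS; apply/measurable_EFinP; exact: measurable_vec3_fun.
rewrite -(@ge0_integral_setU _ _ _ mu) //.
- apply: (@ge0_subset_integral _ _ _ mu) => //.
  + by apply: measurableU; exact: measurable_box.
  + exact: measurable_box.
  + by move=> t _; rewrite lee_fin.
  + by move=> t [/s1|/s2].
- exact: measurable_box.
- exact: measurable_box.
- by move=> t _; rewrite lee_fin.
- by apply/disj_setPS => t [/= h1 h2]; exact: (dis (vec3 t)).
Qed.

End BoxTheory.

(** * Energy estimates on cubes *)

Section CubeIntegrals.
Context {R : realType}.
Local Notation V := 'rV[R]_3.
Implicit Types (i j : 'I_3).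

Lemma cont_sqr (T : topologicalType) (f : T -> R) n : continuous f ->
  continuous (fun x : T => f x ^+ n).
Proof.
move=> cf; elim: n => [|n IH].
  by rewrite (_ : (fun x => _) = fun=> 1) //; exact: cont_cst.
rewrite (_ : (fun x => _) = (fun x => f x * f x ^+ n)); first exact: cont_mul.
by apply/funext => x; rewrite exprS.
Qed.

Lemma cont_sum (T : topologicalType) (n : nat) (f : 'I_n -> T -> R) :
  (forall k, continuous (f k)) -> continuous (fun x : T => \sum_k f k x).
Proof.
move=> cf; elim: n f cf => [|n IH] f cf.
  rewrite (_ : (fun x => _) = fun=> 0); first exact: cont_cst.
  by apply/funext => x; rewrite big_ord0.
rewrite (_ : (fun x => _) = (fun x => f ord0 x + \sum_k f (lift ord0 k) x)).
  by apply: cont_add => //; exact: IH.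
by apply/funext => x; rewrite big_ord_recl.
Qed.

Lemma boxint_sum (n : nat) (f : 'I_n -> V -> R) a b : (forall k, continuous (f k)) ->
  boxint a b (fun x => \sum_k f k x) = \sum_k boxint a b (f k).
Proof.
elim: n f => [|n IH] f cf.
  rewrite big_ord0 (_ : (fun x => _) = fun=> 0 * 0); last first.
    by apply/funext => x; rewrite big_ord0 mul0r.
  by rewrite boxintZ ?mul0r //; exact: cont_cst.
rewrite big_ord_recl -IH // -boxintD //; last exact: cont_sum.
by apply: boxint_eq => x _; rewrite big_ord_recl.
Qed.

Definition cube (r : R) : set V := box (const_mx (- r)) (const_mx r).

Definition cubeint (r : R) (f : V -> R) : R := boxint (const_mx (- r)) (const_mx r) f.

(** For nonnegative continuous [f] this expresses integrability over the whole space, while keeping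
    every estimate on a cube and in the reals. *)
Definition bddint (f : V -> R) := exists C : R, forall r, 1 <= r -> cubeint r f <= C.

Lemma cubeP (r : R) (x : V) : cube r x <-> forall i, - r <= x 0 i <= r.
Proof. by split=> h i; have := h i; rewrite !mxE. Qed.

Lemma bddint_le (f g : V -> R) : continuous f -> continuous g ->
  (forall x, f x <= g x) -> bddint g -> bddint f.
Proof.
move=> cf cg fg [C hC]; exists C => r r1; apply: le_trans (hC r r1).
by apply: boxint_le.
Qed.

Lemma bddintD (f g : V -> R) : continuous f -> continuous g ->
  bddint f -> bddint g -> bddint (fun x => f x + g x).
Proof.
move=> cf cg [C hC] [D hD]; exists (C + D) => r r1.
by rewrite /cubeint boxintD //; apply: lerD; [exact: hC|exact: hD].
Qed.

Lemma bddintZ (k : R) (f : V -> R) : continuous f -> 0 <= k ->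
  bddint f -> bddint (fun x => k * f x).
Proof.
move=> cf k0 [C hC]; exists (k * C) => r r1.
by rewrite /cubeint boxintZ //; apply: ler_wpM2l => //; exact: hC.
Qed.

Lemma bddint_sum (n : nat) (f : 'I_n -> V -> R) : (forall k, continuous (f k)) ->
  (forall k, bddint (f k)) -> bddint (fun x => \sum_k f k x).
Proof.
move=> cf /choice[C hC]; exists (\sum_k C k) => r r1.
by rewrite /cubeint boxint_sum //; apply: ler_sum => k _; exact: hC.
Qed.

Definition bump (r : R) (t : R) : R := 1 - (t / r) ^+ 2.

(** A polynomial that vanishes on the faces of [cube r]. It is not set to zero outside, since all
    integrals in which it occurs are taken over the cube. *)
Definition cutoff (r : R) (x : V) : R := bump r (x 0 0) * bump r (x 0 1) * bump r (x 0 2%:R).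

Lemma C1_cutoffP (r : R) : 0 < r -> exists dz : 'I_3 -> V -> R,
  [/\ C1 (cutoff r), (forall i, partial i (cutoff r) = dz i) &
   forall x, cube r x -> forall i, `|dz i x| <= 2 / r].
Proof.
move=> r0.
pose db (t : R) : R := - (2 * t / r ^+ 2).
have bd (t : R) : is_derive t (1 : R) (bump r) (db t).
  rewrite (_ : bump r = fun s => 1 - (r ^- 2) * s ^+ 2); last first.
    by apply/funext => s; rewrite /bump exprMn exprVn mulrC.
  apply: is_derive_eq; rewrite /db.
  rewrite add0r mul1r; congr (- _).
  have -> : t%:A + t%:A = 2 * t by rewrite [t%:A]mulr1 mulr_natl mulr2n.
  exact: mulrC.
have cdb : continuous db.
  apply: cont_opp; apply: cont_mul; last exact: cont_cst.
  by apply: cont_mul; [exact: cont_cst|move=> t; exact: cvg_id].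
have cc j : C1 (fun x : V => bump r (x 0 j)) /\
    forall i, partial i (fun x : V => bump r (x 0 j)) =
     fun x => db (x 0 j) * (i == j)%:R.
  have [h1 h2] := @C1_coordP R j.
  have [h3 h4] := C1_compP h1 bd cdb.
  by split=> // i; rewrite h4 h2.
have [c0 p0] := cc 0; have [c1 p1] := cc 1; have [c2 p2] := cc 2%:R.
have [c01 p01] := C1_mulP c0 c1.
have [c012 p012] := C1_mulP c01 c2.
exists (fun i => partial i (cutoff r)); split=> // x /cubeP hx i.
have bb j : 0 <= bump r (x 0 j) <= 1.
  rewrite /bump; have := hx j => /andP[h1 h2].
  have : (x 0 j / r) ^+ 2 <= 1.
    rewrite -real_normK ?num_real // expr_le1 //.
    by rewrite normrM normfV (gtr0_norm r0) ler_pdivrMr // mul1r ler_norml h1.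
  by have := sqr_ge0 (x 0 j / r); lra.
have dbb j : `|db (x 0 j)| <= 2 / r.
  rewrite /db normrN !normrM normfV normrX (gtr0_norm r0) ger0_norm //.
  rewrite ler_pdivrMr ?exprn_gt0 // expr2 mulrA divfK ?gt_eqF //.
  by rewrite ler_pM2l // ler_norml; exact: hx.
have P (a b c : R) : `|a| <= 2 / r -> 0 <= b <= 1 -> 0 <= c <= 1 -> `|a * b * c| <= 2 / r.
  move=> ha /andP[b0 b1] /andP[e0 e1].
  rewrite !normrM (ger0_norm b0) (ger0_norm e0).
  have : `|a| * b * c <= `|a| * 1 * 1.
    by apply: ler_pM => //; [exact: mulr_ge0|apply: ler_pM].
  by rewrite !mulr1 => h; exact: le_trans ha.
have -> := congr1 (fun F => F x) (p012 i : partial i (cutoff r) = _).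
rewrite p01 p0 p1 p2; move: i; apply: ord3P => /=;
  rewrite ?(mulr0, mulr1, mul0r, add0r, addr0).
- have := P _ _ _ (dbb 0) (bb 1) (bb 2%:R); congr (`|_| <= _); ring.
- have := P _ _ _ (dbb 1) (bb 0) (bb 2%:R); congr (`|_| <= _); ring.
- have := P _ _ _ (dbb 2%:R) (bb 0) (bb 1); congr (`|_| <= _); ring.
Qed.

End CubeIntegrals.

Opaque partial.
Ltac solve_cont_leaf := match goal with
  | H : continuous ?f |- continuous ?f => exact H
  | H : C1 ?f |- continuous ?f => exact (C1_cont H)
  | H : forall j, C1 (partial j ?f) |- continuous (partial _ ?f) => exact (C1_cont (H _))
  | H : forall j, C1 (?f j) |- continuous (?f _) => exact (C1_cont (H _))
  | H : forall j, C1 (partial j ?f) |- continuous (partial ?i (partial ?k ?f)) =>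
      exact (C1_partial (H k) i)
  | H : C1 ?f |- continuous (partial ?i ?f) => exact (C1_partial H i)
  | H : forall j, continuous (?f j) |- continuous (?f _) => exact (H _)
  | H : forall j, continuous (partial j ?f) |- continuous (partial _ ?f) => exact (H _)
  end.

Ltac solve_cont := lazymatch goal with
  | |- continuous (fun _ => ?k) => exact: cont_cst
  | |- continuous (fun x => @?f x + @?g x) => refine (@cont_add _ _ f g _ _); solve_cont
  | |- continuous (fun x => @?f x * @?g x) => refine (@cont_mul _ _ f g _ _); solve_cont
  | |- continuous (fun x => - @?f x) => refine (@cont_opp _ _ f _); solve_cont
  | |- continuous (fun x => @?f x ^+ ?n) => refine (@cont_sqr _ _ f n _); solve_cont
  | |- continuous (fun x => ?g x) => change (continuous g); solve_cont_leaf
  | |- _ => solve_cont_leaf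
  end.

(** * Caccioppoli inequality: gradient bounds from a divergence-form Laplacian *)

Section Caccioppoli.
Context {R : realType}.
Local Notation V := 'rV[R]_3.
Implicit Types (i j : 'I_3).

(** The cutoff lives on the cube of twice the size. Its derivatives are at most [2 / (2 * r)], hence
    at most 1; on the inner cube each factor is at least 1 - 1/4, and (3/4)^3 exceeds 1/4. *)
Lemma cutoffP (r : R) : 1 <= r -> exists z : V -> R,
  [/\ C1 z,
   forall x, cube (2 * r) x -> 0 <= z x <= 1 /\ forall i, `|partial i z x| <= 1,
   forall (x : V) i, x 0 i = - (2 * r) \/ x 0 i = 2 * r -> z x = 0 &
   forall x, cube r x -> 1 / 4 <= z x].
Proof.
move=> r1; have r0 : 0 < 2 * r by lra.
have rN : 2 * r != 0 by rewrite gt_eqF.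
have [dz [cz pz dzb]] := C1_cutoffP r0.
exists (cutoff (2 * r)); split=> //.
- move=> x hx; split.
    have bb j : 0 <= bump (2 * r) (x 0 j) <= 1.
      have /andP[h1 h2] := (cubeP _ _).1 hx j.
      have h : (x 0 j / (2 * r)) ^+ 2 <= 1.
        rewrite -real_normK ?num_real // expr_le1 //.
        by rewrite normrM normfV (gtr0_norm r0) ler_pdivrMr // mul1r ler_norml h1.
      by rewrite /bump; have := sqr_ge0 (x 0 j / (2 * r)); lra.
    have /andP[a0 a1] := bb 0; have /andP[b0 b1] := bb 1; have /andP[c0 c1] := bb 2%:R.
    by rewrite /cutoff !mulr_ge0 //= !mulr_ile1 // mulr_ge0.
  move=> i; rewrite pz; apply: (le_trans (dzb _ hx i)).
  by rewrite ler_pdivrMr // mul1r; lra.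
- have b0 t : t = - (2 * r) \/ t = 2 * r -> bump (2 * r) t = 0.
    by rewrite /bump => -[] ->; rewrite ?mulNr divff // ?sqrrN expr1n subrr.
  move=> x; apply: ord3P => /b0 h; rewrite /cutoff h ?mulr0 ?mul0r //.
- move=> x /cubeP hx.
  have bb j : 3 / 4 <= bump (2 * r) (x 0 j).
    rewrite /bump; have /andP[h1 h2] := hx j.
    have h : `|x 0 j / (2 * r)| <= 1 / 2.
      rewrite normrM normfV (gtr0_norm r0) ler_pdivrMr // ler_norml.
      by apply/andP; split; lra.
    have : (x 0 j / (2 * r)) ^+ 2 <= (1 / 2) ^+ 2.
      by rewrite -real_normK ?num_real // lerXn2r ?nnegrE.
    by rewrite [(1 / 2) ^+ 2]expr2; lra.
  rewrite /cutoff.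
  have : (3 / 4) * (3 / 4) * (3 / 4) <= bump (2 * r) (x 0 0) * bump (2 * r) (x 0 1) * bump (2 * r) (x 0 2%:R).
    by apply: ler_pM => //; [lra..|apply: ler_pM => //; lra].
  lra.
Qed.

Lemma cubeint_partial0 (r : R) (f : V -> R) i : 0 < r -> C1 f ->
  (forall x : V, x 0 i = - r \/ x 0 i = r -> f x = 0) ->
  cubeint r (partial i f) = 0.
Proof.
move=> r0 cf f0; apply: boxint_partial_le0 => //; first by rewrite !mxE; lra.
by move=> x _; rewrite !mxE; exact: f0.
Qed.

Lemma cubeint_subset (r s : R) (f : V -> R) : continuous f -> r <= s ->
  (forall x, 0 <= f x) -> cubeint r f <= cubeint s f.
Proof.
move=> cf rs f0; apply: boxint_subset => // x h i; have := h i.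
by rewrite !mxE => /andP[h1 h2]; apply/andP; split; lra.
Qed.

Lemma sqr_le1 (b : R) : `|b| <= 1 -> b ^+ 2 <= 1.
Proof. by move=> h; rewrite -real_normK ?num_real // expr_le1. Qed.

(** Here [a] is the cutoff, [b] its derivative, [U] the function and [w] its derivative. The right
    side is the first-order part of the divergence; the three squares absorb its mixed terms into
    half of the leading one. *)
Lemma caccioppoli_pointwise (a b w f U : R) : 0 <= a -> a <= 1 -> `|b| <= 1 ->
  a ^+ 2 * w ^+ 2 / 2 - (5 * U ^+ 2 + 2 * f ^+ 2) <=
  (w - f) * (a * a * w + U * (a * b + a * b)).
Proof.
move=> a0 a1 /sqr_le1 b1.
have {a0}a1 : a ^+ 2 <= 1 by apply: sqr_le1; rewrite ger0_norm.
have h1 := sqr_ge0 (a * w / 2 + 2 * U * b).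
have h2 := sqr_ge0 (a * w / 2 - a * f).
have h3 := sqr_ge0 (a * b * U - f).
have h4 : U ^+ 2 * b ^+ 2 <= U ^+ 2 by rewrite ler_piMr // sqr_ge0.
have h5 : a ^+ 2 * (U ^+ 2 * b ^+ 2) <= U ^+ 2 * b ^+ 2.
  by rewrite ler_piMl // mulr_ge0 // sqr_ge0.
have h6 : a ^+ 2 * f ^+ 2 <= f ^+ 2 by rewrite ler_piMl // sqr_ge0.
have h7 := sqr_ge0 U.
have : (a * w / 2 + 2 * U * b) ^+ 2 + (a * w / 2 - a * f) ^+ 2 + (a * b * U - f) ^+ 2
  - 4 * (U ^+ 2 * b ^+ 2) - a ^+ 2 * (U ^+ 2 * b ^+ 2) - a ^+ 2 * f ^+ 2 - f ^+ 2 =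
  (w - f) * (a * a * w + U * (a * b + a * b)) - a ^+ 2 * w ^+ 2 / 2 by field.
move: (_ ^+ 2) (_ ^+ 2) h1 h2 h3 h4 h5 h6 h7 => *; lra.
Qed.

(* Integrate the divergence of [z ^+ 2 * u * (grad u - F)] for a cutoff [z]. *)
Lemma caccioppoli (u : V -> R) (F : 'I_3 -> V -> R) :
  C1 u -> (forall i, C1 (partial i u)) -> (forall j, C1 (F j)) ->
  (forall x, \sum_j partial j (partial j u) x = \sum_j partial j (F j) x) ->
  bddint (fun x => u x ^+ 2) -> (forall j, bddint (fun x => F j x ^+ 2)) ->
  forall i, bddint (fun x => partial i u x ^+ 2).
Proof.
move=> cu cdu cF E bu bF i.
have cF2 j : continuous (fun x => F j x ^+ 2) by solve_cont.
pose S x := 15 * u x ^+ 2 + 2 * \sum_j F j x ^+ 2.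
have cFs : continuous (fun x => \sum_j F j x ^+ 2) by exact: cont_sum.
have cS : continuous S by rewrite /S; solve_cont.
have [C hC] : bddint S.
  apply: bddintD; [by solve_cont|by solve_cont| |].
    by apply: bddintZ; [solve_cont|exact: ler0n|].
  by apply: bddintZ; [solve_cont|exact: ler0n|exact: bddint_sum].
(* A factor 16 pays for [z >= 1 / 4] on the inner cube, and a factor 2 for the half lost in the
   pointwise bound. *)
exists (32 * C) => r r1.
have [z [cz z1 z0 z4]] := cutoffP r1.
have [cz2 pz2] := C1_mulP cz cz.
have [cz2u pz2u] := C1_mulP cz2 cu.
have cG j : C1 (fun x => z x * z x * u x * (partial j u x + - F j x)) /\
   partial j (fun x => z x * z x * u x * (partial j u x + - F j x)) = fun x =>
     z x * z x * u x * (partial j (partial j u) x - partial j (F j) x) +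
     (partial j u x - F j x) *
       (z x * z x * partial j u x + u x * (z x * partial j z x + z x * partial j z x)).
  have [cn pn] := C1_oppP (cF j).
  have [ca pa] := C1_addP (cdu j) cn.
  have [cm pm] := C1_mulP cz2u ca.
  by split=> //; rewrite pm pa pn pz2u pz2.
pose D x := \sum_j partial j (fun x => z x * z x * u x * (partial j u x + - F j x)) x.
have cD : continuous D.
  by apply: cont_sum => j; apply: C1_partial; have [] := cG j.
have D0 : cubeint (2 * r) D = 0.
  rewrite /cubeint boxint_sum; last by move=> j; apply: C1_partial; have [] := cG j.
  apply: big1 => j _; apply: cubeint_partial0; first lra.
    by have [] := cG j.
  by move=> x /z0 ->; rewrite !mul0r.
have c2 : continuous (fun x => partial i u x ^+ 2) by solve_cont.
have key x : cube (2 * r) x ->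
   z x ^+ 2 * partial i u x ^+ 2 <= 2 * (D x + S x).
  move=> hx; have [/andP[za zb] zd] := z1 x hx.
  have pt j : z x ^+ 2 * partial j u x ^+ 2 / 2 - (5 * u x ^+ 2 + 2 * F j x ^+ 2) <=
    (partial j u x - F j x) *
       (z x * z x * partial j u x + u x * (z x * partial j z x + z x * partial j z x)).
    by apply: caccioppoli_pointwise => //; exact: zd.
  (* The second-order terms carry the factor Delta u - div F, which is zero by [E]. *)
  have ED : D x = \sum_j (partial j u x - F j x) *
       (z x * z x * partial j u x + u x * (z x * partial j z x + z x * partial j z x)).
    rewrite /D; under eq_bigr do rewrite (cG _).2.
    rewrite big_split /= -mulr_sumr.
    have -> : \sum_j (partial j (partial j u) x - partial j (F j) x) = 0.
      by rewrite big_split /= sumrN E subrr.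
    by rewrite mulr0 add0r.
  have : \sum_j (z x ^+ 2 * partial j u x ^+ 2 / 2 - (5 * u x ^+ 2 + 2 * F j x ^+ 2)) <= D x.
    by rewrite ED; apply: ler_sum => j _; exact: pt.
  rewrite big_split /= sumrN big_split /= -!mulr_sumr sumr_const card_ord.
  have : z x ^+ 2 * partial i u x ^+ 2 / 2 <= \sum_j z x ^+ 2 * partial j u x ^+ 2 / 2.
    rewrite (bigD1 i) //= lerDl; apply: sumr_ge0 => j _.
    by rewrite divr_ge0 // mulr_ge0 // sqr_ge0.
  rewrite -[_ *+ 3]mulr_natl /S. move: (\sum_j _) (\sum_j _) => *; lra.
have cz2' : continuous (fun x => z x ^+ 2 * partial i u x ^+ 2).
  by solve_cont.
have h1 : cubeint r (fun x => partial i u x ^+ 2) <=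
   cubeint (2 * r) (fun x => 16 * (z x ^+ 2 * partial i u x ^+ 2)).
  apply: (@le_trans _ _ (cubeint r (fun x => 16 * (z x ^+ 2 * partial i u x ^+ 2)))).
    apply: boxint_le => //; first by solve_cont.
    move=> x hx; have hz := z4 x hx; rewrite mulrA ler_peMl ?sqr_ge0 //.
    have : (1 / 4) ^+ 2 <= z x ^+ 2 by rewrite lerXn2r ?nnegrE //; lra.
    by rewrite [(1 / 4) ^+ 2]expr2; lra.
  apply: cubeint_subset; [by solve_cont|lra|].
  by move=> x; apply: mulr_ge0; [exact: ler0n|rewrite mulr_ge0 ?sqr_ge0].
have h2 : cubeint (2 * r) (fun x => 16 * (z x ^+ 2 * partial i u x ^+ 2)) <=
   cubeint (2 * r) (fun x => 32 * D x + 32 * S x).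
  apply: boxint_le; [by solve_cont|by solve_cont|].
  by move=> x /key; move: (S x) (D x) => *; lra.
apply: (le_trans h1 (le_trans h2 _)).
rewrite /cubeint boxintD; [|by solve_cont|by solve_cont]; rewrite (boxintZ _ _ _ cD) (boxintZ _ _ _ cS).
have := D0; rewrite /cubeint => ->; rewrite mulr0 add0r ler_pM2l ?ltr0n //.
by apply: hC; lra.
Qed.

End Caccioppoli.

(** * Fourth powers of the gradient of a bounded function *)

Section GagliardoNirenberg.
Context {R : realType}.
Local Notation V := 'rV[R]_3.
Implicit Types (i j : 'I_3).

(** The right side is the derivative of [z ^+ 4 * u * g ^+ 3] with [g] the derivative of [u] and [h]
    that of [g]. Each of the two squares spends a quarter of [a ^+ 4 * g ^+ 4]: one on the term with
    [h], the other on the term with the cutoff derivative [b]. *)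
Lemma gagliardo_pointwise (a b g h U M : R) : 0 <= a -> a <= 1 -> `|b| <= 1 -> `|U| <= M ->
  a ^+ 4 * g ^+ 4 / 2 - M ^+ 2 * (16 * g ^+ 2 + 9 * h ^+ 2) <=
  a * a * (a * a) * U * (g * (g * h + g * h) + g * g * h) +
  g * (g * g) * (a * a * (a * a) * g + U * (a * a * (a * b + a * b) + a * a * (a * b + a * b))).
Proof.
move=> a0 a1 /sqr_le1 b1 UM.
have {a0}a1 : a ^+ 2 <= 1 by apply: sqr_le1; rewrite ger0_norm.
have {UM}U1 : U ^+ 2 <= M ^+ 2.
  rewrite -real_normK ?num_real // lerXn2r ?nnegrE //.
  exact: le_trans UM.
have h1 := sqr_ge0 (a ^+ 2 * g ^+ 2 / 2 + 3 * a ^+ 2 * U * h).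
have h2 := sqr_ge0 (a ^+ 2 * g ^+ 2 / 2 + 4 * a * b * U * g).
have c1 : a ^+ 2 * b ^+ 2 <= 1 by rewrite mulr_ile1 ?sqr_ge0.
have c2 : a ^+ 2 * a ^+ 2 <= 1 by rewrite mulr_ile1 ?sqr_ge0.
have d1 : a ^+ 2 * b ^+ 2 * (U ^+ 2 * g ^+ 2) <= M ^+ 2 * g ^+ 2.
  apply: (@le_trans _ _ (U ^+ 2 * g ^+ 2)); first by rewrite ler_piMl // mulr_ge0 ?sqr_ge0.
  by rewrite ler_wpM2r ?sqr_ge0.
have d2 : a ^+ 2 * a ^+ 2 * (U ^+ 2 * h ^+ 2) <= M ^+ 2 * h ^+ 2.
  apply: (@le_trans _ _ (U ^+ 2 * h ^+ 2)); first by rewrite ler_piMl // mulr_ge0 ?sqr_ge0.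
  by rewrite ler_wpM2r ?sqr_ge0.
have E : (a ^+ 2 * g ^+ 2 / 2 + 3 * a ^+ 2 * U * h) ^+ 2 +
   (a ^+ 2 * g ^+ 2 / 2 + 4 * a * b * U * g) ^+ 2 -
   16 * (a ^+ 2 * b ^+ 2 * (U ^+ 2 * g ^+ 2)) - 9 * (a ^+ 2 * a ^+ 2 * (U ^+ 2 * h ^+ 2)) =
   (a * a * (a * a) * U * (g * (g * h + g * h) + g * g * h) +
   g * (g * g) * (a * a * (a * a) * g + U * (a * a * (a * b + a * b) + a * a * (a * b + a * b))))
   - a ^+ 4 * g ^+ 4 / 2 by field.
rewrite mulrDr; lra.
Qed.

(* Integrate [partial i (z ^+ 4 * u * partial i u ^+ 3)] for a cutoff [z]. *)
Lemma gagliardo_nirenberg (u : V -> R) i (M : R) :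
  C1 u -> C1 (partial i u) -> (forall x, `|u x| <= M) ->
  bddint (fun x => partial i u x ^+ 2) ->
  bddint (fun x => partial i (partial i u) x ^+ 2) ->
  bddint (fun x => partial i u x ^+ 4).
Proof.
move=> cu cg uM b1 b2.
pose S x := M ^+ 2 * (16 * partial i u x ^+ 2 + 9 * partial i (partial i u) x ^+ 2).
have cS : continuous S by rewrite /S; solve_cont.
have [C hC] : bddint S.
  apply: bddintZ; [solve_cont|exact: sqr_ge0|apply: bddintD; [solve_cont|solve_cont|..]].
    by apply: bddintZ; [solve_cont|exact: ler0n|].
  by apply: bddintZ; [solve_cont|exact: ler0n|].
(* Now the fourth power of the cutoff is inverted: 512 = 2 * 4^4. *)
exists (512 * C) => r r1.
have [z [cz z1 z0 z4]] := cutoffP r1.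
have [cz2 pz2] := C1_mulP cz cz.
have [cz4 pz4] := C1_mulP cz2 cz2.
have [czu pzu] := C1_mulP cz4 cu.
have [cg2 pg2] := C1_mulP cg cg.
have [cg3 pg3] := C1_mulP cg cg2.
have [cG pG] := C1_mulP czu cg3.
set G := (fun x => _) in cG pG.
have G0 : cubeint (2 * r) (partial i G) = 0.
  apply: cubeint_partial0 => //; first lra.
  by move=> x /z0 E; rewrite /G E !mul0r.
have cD := C1_partial cG i.
have key x : cube (2 * r) x ->
   z x ^+ 4 * partial i u x ^+ 4 <= 2 * (partial i G x + S x).
  move=> hx; have [/andP[za zb] zd] := z1 x hx.
  have := gagliardo_pointwise (partial i u x) (partial i (partial i u) x) za zb (zd i) (uM x).
  rewrite -/(S x); set X := (X in _ <= X -> _).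
  have -> : partial i G x = X by rewrite pG pzu pz4 pz2 pg3 pg2.
  by clearbody X; move: (S x) => ? gp; lra.
have h1 : cubeint r (fun x => partial i u x ^+ 4) <=
   cubeint (2 * r) (fun x => 256 * (z x ^+ 4 * partial i u x ^+ 4)).
  apply: (@le_trans _ _ (cubeint r (fun x => 256 * (z x ^+ 4 * partial i u x ^+ 4)))).
    apply: boxint_le; [solve_cont|solve_cont|].
    move=> x hx; have hz := z4 x hx; rewrite mulrA ler_peMl ?exprn_even_ge0 //.
    have : (1 / 4) ^+ 4 <= z x ^+ 4 by rewrite lerXn2r ?nnegrE //; lra.
    have -> : (1 / 4 : R) ^+ 4 = 256^-1 by field.
    by move=> /(ler_wpM2l (ler0n R 256)); rewrite mulfV; last by rewrite pnatr_eq0.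
  apply: cubeint_subset; [by solve_cont|lra|].
  move=> x; apply: mulr_ge0; first exact: ler0n.
  by rewrite mulr_ge0 ?exprn_even_ge0.
have h2 : cubeint (2 * r) (fun x => 256 * (z x ^+ 4 * partial i u x ^+ 4)) <=
   cubeint (2 * r) (fun x => 512 * partial i G x + 512 * S x).
  apply: boxint_le; [by solve_cont|by solve_cont|].
  by move=> x /key; move: (S x) (partial i G x) => *; lra.
apply: (le_trans h1 (le_trans h2 _)).
rewrite /cubeint boxintD; [|by solve_cont|by solve_cont]; rewrite (boxintZ _ _ _ cD) (boxintZ _ _ _ cS).
have := G0; rewrite /cubeint => ->; rewrite mulr0 add0r ler_pM2l ?ltr0n //.
by apply: hC; lra.
Qed.

End GagliardoNirenberg.

(** * Limit at infinity of functions with square integrable derivatives *)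

Section IntervalExpansion.
Context {R : realType}.
Local Notation leb := (@lebesgue_measure R).

Lemma itvint_subset (a b a' b' : R) (f : R -> R) : continuous f ->
  a' <= a -> b <= b' -> (forall t, 0 <= f t) -> itvint a b f <= itvint a' b' f.
Proof.
move=> cf aa bb f0; rewrite -lee_fin !EFin_itvint //.
apply: ge0_subset_integral => //.
- apply: measurable_funTS; apply/measurable_EFinP.
  exact: continuous_measurable_fun.
- by move=> t _; rewrite lee_fin.
- by move=> t /=; rewrite !in_itv /= => /andP[h1 h2]; apply/andP; split; lra.
Qed.

Lemma osc_le_itvint (g dg G : R -> R) a b s t :
  (forall t, is_derive t (1 : R) g (dg t)) -> continuous dg -> continuous G ->
  (forall t, `|dg t| <= G t) -> a <= s <= b -> a <= t <= b ->
  `|g s - g t| <= itvint a b G.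
Proof.
move=> gd cdg cG dgG /andP[s1 s2] /andP[t1 t2].
have G0 u : 0 <= G u by apply: le_trans (dgG u).
have H u v : a <= u -> u < v -> v <= b -> `|g v - g u| <= itvint a b G.
  move=> au uv vb; rewrite -(itvint_ftc uv gd cdg).
  apply: (@le_trans _ _ (itvint u v G)); last exact: itvint_subset.
  rewrite ler_norml; apply/andP; split.
    rewrite lerNl -mulN1r -itvintZ //; apply: itvint_le => //.
      by apply: cont_mul => //; exact: cont_cst.
    by move=> w _; have := dgG w; rewrite ler_norml => /andP[h1 h2]; lra.
  by apply: itvint_le => // w _; apply: le_trans (dgG w); exact: ler_norm.
case: (ltgtP s t) => [st|ts|->].
- by rewrite distrC; exact: H.
- exact: H.
- rewrite subrr normr0 /itvint; apply: Rintegral_ge0 => u _; exact: G0.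
Qed.

(** A value of [g] exceeds its mean over the large interval by at most the oscillation there, which
    the integral of [G] bounds. *)
Lemma itvint_expand1 (g dg G : R -> R) a b a' b' :
  (forall t, is_derive t (1 : R) g (dg t)) -> continuous dg -> continuous G ->
  (forall t, `|dg t| <= G t) -> a' <= a -> a < b -> b <= b' ->
  itvint a b g <= (b - a) / (b' - a') * itvint a' b' g + (b - a) * itvint a' b' G.
Proof.
move=> gd cdg cG dgG aa ab bb.
have cg := is_derive_continuous gd.
have d0 : 0 < b' - a' by lra.
set N := itvint a' b' G; set K := itvint a' b' g / (b' - a') + N.
have -> : (b - a) / (b' - a') * itvint a' b' g + (b - a) * N = K * (b - a).
  by rewrite /K; ring.
rewrite -(itvint_cst K (ltW ab)); apply: itvint_le => //; first exact: cont_cst.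
move=> s /andP[s1 s2]; rewrite /K -lerBlDr ler_pdivlMr //.
rewrite -itvint_cst; last lra.
apply: itvint_le => //; first exact: cont_cst.
move=> t ht; have : `|g s - g t| <= N.
  by apply: (osc_le_itvint gd cdg) => //; apply/andP; split; lra.
by rewrite ler_norml => /andP[_]; clearbody N => *; lra.
Qed.

(** The tangent line at the common midpoint is subtracted: its slope integrates to zero over
    symmetric intervals, so the first derivative drops out. The remainder [4 * r * N] costs
    [8 * r ^+ 2 * N] on either interval after rescaling. *)
Lemma itvint_expand2 (g dg ddg G : R -> R) m r : 0 < r ->
  (forall t, is_derive t (1 : R) g (dg t)) ->
  (forall t, is_derive t (1 : R) dg (ddg t)) -> continuous ddg -> continuous G ->
  (forall t, `|ddg t| <= G t) ->
  itvint (m - r) (m + r) g <=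
  1 / 4 * itvint (m - 4 * r) (m + 4 * r) g + 16 * r ^+ 2 * itvint (m - 4 * r) (m + 4 * r) G.
Proof.
move=> r0 gd dgd cddg cG ddgG.
have cg := is_derive_continuous gd.
set N := itvint (m - 4 * r) (m + 4 * r) G.
have taylor t : m - 4 * r <= t <= m + 4 * r ->
    `|g t - (g m + dg m * (t - m))| <= 4 * r * N.
  move=> ht.
  pose h s := g s - dg m * s.
  have hd s : is_derive s (1 : R) h (dg s - dg m).
    apply: is_deriveB => //; apply: is_derive_eq.
    by rewrite [_ *: _]mulr1.
  have ch := is_derive_continuous hd.
  have ob s : m - 4 * r <= s <= m + 4 * r -> `|dg s - dg m| <= N.
    by move=> hs; apply: (osc_le_itvint dgd cddg) => //; apply/andP; split; lra.
  have N0 : 0 <= N by apply: le_trans (ob m _) => //; apply/andP; split; lra.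
  have -> : g t - (g m + dg m * (t - m)) = h t - h m by rewrite /h; ring.
  have H u v : m - 4 * r <= u -> u < v -> v <= m + 4 * r -> v - u <= 4 * r ->
      `|h v - h u| <= 4 * r * N.
    move=> u1 uv v1 vu; have [c] := MVT uv (fun s _ => hd s) (continuous_subspaceT ch).
    rewrite in_itv /= => /andP[c1 c2] ->; rewrite normrM mulrC.
    apply: ler_pM => //; first by rewrite ger0_norm; lra.
    by apply: ob; apply/andP; split; lra.
  move: ht => /andP[t1 t2].
  case: (ltgtP t m) => [tm|mt|->].
  - by rewrite distrC; apply: H; lra.
  - by apply: H; lra.
  - by rewrite subrr normr0 mulr_ge0 //; lra.
pose l t := g m + dg m * (t - m).
have cid : continuous (fun t : R => t - m).
  by apply: cont_add; [move=> t; exact: cvg_id|exact: cont_cst].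
have cl : continuous l.
  by apply: cont_add; [exact: cont_cst|apply: cont_mul; [exact: cont_cst|exact: cid]].
have intl s : 0 < s -> itvint (m - s) (m + s) l = 2 * s * g m.
  move=> s0.
  have ld t : is_derive t (1 : R) (fun t => g m * t + dg m * ((t - m) ^+ 2 / 2)) (l t).
    apply: is_derive_eq; rewrite /l.
    by rewrite /GRing.scale /=; field.
  by rewrite (itvint_ftc _ ld cl); [field|lra].
have cN (k : R) : continuous (fun _ : R => k) by exact: cont_cst.
have h1 : itvint (m - r) (m + r) g <= itvint (m - r) (m + r) (fun t => l t + 4 * r * N).
  apply: itvint_le => //; first exact: cont_add.
  move=> t /andP[t1 t2]; have : m - 4 * r <= t <= m + 4 * r by apply/andP; split; lra.
  by move=> /taylor; rewrite ler_norml -/(l t) => /andP[_]; lra.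
have h2 : itvint (m - 4 * r) (m + 4 * r) (fun t => l t + - (4 * r * N)) <=
    itvint (m - 4 * r) (m + 4 * r) g.
  apply: itvint_le => //; first exact: cont_add.
  by move=> t /taylor; rewrite ler_norml -/(l t) => /andP[]; lra.
move: h1 h2; rewrite (itvintD _ _ cl (cN _)) (itvintD _ _ cl (cN _)).
rewrite (intl r r0) (intl (4 * r)); last lra.
rewrite itvint_cst ?itvint_cst; try lra.
Qed.

End IntervalExpansion.

(** * Comparison of averages over cubes of ratio four *)

Section Morrey.
Context {R : realType}.
Local Notation V := 'rV[R]_3.
Implicit Types (i j : 'I_3).

Definition cbox_lo (x : V) (r : R) : V := x - const_mx r.
Definition cbox_hi (x : V) (r : R) : V := x + const_mx r.
Definition cboxint (x : V) (r : R) (f : V -> R) : R :=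
  boxint (cbox_lo x r) (cbox_hi x r) f.

Lemma cbox_loE x r i : cbox_lo x r 0 i = x 0 i - r.
Proof. by rewrite !mxE. Qed.
Lemma cbox_hiE x r i : cbox_hi x r 0 i = x 0 i + r.
Proof. by rewrite !mxE. Qed.

Lemma expand_arith (J0 J1 J2 J3 g1 g2 g3 c : R) :
  J0 <= 1 / 4 * J1 + c * g1 -> J1 <= 1 / 4 * J2 + c * g2 -> J2 <= 1 / 4 * J3 + c * g3 ->
  g1 <= g3 -> g2 <= g3 -> 0 <= g3 -> 0 <= c -> J0 <= 1 / 64 * J3 + 2 * c * g3.
Proof.
move=> s1 s2 s3 h1 h2 h3 c0.
have k1 : c * g1 <= c * g3 by rewrite ler_wpM2l.
have k2 : c * g2 <= c * g3 by rewrite ler_wpM2l.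
have k3 : 0 <= c * g3 by rewrite mulr_ge0.
by rewrite -mulrA; lra.
Qed.

(** The small cube is stretched into the large one along one axis after another. Each stretch gains
    1/4, so that 1/64 is the ratio of the volumes, and the errors sum to at most c + c/4 + c/16 <= 2
    * c times the integral of [G] over the large cube. *)
Lemma boxint_expand (x y : V) (r c : R) (f G : V -> R) : 0 < r -> 0 <= c ->
  continuous f -> continuous G -> (forall z, 0 <= G z) ->
  (forall i, `|x 0 i - y 0 i| <= 3 * r) ->
  (forall i z, itvint (x 0 i - r) (x 0 i + r) (fun s => f (upd i z s)) <=
     1 / 4 * itvint (y 0 i - 4 * r) (y 0 i + 4 * r) (fun s => f (upd i z s)) +
     c * itvint (y 0 i - 4 * r) (y 0 i + 4 * r) (fun s => G (upd i z s))) ->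
  cboxint x r f <= 1 / 64 * cboxint y (4 * r) f + 2 * c * cboxint y (4 * r) G.
Proof.
move=> r0 c0 cf cG G0 xy h.
have la0 i : y 0 i - 4 * r <= cbox_lo x r 0 i.
  have := xy i; rewrite cbox_loE ler_norml => /andP[h1 h2].
  by move: (x 0 i) (y 0 i) h1 h2 => *; lra.
have lb0 i : cbox_hi x r 0 i <= y 0 i + 4 * r.
  have := xy i; rewrite cbox_hiE ler_norml => /andP[h1 h2].
  by move: (x 0 i) (y 0 i) h1 h2 => *; lra.
have step i (a b : V) : a 0 i = x 0 i - r -> b 0 i = x 0 i + r ->
    boxint a b f <= 1 / 4 * boxint (upd i a (y 0 i - 4 * r)) (upd i b (y 0 i + 4 * r)) f +
      c * boxint (upd i a (y 0 i - 4 * r)) (upd i b (y 0 i + 4 * r)) G.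
  move=> ai bi; rewrite -!boxintZ // -boxintD; [|by solve_cont|by solve_cont].
  apply: (boxint_slice (i := i)) => //; first by solve_cont.
  - by rewrite ai bi; lra.
  - by rewrite !mxE eqxx; lra.
  - by move=> j ji; rewrite !mxE (negbTE ji).
  - have cu (k : V -> R) z : continuous k -> continuous (fun s => k (upd i z s)).
      by move=> ck; apply: cont_comp ck; exact: upd_cont.
    move=> z _; rewrite ai bi !mxE eqxx.
    rewrite itvintD; [|by apply: cont_mul; [exact: cont_cst|exact: cu]..].
    by rewrite !itvintZ; [exact: h|exact: cu|exact: cu].
pose a0 := cbox_lo x r; pose b0 := cbox_hi x r.
pose a1 := upd 0 a0 (y 0 0 - 4 * r); pose b1 := upd 0 b0 (y 0 0 + 4 * r).
pose a2 := upd 1 a1 (y 0 1 - 4 * r); pose b2 := upd 1 b1 (y 0 1 + 4 * r).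
pose a3 := upd 2%:R a2 (y 0 2%:R - 4 * r); pose b3 := upd 2%:R b2 (y 0 2%:R + 4 * r).
have s1 := step 0 a0 b0 (cbox_loE _ _ _) (cbox_hiE _ _ _).
have s2 : boxint a1 b1 f <= 1 / 4 * boxint a2 b2 f + c * boxint a2 b2 G.
  by apply: step; rewrite !mxE.
have s3 : boxint a2 b2 f <= 1 / 4 * boxint a3 b3 f + c * boxint a3 b3 G.
  by apply: step; rewrite !mxE.
have ea : a3 = cbox_lo y (4 * r).
  by apply/rowP; apply: ord3P; rewrite !mxE.
have eb : b3 = cbox_hi y (4 * r).
  by apply/rowP; apply: ord3P; rewrite !mxE.
have la j (a : V) : (forall i, y 0 i - 4 * r <= a 0 i) ->
    forall i, y 0 i - 4 * r <= upd j a (y 0 j - 4 * r) 0 i.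
  by move=> ha i; rewrite mxE; case: eqP => [->|].
have lb j (b : V) : (forall i, b 0 i <= y 0 i + 4 * r) ->
    forall i, upd j b (y 0 j + 4 * r) 0 i <= y 0 i + 4 * r.
  by move=> ha i; rewrite mxE; case: eqP => [->|].
have sub (a b : V) : (forall i, y 0 i - 4 * r <= a 0 i) -> (forall i, b 0 i <= y 0 i + 4 * r) ->
    boxint a b G <= boxint a3 b3 G.
  move=> ha hb; apply: boxint_subset => // z hz i.
  have /andP[h1 h2] := hz i; rewrite ea eb cbox_loE cbox_hiE.
  by apply/andP; split; [exact: le_trans h1|exact: le_trans (hb i)].
have sub1 : boxint a1 b1 G <= boxint a3 b3 G by apply: sub; [exact: la|exact: lb].
have sub2 : boxint a2 b2 G <= boxint a3 b3 G.
  by apply: sub; [exact: (la _ _ (la _ _ _))|exact: (lb _ _ (lb _ _ _))].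
have J0 : 0 <= boxint a3 b3 G by apply: boxint_ge0.
rewrite /cboxint -ea -eb.
exact: (expand_arith s1 s2 s3 sub1 sub2 J0 c0).
Qed.

Definition avg (x : V) (r : R) (f : V -> R) : R := cboxint x r f / (2 * r) ^+ 3.

Lemma cboxint_cst x r (k : R) : 0 <= r -> cboxint x r (fun=> k) = k * (2 * r) ^+ 3.
Proof.
move=> r0; rewrite /cboxint boxint_cst; last first.
  by move=> i; rewrite cbox_loE cbox_hiE; lra.
congr (_ * _); rewrite (eq_bigr (fun=> 2 * r)); last first.
  by move=> i _; rewrite cbox_loE cbox_hiE; ring.
by rewrite prodr_const card_ord.
Qed.

(* The radius is [s ^+ 2] so that the AM-GM weight [k = d / s ^+ 3] stays rational
   in the scale: the cubes then gain [s^-1] with first derivatives and [s] with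
   second derivatives. *)
Lemma avg_expand (x y : V) (s d c : R) (f W : V -> R) : 0 < s -> 0 < d -> 0 <= c ->
  continuous f -> continuous W -> (forall z, 0 <= W z) ->
  (forall i, `|x 0 i - y 0 i| <= 3 * s ^+ 2) ->
  (forall (k : R) i z, 0 < k ->
     itvint (x 0 i - s ^+ 2) (x 0 i + s ^+ 2) (fun t => f (upd i z t)) <=
     1 / 4 * itvint (y 0 i - 4 * s ^+ 2) (y 0 i + 4 * s ^+ 2) (fun t => f (upd i z t)) +
     c * itvint (y 0 i - 4 * s ^+ 2) (y 0 i + 4 * s ^+ 2) (fun t => k + k^-1 * W (upd i z t))) ->
  avg x (s ^+ 2) f <= avg y (4 * s ^+ 2) f +
     c / (4 * s ^+ 3) * (512 * d + cboxint y (4 * s ^+ 2) W / d).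
Proof.
move=> s0 d0 c0 cf cW W0 xy h.
have r0 : 0 < s ^+ 2 by rewrite exprn_gt0.
pose k := d / s ^+ 3.
have k0 : 0 < k by rewrite divr_gt0 // exprn_gt0.
have cG : continuous (fun z => k + k^-1 * W z) by solve_cont.
have kV : 0 < k^-1 by rewrite invr_gt0.
have G0 z : 0 <= k + k^-1 * W z by apply: addr_ge0; [exact: ltW|apply: mulr_ge0 => //; exact: ltW].
have EG : cboxint y (4 * s ^+ 2) (fun z => k + k^-1 * W z) =
    k * (2 * (4 * s ^+ 2)) ^+ 3 + k^-1 * cboxint y (4 * s ^+ 2) W.
  have r4 : 0 <= 4 * s ^+ 2 by rewrite mulr_ge0 // ltW.
  rewrite -(cboxint_cst y k r4) /cboxint -boxintZ // -boxintD //; last by solve_cont.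
  exact: cont_cst.
have := boxint_expand r0 c0 cf cG G0 xy (fun i z => h k i z k0); rewrite EG => H.
have v0 : 0 < (2 * s ^+ 2) ^+ 3 by rewrite exprn_gt0 // mulr_gt0.
rewrite /avg ler_pdivrMr //; apply: (le_trans H).
rewrite le_eqVlt; apply/orP; left; apply/eqP.
rewrite /k; field.
by rewrite !gt_eqF.
Qed.

End Morrey.

Section ScaleChains.
Context {R : realType}.
Local Notation V := 'rV[R]_3.
Implicit Types (i j : 'I_3).

Lemma avgN (x : V) r (f : V -> R) : continuous f ->
  avg x r (fun z => - f z) = - avg x r f.
Proof.
move=> cf; rewrite /avg /cboxint -mulNr; congr (_ / _).
rewrite -mulN1r -boxintZ //; apply: boxint_eq => z _; rewrite mulN1r //.
Qed.

Lemma abs_le_amgm (a k w : R) : 0 < k -> a ^+ 2 <= w -> `|a| <= k + k^-1 * w.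
Proof.
move=> k0 aw; have [h|h] := leP `|a| k.
  have w0 : 0 <= w by apply: le_trans aw; exact: sqr_ge0.
  by rewrite (le_trans h) // lerDl mulr_ge0 // invr_ge0 ltW.
have : `|a| <= k^-1 * w.
  rewrite -ler_pdivrMl ?invr_gt0 // invrK (le_trans _ aw) //.
  by rewrite -[X in _ <= X]real_normK ?num_real // expr2 ler_wpM2r // ltW.
by move/le_trans; apply; rewrite lerDr ltW.
Qed.

(** The centres may differ by as much as keeps the small cube inside the large one. This freedom is
    what later links two distant points to one common average. *)
Lemma avg_step1_le (x y : V) (s d : R) (f W : V -> R) : 0 < s -> 0 < d ->
  C1 f -> continuous W -> (forall i z, partial i f z ^+ 2 <= W z) ->
  (forall i, `|x 0 i - y 0 i| <= 3 * s ^+ 2) ->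
  avg x (s ^+ 2) f <= avg y (4 * s ^+ 2) f +
     s^-1 * (512 * d + cboxint y (4 * s ^+ 2) W / d).
Proof.
move=> s0 d0 cf cW fW xy.
have W0 z : 0 <= W z by apply: le_trans (fW 0 z); exact: sqr_ge0.
have s20 : 0 < s ^+ 2 by rewrite exprn_gt0.
have J0 : 0 <= cboxint y (4 * s ^+ 2) W by apply: boxint_ge0.
have B0 : 0 <= 512 * d + cboxint y (4 * s ^+ 2) W / d.
  apply: addr_ge0; first by apply: mulr_ge0; [exact: ler0n|exact: ltW].
  by apply: divr_ge0; [exact: J0|exact: ltW].
apply: (le_trans (avg_expand (c := 2 * s ^+ 2) s0 d0 _ (C1_cont cf) cW W0 xy _)).
- by rewrite mulr_ge0 // ltW.
- move=> k i z k0; have D t := is_derive_upd i z t cf.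
  have := itvint_expand1 (a := x 0 i - s ^+ 2) (b := x 0 i + s ^+ 2)
     (a' := y 0 i - 4 * s ^+ 2) (b' := y 0 i + 4 * s ^+ 2)
     (G := fun t => k + k^-1 * W (upd i z t)) D.
  have -> : (x 0 i + s ^+ 2 - (x 0 i - s ^+ 2)) / (y 0 i + 4 * s ^+ 2 - (y 0 i - 4 * s ^+ 2)) = 1 / 4.
    by field; apply: contraTneq s20 => h; rewrite lt_neqAle; apply/negP=> /andP[]; lra.
  have -> : x 0 i + s ^+ 2 - (x 0 i - s ^+ 2) = 2 * s ^+ 2 by ring.
  have := xy i; rewrite ler_norml => /andP[h1 h2].
  apply; try lra.
  + by apply: cont_comp (C1_partial cf i); exact: upd_cont.
  + have cu : continuous (fun t => W (upd i z t)) by apply: cont_comp cW; exact: upd_cont.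
    by solve_cont.
  + by move=> t; apply: abs_le_amgm.
- rewrite lerD2l ler_wpM2r // ler_pdivrMr ?mulr_gt0 ?exprn_gt0 //.
  have -> : s^-1 * (4 * s ^+ 3) = 4 * s ^+ 2 by field; rewrite gt_eqF.
  by rewrite ler_wpM2r ?(ltW s20) // ler_nat.
Qed.

(** Here the cubes are concentric, because the linear part is removed by symmetry. *)
Lemma avg_step2_le (x : V) (s d : R) (f W : V -> R) : 0 < s -> 0 < d ->
  C1 f -> (forall i, C1 (partial i f)) -> continuous W ->
  (forall i z, partial i (partial i f) z ^+ 2 <= W z) ->
  avg x (s ^+ 2) f <= avg x (4 * s ^+ 2) f +
     4 * s * (512 * d + cboxint x (4 * s ^+ 2) W / d).
Proof.
move=> s0 d0 cf cdf cW fW.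
have W0 z : 0 <= W z by apply: le_trans (fW 0 z); exact: sqr_ge0.
have s20 : 0 < s ^+ 2 by rewrite exprn_gt0.
apply: (le_trans (avg_expand (c := 16 * (s ^+ 2) ^+ 2) (y := x) s0 d0 _ (C1_cont cf) cW W0 _ _)).
- by rewrite mulr_ge0 // ?sqr_ge0.
- by move=> i; rewrite subrr normr0 mulr_ge0 // ltW.
- move=> k i z k0; have D t := is_derive_upd i z t cf.
  have D2 t := is_derive_upd i z t (cdf i).
  apply: (itvint_expand2 _ s20 D D2).
  + by apply: cont_comp (C1_partial (cdf i) i); exact: upd_cont.
  + have cu : continuous (fun t => W (upd i z t)) by apply: cont_comp cW; exact: upd_cont.
    by solve_cont.
  + by move=> t; apply: abs_le_amgm.
- rewrite lerD2l; have -> : 16 * (s ^+ 2) ^+ 2 / (4 * s ^+ 3) = 4 * s.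
    by field; rewrite gt_eqF.
  by [].
Qed.

Lemma telescope_dist (u : nat -> R) (T : R) (K : nat) :
  (forall n, (n < K)%N -> `|u n - u n.+1| <= T * 2^-1 ^+ n) ->
  `|u 0%N - u K| <= 2 * T * (1 - 2^-1 ^+ K).
Proof.
elim: K => [_|K IH h]; first by rewrite subrr normr0 expr0 subrr mulr0.
have -> : u 0%N - u K.+1 = (u 0%N - u K) + (u K - u K.+1) by ring.
apply: (le_trans (ler_normD _ _)).
have h1 := IH (fun n nK => h n (ltnW nK)); have h2 := h K (leqnn _).
rewrite exprS; move: (_ ^+ K) h1 h2 => q h1 h2; lra.
Qed.

Lemma avg_near (x : V) (f : V -> R) (e : R) : continuous f -> 0 < e ->
  exists2 d, 0 < d & forall r, 0 < r -> r < d -> `|avg x r f - f x| <= e.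
Proof.
move=> cf e0; have /cvgrPdist_lt/(_ _ e0)/nbhs_ballP [d /= d0 H] := cf x.
exists d => // r r0 rd.
have r3 : 0 < (2 * r) ^+ 3 by rewrite exprn_gt0 // mulr_gt0.
have cc (k : R) : continuous (fun _ : V => k) by exact: cont_cst.
have B z : box (cbox_lo x r) (cbox_hi x r) z -> `|f x - f z| < e.
  move=> hz; apply: H; rewrite -ball_normE /ball_ /=; apply: le_lt_trans rd.
  apply: norm_le_coord; first exact: ltW.
  by move=> j; have := hz j; rewrite cbox_loE cbox_hiE !mxE ler_norml => /andP[h1 h2]; apply/andP; split; lra.
have h1 : cboxint x r f <= (f x + e) * (2 * r) ^+ 3.
  rewrite -(cboxint_cst x _ (ltW r0)); apply: boxint_le => // z /B.
  by rewrite ltr_norml => /andP[k1 k2]; lra.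
have h2 : (f x - e) * (2 * r) ^+ 3 <= cboxint x r f.
  rewrite -(cboxint_cst x _ (ltW r0)); apply: boxint_le => // z /B.
  by rewrite ltr_norml => /andP[k1 k2]; lra.
rewrite ler_norml /avg; apply/andP; split.
  by rewrite lerBrDr addrC ler_pdivlMr.
by rewrite lerBlDr addrC ler_pdivrMr.
Qed.

(** A centred cube almost attains the supremum of the integrals over cubes. A box outside it fits
    with it into a larger cube, so only the deficit [e] is left for the box. *)
Lemma bddint_tail (W : V -> R) : continuous W -> (forall z, 0 <= W z) -> bddint W ->
  exists E, [/\ 0 <= E, (forall a b, boxint a b W <= E) &
   forall e, 0 < e -> exists M, forall a b, (forall x, box a b x -> M < `|x|) ->
     boxint a b W <= e].
Proof.
move=> cW W0 [C hC].
pose A := [set cubeint r W | r in [set r | 1 <= r]].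
have supA : has_sup A.
  split; first by exists (cubeint 1 W), 1 => //=.
  by exists C => _ [r r1 <-]; exact: hC.
have ubA r : 1 <= r -> cubeint r W <= sup A by move=> r1; apply: sup_upper_bound => //; exists r.
have incl a b N : `|a| <= N -> `|b| <= N -> box a b `<=` cube N.
  move=> aN bN x hx; apply/cubeP => i; have /andP[h1 h2] := hx i.
  have := le_trans (norm_coord_le a i) aN; have := le_trans (norm_coord_le b i) bN.
  by rewrite !ler_norml => /andP[k1 k2] /andP[k3 k4]; apply/andP; split; lra.
exists (sup A); split.
- apply: le_trans (ubA 1 _) => //; exact: boxint_ge0.
- move=> a b; pose N := Num.max 1 (Num.max `|a| `|b|).
  apply: (@le_trans _ _ (cubeint N W)); last by apply: ubA; rewrite le_max lexx.
  by apply: boxint_subset => //; apply: incl; rewrite !le_max lexx !orbT.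
- move=> e e0; have [_ [M /= M1 <-] hM] := sup_adherent e0 supA.
  exists M => a b hab; pose N := Num.max M (Num.max `|a| `|b|).
  have MN : M <= N by rewrite le_max lexx.
  have h : cubeint M W + boxint a b W <= cubeint N W.
    apply: boxint_disjoint => //.
    + by move=> x hx i; have := hx i; rewrite !mxE => /andP[k1 k2]; apply/andP; split; lra.
    + by apply: incl; rewrite !le_max lexx !orbT.
    + move=> x /cubeP hx /hab; rewrite ltNge; apply/negP; rewrite negbK.
      by apply: norm_le_coord => [|j]; [lra|rewrite ler_norml; exact: hx].
  have := ubA N (le_trans M1 MN); move: h hM.
  by move: (cubeint M W) (cubeint N W) (boxint a b W) (sup A) => *; lra.
Qed.

End ScaleChains.

(** * Convergence at infinity from L^2 bounds on first and second derivatives *)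

Section PressureDecay.
Context {R : realType}.
Local Notation V := 'rV[R]_3.
Implicit Types (i j : 'I_3).

Lemma norm_const_mx (M : R) : 0 <= M -> `|const_mx M : V| = M.
Proof.
move=> M0; apply/eqP; rewrite eq_le; apply/andP; split.
  by apply: norm_le_coord => // j; rewrite mxE ger0_norm.
by have := norm_coord_le (const_mx M : V) 0; rewrite mxE ger0_norm.
Qed.

Lemma at_infinity_proper : ProperFilter (@at_infinity R).
Proof.
apply: filter_from_proper; last first.
  move=> M _; exists (const_mx (`|M| + 1)) => /=.
  by rewrite norm_const_mx; have := ler_norm M; have := normr_ge0 M; lra.
apply: filter_from_filter; first by exists 0.
move=> M N _ _; exists (Num.max M N) => // x /=.
by rewrite gt_max => /andP[].
Qed.

Lemma at_infinityP (P : set V) : at_infinity P <-> exists M, forall x, M < `|x| -> P x.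
Proof.
split=> [[M _ h]|[M h]]; first by exists M => x; exact: h.
by exists M.
Qed.

Lemma cauchy_at_infinity (f : V -> R) :
  (forall e, 0 < e -> exists M, forall x y, M < `|x| -> M < `|y| -> `|f x - f y| <= e) ->
  exists c : R, f x @[x --> at_infinity] --> c.
Proof.
move=> h; have PF := at_infinity_proper.
suff /cvg_ex : [cvg (f @ at_infinity) in R] by [].
apply: cauchy_cvg; apply/cauchy_exP => e e0.
have e2 : 0 < e / 2 by rewrite divr_gt0.
have [M hM] := h _ e2.
pose x0 : V := const_mx (`|M| + 1).
have hx0 : M < `|x0|.
  by rewrite norm_const_mx; have := ler_norm M; have := normr_ge0 M; lra.
exists (f x0); apply/at_infinityP; exists M => x hx.
rewrite -ball_normE /ball_ /=; apply: (le_lt_trans (hM _ _ hx0 hx)); lra.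
Qed.

Lemma exp2_small (e : R) : 0 < e -> exists K : nat, (2^-1 : R) ^+ K <= e.
Proof.
move=> e0; pose K := (Num.truncn e^-1).+1; exists K.
have h : e^-1 < K%:R by rewrite /K truncnS_gt.
have h2 : K%:R <= (2 : R) ^+ K by rewrite -natrX ler_nat ltnW // ltn_expl.
rewrite exprVn -[X in _ <= X]invrK lef_pV2 ?posrE ?invr_gt0 ?exprn_gt0 //.
exact: le_trans (ltW h) h2.
Qed.

(** The chain runs from the value [px] through averages about the point at a tiny scale, at scale 1,
    and at two large scales, to the average [A] about the origin. The links down from scale K cost
    at most (1 + 4 + 2) * T1 = e / 4, the remaining ones at most 3 * (qK * T2) <= e / 4. *)
Lemma chain_arith (a1 aK aN an A px T1 T2 d e qK qn qN : R) :
  `|a1 - aK| <= 2 * T1 * (1 - qK) -> `|aK - aN| <= 2 * (qK * T2) * (1 - qN) ->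
  `|a1 - an| <= 2 * (2 * T1) * (1 - qn) -> `|an - px| <= d -> `|aN - A| <= qK * T2 ->
  d <= T1 -> 28 * T1 = e -> 12 * (qK * T2) <= e -> 0 <= T1 -> 0 <= T2 ->
  0 <= qK -> 0 <= qn -> 0 <= qN -> `|px - A| <= e / 2.
Proof.
move=> c1 c2 c3 c4 c5 dT Ed hK T10 T20 qK0 qn0 qN0.
have h1 : 0 <= T1 * qK by rewrite mulr_ge0.
have h2 : 0 <= (qK * T2) * qN by rewrite !mulr_ge0.
have h3 : 0 <= T1 * qn by rewrite mulr_ge0.
move: c1 c2 c3 c4 c5; rewrite !ler_norml.
move=> /andP[? ?] /andP[? ?] /andP[? ?] /andP[? ?] /andP[? ?].
by apply/andP; split; nra.
Qed.

(* Averages over dyadic cubes: first derivatives control the large scales and pure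
   second derivatives the small ones, and both geometric series are small where the
   tail of the energy is. *)
Lemma morrey_limit (p : V -> R) : C1 p -> (forall i, C1 (partial i p)) ->
  (forall i, bddint (fun x => partial i p x ^+ 2)) ->
  (forall i, bddint (fun x => partial i (partial i p) x ^+ 2)) ->
  exists c : R, p x @[x --> at_infinity] --> c.
Proof.
move=> cp cdp b1 b2.
pose W z := \sum_i (partial i p z ^+ 2 + partial i (partial i p) z ^+ 2).
have cdd i : continuous (partial i (partial i p)) by exact: C1_partial.
have cWi i : continuous (fun z => partial i p z ^+ 2 + partial i (partial i p) z ^+ 2) by solve_cont.
have cW : continuous W by exact: cont_sum.
have Wi0 i z : 0 <= partial i p z ^+ 2 + partial i (partial i p) z ^+ 2.
  by rewrite addr_ge0 ?sqr_ge0.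
have W0 z : 0 <= W z by apply: sumr_ge0 => i _; exact: Wi0.
have WW i z : partial i p z ^+ 2 + partial i (partial i p) z ^+ 2 <= W z.
  by rewrite /W (bigD1 i) //= lerDl; apply: sumr_ge0 => j _; exact: Wi0.
have W1 i z : partial i p z ^+ 2 <= W z by apply: le_trans (WW i z); rewrite lerDl sqr_ge0.
have W2 i z : partial i (partial i p) z ^+ 2 <= W z.
  by apply: le_trans (WW i z); rewrite lerDr sqr_ge0.
have bW : bddint W.
  by apply: bddint_sum => // i; apply: bddintD; [solve_cont|solve_cont|exact: b1|exact: b2].
have [E [E0 hE tail]] := bddint_tail cW W0 bW.
(* The one-sided comparisons applied to [- p] yield the lower bounds. *)
have [cn pn] := C1_oppP cp.
have cdn i : C1 (partial i (fun x => - p x)).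
  by rewrite pn; have [] := C1_oppP (cdp i).
have pnn i : partial i (partial i (fun x => - p x)) = fun x => - partial i (partial i p) x.
  by rewrite pn (C1_oppP (cdp i)).2.
have S1 (x y : V) s d : 0 < s -> 0 < d -> (forall i, `|x 0 i - y 0 i| <= 3 * s ^+ 2) ->
    `|avg x (s ^+ 2) p - avg y (4 * s ^+ 2) p| <=
     s^-1 * (512 * d + cboxint y (4 * s ^+ 2) W / d).
  move=> s0 d0 xy; have h1 := avg_step1_le s0 d0 cp cW W1 xy.
  have nW1 i z : partial i (fun x => - p x) z ^+ 2 <= W z by rewrite pn sqrrN.
  have := avg_step1_le s0 d0 cn cW nW1 xy; rewrite !avgN; [|exact: C1_cont..].
  by move: h1; rewrite ler_norml => h1 h2; apply/andP; split; lra.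
have S2 (x : V) s d : 0 < s -> 0 < d ->
    `|avg x (s ^+ 2) p - avg x (4 * s ^+ 2) p| <=
     4 * s * (512 * d + cboxint x (4 * s ^+ 2) W / d).
  move=> s0 d0; have h1 := avg_step2_le x s0 d0 cp cdp cW W2.
  have nW2 i z : partial i (partial i (fun x => - p x)) z ^+ 2 <= W z by rewrite pnn sqrrN.
  have := avg_step2_le x s0 d0 cn cdn cW nW2; rewrite !avgN; [|exact: C1_cont..].
  by move: h1; rewrite ler_norml => h1 h2; apply/andP; split; lra.
apply: cauchy_at_infinity => e e0.
have [B1 B11] : exists B : R, B = 513 by exists 513.
have [B2 B22] : exists B : R, B = 512 by exists 512.
have B2p : 0 < B2 by rewrite B22 ltr0n.
have B12 : B1 = B2 + 1 by rewrite B11 B22 -natr1.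
rewrite -B22 in S1 S2; clear B11 B22; subst B1.
(* This [d] weighs the cubes that see only the tail of the energy. Tail energy at most [d ^+ 2]
   makes each error at most [(B2 + 1) * d] times the scale factor. All other cubes use weight 1 and
   the total energy [E]. *)
pose d := e / (28 * (B2 + 1)).
have d0 : 0 < d by rewrite divr_gt0 // mulr_gt0 //; lra.
have Ed : 28 * ((B2 + 1) * d) = e by rewrite /d; field; rewrite gt_eqF //; lra.
pose T2 := B2 + E.
have T20 : 0 < T2 by rewrite /T2; lra.
have [K hK] : exists K : nat, (2^-1 : R) ^+ K <= e / (12 * T2).
  by apply: exp2_small; rewrite divr_gt0 // mulr_gt0.
have {}hK : 12 * (2^-1 ^+ K * T2) <= e.
  by move: hK; rewrite ler_pdivlMr ?mulr_gt0 // mulrCA.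
have [M0 hM0] := tail (d ^+ 2) (exprn_gt0 2 d0).
have sq n : 4 * ((2 : R) ^+ n) ^+ 2 = (2 ^+ n.+1) ^+ 2 by rewrite [2 ^+ n.+1]exprS; ring.
have p2 n : 0 < (2 : R) ^+ n by rewrite exprn_gt0.
have q2 n : 0 < (2^-1 : R) ^+ n by rewrite exprn_gt0 // invr_gt0.
have q2le1 n : (2^-1 : R) ^+ n <= 1 by rewrite exprn_ile1 ?invr_ge0 // invf_le1 // ler1n.
have p2ge1 n : 1 <= (2 : R) ^+ n by rewrite exprn_ege1 // ler1n.
have T10 : 0 < (B2 + 1) * d by rewrite mulr_gt0 //; lra.
(* A cube of half-side at most 4^K about a point of norm above [M] avoids the region of norm at most
   [M0]. *)
pose M := M0 + (2 ^+ K) ^+ 2.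
have half (x : V) N : M < `|x| -> (K <= N)%N -> (forall i, `|x 0 i| <= 3 * (2 ^+ N) ^+ 2) ->
    `|p x - avg 0 (4 * (2 ^+ N) ^+ 2) p| <= e / 2.
  move=> hx KN xN.
  have far r : r <= (2 ^+ K) ^+ 2 -> B2 * d + cboxint x r W / d <= (B2 + 1) * d.
    move=> hr; rewrite mulrDl mul1r lerD2l ler_pdivrMr // -expr2; apply: hM0 => z hz.
    have [r0|r0] := leP 0 r; last first.
      by have := hz 0; rewrite cbox_loE cbox_hiE => /andP[h1 h2]; lra.
    have h : `|x - z| <= r.
      apply: norm_le_coord => // j; have := hz j.
      by rewrite cbox_loE cbox_hiE !mxE ler_norml => /andP[h1 h2]; apply/andP; split; lra.
    have : `|x| <= `|x - z| + `|z| by rewrite -{1}[x](subrK z) ler_normD.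
    by move: hx; rewrite /M; move: `|x| `|z| `|x - z| h => *; lra.
  have T2le y r : B2 * 1 + cboxint y r W / 1 <= T2.
    by rewrite mulr1 divr1 lerD2l; exact: hE.
  (* From scale 1 to 4^K the cubes are far out, so the tail energy suffices. *)
  have c1 : `|avg x ((2 ^+ 0) ^+ 2) p - avg x ((2 ^+ K) ^+ 2) p| <=
      2 * ((B2 + 1) * d) * (1 - 2^-1 ^+ K).
    apply: (@telescope_dist _ (fun n => avg x ((2 ^+ n) ^+ 2) p)) => n nK.
    rewrite -sq; apply: (le_trans (S1 x x (2 ^+ n) d _ _ _)) => //.
      by move=> i; rewrite subrr normr0 mulr_ge0 // sqr_ge0.
    rewrite -exprVn mulrC ler_wpM2r ?(ltW (q2 n)) //; apply: far.
    by rewrite sq lerXn2r ?nnegrE ?(ltW (p2 _)) // ler_weXn2l // ler1n.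
  (* Beyond 4^K the cubes may meet the core; smallness comes from the factor 2^(-K). *)
  have c2 : `|avg x ((2 ^+ (K + 0)) ^+ 2) p - avg x ((2 ^+ (K + (N - K))) ^+ 2) p| <=
      2 * (2^-1 ^+ K * T2) * (1 - 2^-1 ^+ (N - K)).
    apply: (@telescope_dist _ (fun n => avg x ((2 ^+ (K + n)) ^+ 2) p)) => n _.
    rewrite addnS -sq; apply: (le_trans (S1 x x (2 ^+ (K + n)) 1 _ _ _)) => //.
      by move=> i; rewrite subrr normr0 mulr_ge0 // sqr_ge0.
    by rewrite -exprVn exprD [X in _ <= X]mulrAC ler_wpM2l ?(ltW (mulr_gt0 (q2 K) (q2 n))) //; exact: T2le.
  have [rho rho0 hrho] := avg_near x (C1_cont cp) d0.
  have [n hn] : exists n : nat, (2^-1 : R) ^+ n <= rho / 2.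
    by apply: exp2_small; rewrite divr_gt0.
  (* Below scale 1 the second derivatives take over, with a factor decreasing with the scale. *)
  have c3 : `|avg x ((2^-1 ^+ 0) ^+ 2) p - avg x ((2^-1 ^+ n) ^+ 2) p| <=
      2 * (2 * ((B2 + 1) * d)) * (1 - 2^-1 ^+ n).
    apply: (@telescope_dist _ (fun n => avg x ((2^-1 ^+ n) ^+ 2) p)) => m _.
    have E4 : (2^-1 ^+ m) ^+ 2 = 4 * (2^-1 ^+ m.+1) ^+ 2 :> R by rewrite [2^-1 ^+ m.+1]exprS; field.
    rewrite distrC E4; apply: (le_trans (S2 x (2^-1 ^+ m.+1) d _ _)) => //.
    have -> : 4 * 2^-1 ^+ m.+1 = 2 * 2^-1 ^+ m :> R by rewrite [2^-1 ^+ m.+1]exprS; field.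
    rewrite [X in _ <= X]mulrAC ler_wpM2l //.
    apply: far; rewrite -E4; apply: (@le_trans _ _ 1).
      by rewrite exprn_ile1 // ltW.
    by rewrite exprn_ege1.
  have c4 : `|avg x ((2^-1 ^+ n) ^+ 2) p - p x| <= d.
    apply: hrho; first by rewrite exprn_gt0.
    apply: (@le_lt_trans _ _ (2^-1 ^+ n)); first by rewrite expr2 ler_piMl // ltW.
    lra.
  have c5 : `|avg x ((2 ^+ N) ^+ 2) p - avg 0 (4 * (2 ^+ N) ^+ 2) p| <= 2^-1 ^+ K * T2.
    apply: (le_trans (S1 x 0 (2 ^+ N) 1 _ _ _)) => //.
      by move=> i; rewrite [(0 : V) 0 i]mxE subr0.
    apply: ler_pM => //.
      rewrite mulr1 divr1 addr_ge0 ?(ltW B2p) //; exact: boxint_ge0.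
    by rewrite -exprVn ler_wiXn2l // ?invr_ge0 // invf_le1 // ler1n.
  rewrite addn0 subnKC // in c2.
  rewrite !expr0 expr1n in c1 c3.
  have dB : d <= (B2 + 1) * d by rewrite ler_peMl ?(ltW d0) //; lra.
  exact: (chain_arith c1 c2 c3 c4 c5 dB Ed hK (ltW T10) (ltW T20) (ltW (q2 K))
    (ltW (q2 n)) (ltW (q2 (N - K)%N))).
exists M => x y hx hy.
(* One scale reaches the origin from both points, so both are compared with the same average. *)
have [N [KN Nx Ny]] : exists N, [/\ (K <= N)%N, `|x| <= 3 * (2 ^+ N) ^+ 2 &
    `|y| <= 3 * (2 ^+ N) ^+ 2].
  have mx : 0 < `|x| + `|y| + 1 by have := normr_ge0 x; have := normr_ge0 y; lra.
  have [N hN] : exists N : nat, (2^-1 : R) ^+ N <= (`|x| + `|y| + 1)^-1.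
    by apply: exp2_small; rewrite invr_gt0.
  exists (maxn K N); have {}hN : `|x| + `|y| + 1 <= 2 ^+ maxn K N.
    apply: (@le_trans _ _ (2 ^+ N)); last by rewrite ler_weXn2l ?leq_maxr // ler1n.
    by move: hN; rewrite exprVn lef_pV2 ?posrE.
  have h2 : (2 : R) ^+ maxn K N <= 3 * (2 ^+ maxn K N) ^+ 2.
    rewrite expr2 mulrA ler_peMl ?(ltW (p2 _)) //.
    by have := p2ge1 (maxn K N); lra.
  have := normr_ge0 x; have := normr_ge0 y.
  by rewrite leq_maxl; split=> //; lra.
have hx2 := half x N hx KN (fun i => le_trans (norm_coord_le x i) Nx).
have hy2 := half y N hy KN (fun i => le_trans (norm_coord_le y i) Ny).
have -> : p x - p y = (p x - avg 0 (4 * (2 ^+ N) ^+ 2) p) - (p y - avg 0 (4 * (2 ^+ N) ^+ 2) p) by ring.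
by rewrite (le_trans (ler_normB _ _)) // (le_trans (lerD hx2 hy2)) // -splitr.
Qed.

End PressureDecay.

(** * Maximum principle *)

Section MaxPrinciple.
Context {R : realType}.
Local Notation V := 'rV[R]_3.
Implicit Types (i j : 'I_3).

Lemma cont_gt_near (f : V -> R) (c : V) (a : R) : continuous f -> a < f c ->
  exists2 d, 0 < d & forall y, `|y - c| < d -> a < f y.
Proof.
move=> cf ac; have e0 : 0 < f c - a by lra.
have /cvgrPdist_lt/(_ _ e0)/nbhs_ballP [d /= d0 H] := cf c.
exists d => // y yc; have : `|f c - f y| < f c - a.
  by apply: H; rewrite -ball_normE /ball_ /= distrC.
by rewrite ltr_norml => /andP[h1 h2]; lra.
Qed.

Lemma norm_line (c : V) (t : R) i : 0 <= t -> `|c + t *: ebase i - c| <= t.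
Proof.
move=> t0; rewrite addrAC subrr add0r normrZ ger0_norm //.
by rewrite ler_piMr //; exact: norm_ebase.
Qed.

Lemma max_partial_le0 (w : V -> R) (c : V) (d : R) i : C1 w -> 0 < d ->
  (forall y, `|y - c| < d -> w y <= w c) -> partial i w c <= 0.
Proof.
move=> cw d0 hmax; rewrite leNgt; apply/negP => h.
have [d' d'0 hd'] := cont_gt_near (C1_partial cw i) h.
have m0 : 0 < Num.min d d' by rewrite lt_min d0.
have [t /andP[t0 te] E] := mvt_partial c i cw (divr_gt0 m0 (ltr0n R 2)).
have me : Num.min d d' <= d /\ Num.min d d' <= d' by rewrite !ge_min !lexx orbT.
have h1 : 0 < partial i w (c + t *: ebase i).
  by apply: hd'; apply: (le_lt_trans (norm_line _ _ (ltW t0))); lra.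
have h2 : w (c + (Num.min d d' / 2) *: ebase i) <= w c.
  by apply: hmax; apply: (le_lt_trans (norm_line _ _ _)); lra.
have : 0 < Num.min d d' / 2 * partial i w (c + t *: ebase i) by rewrite mulr_gt0 //; lra.
by rewrite -E; lra.
Qed.

Lemma max_partial_ge0 (w : V -> R) (c : V) (d : R) i : C1 w -> 0 < d ->
  (forall y, `|y - c| < d -> w y <= w c) -> 0 <= partial i w c.
Proof.
move=> cw d0 hmax; rewrite leNgt; apply/negP => h.
have cN : continuous (fun x => - partial i w x) by solve_cont.
have h' : 0 < - partial i w c by lra.
have [d' d'0 hd'] := cont_gt_near cN h'.
have m0 : 0 < Num.min d d' by rewrite lt_min d0.
have me : Num.min d d' <= d /\ Num.min d d' <= d' by rewrite !ge_min !lexx orbT.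
pose e := Num.min d d' / 2; have e0 : 0 < e by rewrite /e; lra.
have ed : e < d /\ e < d' by rewrite /e; lra.
clearbody e.
have [t /andP[t0 te]] := mvt_partial (c - e *: ebase i) i cw e0.
rewrite subrK => E.
have h1 : 0 < - partial i w (c - e *: ebase i + t *: ebase i).
  apply: hd'; rewrite addrAC [c - _ - c]addrAC subrr add0r -scaleNr -scalerDl normrZ.
  apply: (@le_lt_trans _ _ e); last by lra.
  apply: (@le_trans _ _ (e * 1)); last by rewrite mulr1.
  apply: ler_pM => //; last exact: norm_ebase.
  by rewrite ler_norml; apply/andP; split; lra.
have h2 : w (c - e *: ebase i) <= w c.
  apply: hmax; rewrite addrAC subrr add0r normrN normrZ gtr0_norm //.
  apply: (@le_lt_trans _ _ (e * 1)); last by lra.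
  by apply: ler_wpM2l; [exact: ltW|exact: norm_ebase].
have : 0 < e * - partial i w (c - e *: ebase i + t *: ebase i) by rewrite mulr_gt0 //; lra.
by rewrite mulrN -E; lra.
Qed.

(** If the second derivative were positive, the mean value theorem used twice from the critical
    point [c] would show [w] increasing along the axis. *)
Lemma max_partial2_le0 (w : V -> R) (c : V) (d : R) i : C1 w -> C1 (partial i w) ->
  0 < d -> (forall y, `|y - c| < d -> w y <= w c) -> partial i (partial i w) c <= 0.
Proof.
move=> cw cdw d0 hmax; rewrite leNgt; apply/negP => h.
have p0 : partial i w c = 0.
  apply/eqP; rewrite eq_le (max_partial_le0 i cw d0 hmax).
  exact: (max_partial_ge0 i cw d0 hmax).
have [d' d'0 hd'] := cont_gt_near (C1_partial cdw i) h.
have m0 : 0 < Num.min d d' by rewrite lt_min d0.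
have me : Num.min d d' <= d /\ Num.min d d' <= d' by rewrite !ge_min !lexx orbT.
pose e := Num.min d d' / 2; have e0 : 0 < e by rewrite /e; lra.
have ed : e < d /\ e < d' by rewrite /e; lra.
clearbody e.
have [t /andP[t0 te] E] := mvt_partial c i cw e0.
have [s /andP[s0 st]] := mvt_partial c i cdw t0; rewrite p0 subr0 => E2.
have h1 : 0 < partial i (partial i w) (c + s *: ebase i).
  apply: hd'; apply: (le_lt_trans (norm_line _ _ (ltW s0))).
  exact: lt_trans st (lt_trans te ed.2).
have h2 : w (c + e *: ebase i) <= w c.
  by apply: hmax; apply: (le_lt_trans (norm_line _ _ (ltW e0))); exact: ed.1.
have : 0 < e * (t * partial i (partial i w) (c + s *: ebase i)) by rewrite !mulr_gt0.
by rewrite -E2 -E subr_gt0 ltNge h2.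
Qed.

Lemma is_derive_expM (a k t : R) :
  is_derive t (1 : R) (fun s => k * expR (a * s)) (a * k * expR (a * t)).
Proof.
have d1 : is_derive t (1 : R) (fun s : R => a * s) a.
  by apply: is_derive_eq; rewrite [_ *: _]mulr1.
have d2 := @is_derive1_comp R expR (fun s : R => a * s) t _ _ (is_derive_expR (a * t)) d1.
have -> : (fun s : R => k * expR (a * s)) = k *: (expR \o (fun s : R => a * s)).
  by apply/funext.
have -> : a * k * expR (a * t) = k *: (expR (a * t) * a).
  by rewrite /GRing.scale /=; ring.
exact: is_deriveZ.
Qed.

(* [k * expR (al * x 0 0)] with [al > M] is a strict subsolution; adding a small
   multiple of it to [f] rules out an interior maximum on a large cube. *)
Lemma maximum_principle (f : V -> R) (v : 'I_3 -> V -> R) (M : R) :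
  C1 f -> (forall i, C1 (partial i f)) -> (forall i x, `|v i x| <= M) ->
  (forall x, 0 <= \sum_i partial i (partial i f) x - \sum_i v i x * partial i f x) ->
  (forall e, 0 < e -> exists N, forall x, N < `|x| -> f x <= e) ->
  forall x, f x <= 0.
Proof.
move=> cf cdf vM Lf finf x0; rewrite leNgt; apply/negP => fx0.
have M0 : 0 <= M by apply: le_trans (vM 0 0).
have [e [e0 Ee]] : exists e, 0 < e /\ f x0 = 2 * e.
  by exists (f x0 / 2); split; [rewrite divr_gt0|field].
have [N hN] := finf e e0.
have [r [xr Nr]] : exists r, `|x0| < r /\ N < r.
  exists (Num.max `|x0| `|N| + 1); split; first by rewrite ltr_pwDr // le_max lexx.
  apply: (le_lt_trans (ler_norm N)).
  by rewrite ltr_pwDr // le_max lexx orbT.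
have r0 : 0 < r by apply: le_lt_trans xr.
have [al [al0 alM]] : exists al, 0 < al /\ M < al by exists (M + 1); split; lra.
(* The barrier adds at most [e / 2] on the cube, while [f <= e] at its boundary: there [w] stays
   below [2 * e = f x0], hence below [w x0]. *)
have [k [k0 Ek]] : exists k, 0 < k /\ k * expR (al * r) = e / 2.
  exists (e / 2 / expR (al * r)); rewrite divfK ?gt_eqF ?expR_gt0 //.
  by split=> //; rewrite !divr_gt0 // expR_gt0.
have cexp (b : R) : continuous (fun s : R => b * expR (al * s)).
  exact: is_derive_continuous (is_derive_expM al b).
have [cx px] := @C1_coordP R 0.
have [cE pE] := C1_compP cx (is_derive_expM al k) (cexp (al * k)).
have [cE2 pE2] := C1_compP cx (is_derive_expM al (al * k)) (cexp (al * (al * k))).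
have [cw pw] := C1_addP cf cE.
pose w x := f x + k * expR (al * x 0 0).
have pEE i : partial i (fun x : V => k * expR (al * x 0 0)) =
    fun x => (al * k * expR (al * x 0 0)) * (i == 0)%:R.
  by rewrite pE px.
have cK i : C1 (fun x : V => (al * k * expR (al * x 0 0)) * (i == 0)%:R) /\
  partial i (fun x : V => (al * k * expR (al * x 0 0)) * (i == 0)%:R) =
    fun x => al * (al * k) * expR (al * x 0 0) * (i == 0)%:R.
  have [cc pc] := @C1_cstP R (i == 0)%:R.
  have [cm pm] := C1_mulP cE2 cc; split=> //.
  rewrite pm pc pE2 px; apply/funext => x; rewrite mulr0 add0r.
  by case: eqP => _; rewrite ?mulr1 ?mul1r ?mulr0.
have cdw i : C1 (partial i w) /\ partial i (partial i w) = fun x =>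
    partial i (partial i f) x + al * (al * k) * expR (al * x 0 0) * (i == 0)%:R.
  have -> : partial i w = fun x => partial i f x + (al * k * expR (al * x 0 0)) * (i == 0)%:R.
    by rewrite /w pw pEE.
  have [ca pa] := C1_addP (cdf i) (cK i).1.
  by split=> //; rewrite pa (cK i).2.
have wE x : w x = f x + k * expR (al * x 0 0) by [].
have pw' i : partial i w = fun x => partial i f x + (al * k * expR (al * x 0 0)) * (i == 0)%:R.
  by rewrite /w pw pEE.
have {}cw : C1 w := cw.
clear pw; clearbody w.
have [//||c hc hmax] := @EVT_max_rV _ _ w (cube r) _ (@compact_box _ _ _).
- by exists x0; apply/cubeP => i; have := norm_coord_le x0 i; rewrite ler_norml => /andP[h1 h2]; apply/andP; split; lra.
- by apply: continuous_subspaceT; exact: C1_cont.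
have {}hc : cube r c by rewrite inE in hc.
have wx0 : w x0 <= w c.
  apply: hmax; rewrite inE; apply/cubeP => i.
  by have := norm_coord_le x0 i; rewrite ler_norml => /andP[h1 h2]; apply/andP; split; lra.
have [cr|rc] := ltP `|c| r; last first.
  have h1 : f c <= e by apply: hN; exact: lt_le_trans rc.
  have h2 : k * expR (al * c 0 0) <= e / 2.
    rewrite -Ek ler_pM2l // ler_expR ler_pM2l //.
    by have /cubeP/(_ 0)/andP[] := hc.
  have h3 : 0 < k * expR (al * x0 0 0) by rewrite mulr_gt0 ?expR_gt0.
  move: wx0 h1 h2 h3; rewrite !wE Ee.
  by move: (f c) (k * _) (k * _) => *; lra.
have d0 : 0 < r - `|c| by lra.
have dmax y : `|y - c| < r - `|c| -> w y <= w c.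
  move=> hy; apply: hmax; rewrite inE; apply/cubeP => i.
  have h : `|y| < r.
    by have := ler_normD (y - c) c; rewrite subrK; move: `|y| `|c| `|y - c| hy => *; lra.
  by have := norm_coord_le y i; rewrite ler_norml => /andP[h1 h2]; apply/andP; split; lra.
pose X := al * (al * k) * expR (al * c 0 0); pose Y := al * k * expR (al * c 0 0).
have XY : v 0 c * Y - X < 0.
  have v0 : v 0 c < al by apply: le_lt_trans alM; exact: le_trans (ler_norm _) (vM 0 c).
  have -> : v 0 c * Y - X = - (al * (k * expR (al * c 0 0)) * (al - v 0 c)).
    by rewrite /X /Y; ring.
  rewrite oppr_lt0 !mulr_gt0 ?expR_gt0 //; rewrite subr_gt0 //.
(* At the interior maximum [c], the gradient of [w] vanishes and its pure second derivatives are
   nonpositive. So the operator applied to [f] is at most minus its value on the barrier, which is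
   negative and contradicts [Lf]. *)
have t i : partial i (partial i f) c - v i c * partial i f c <=
    (v 0 c * Y - X) * (i == 0)%:R.
  have := max_partial2_le0 cw (cdw i).1 d0 dmax.
  have := max_partial_ge0 i cw d0 dmax; have := max_partial_le0 i cw d0 dmax.
  rewrite (congr1 (@^~ c) (cdw i).2) (congr1 (@^~ c) (pw' i)) /= -/X -/Y.
  move: (partial i (partial i f) c) (partial i f c) => a b.
  case: eqP => [->|_]; rewrite ?mulr1 ?mulr0 ?addr0 => h1 h2 h3.
    have -> : b = - Y by lra.
    lra.
  have -> : b = 0 by lra.
  by rewrite mulr0; lra.
have := Lf c; rewrite -sumrB leNgt => /negP; apply.
apply: (le_lt_trans (ler_sum _ (fun i _ => t i))).
rewrite (bigD1 0) //= mulr1 big1 ?addr0 // => i /negbTE ->; by rewrite mulr0.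
Qed.

End MaxPrinciple.

(** * Stationary Navier-Stokes: identities and square integrability *)

Section SmoothCalculus.
Context {R : realType}.
Local Notation V := 'rV[R]_3.
Implicit Types (i j : 'I_3).

Lemma C1_sumP (n : nat) (f : 'I_n -> V -> R) : (forall k, C1 (f k)) ->
  C1 (fun x => \sum_k f k x) /\
  forall i, partial i (fun x => \sum_k f k x) = fun x => \sum_k partial i (f k) x.
Proof.
elim: n f => [|n IH] f cf.
  have E (g : 'I_0 -> V -> R) : (fun x => \sum_k g k x) = fun=> 0.
    by apply/funext => x; rewrite big_ord0.
  have [c0 p0] := @C1_cstP R 0.
  by rewrite E; split=> // i; rewrite p0 E.
have [c1 p1] := IH (fun k => f (lift ord0 k)) (fun k => cf _).
have [c2 p2] := C1_addP (cf ord0) c1.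
have E (g : 'I_n.+1 -> V -> R) :
    (fun x => \sum_k g k x) = (fun x => g ord0 x + \sum_k g (lift ord0 k) x).
  by apply/funext => x; rewrite big_ord_recl.
by rewrite E; split=> // i; rewrite p2 p1 E.
Qed.

Definition lap (f : V -> R) (x : V) : R := \sum_i partial i (partial i f) x.

Lemma smooth_C1_partial (f : V -> R) : smooth f -> forall i, C1 (partial i f).
Proof. by move=> sf i; apply: smooth_C1; exact: smooth_partial. Qed.

Lemma smooth_partialC (f : V -> R) i j : smooth f ->
  partial i (partial j f) = partial j (partial i f).
Proof.
by move=> sf; apply: partialC; [exact: smooth_C1|exact: smooth_C1_partial|exact: smooth_C1_partial].
Qed.

Lemma C1_lapP (f : V -> R) : smooth f ->
  C1 (lap f) /\ forall a, partial a (lap f) = lap (partial a f).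
Proof.
move=> sf; have [c h] := @C1_sumP 3 (fun i => partial i (partial i f))
   (fun i => smooth_C1_partial (smooth_partial i sf) i).
split=> [|a]; first exact: c.
rewrite /lap h; apply/funext => x; apply: eq_bigr => i _.
rewrite (smooth_partialC a i (smooth_partial i sf)).
by rewrite (smooth_partialC a i sf).
Qed.

Lemma bounded_decay (f : V -> R) : continuous f ->
  (exists N, forall x, N < `|x| -> `|f x| <= 1) -> exists M, forall x, `|f x| <= M.
Proof.
move=> cf [N hN]; have [M [M0 hM]] := cont_bounded_box (const_mx (- N)) (const_mx N) cf.
exists (Num.max M 1) => x; have [h|h] := ltP N `|x|.
  by rewrite le_max hN ?orbT.
rewrite le_max hM // => i; rewrite !mxE -ler_norml.
exact: le_trans (norm_coord_le x i) h.
Qed.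

Lemma sub_cancel (P Q P' Q' s s' : R) : P' = P + s -> Q' = Q + s' -> s = s' ->
  P - Q = P' - Q'.
Proof. by move=> -> -> ->; ring. Qed.

Lemma sum_sub_zero (n : nat) (F A B C : 'I_n -> R) :
  \sum_k A k = 0 -> \sum_k B k = 0 -> (forall k, F k = A k - (B k + C k)) ->
  \sum_k F k = - \sum_k C k.
Proof.
move=> A0 B0 h; rewrite (eq_bigr _ (fun k _ => h k)) sumrB big_split /= A0 B0.
by rewrite sub0r add0r.
Qed.

Lemma sqr_sum3_le (a b c : R) : (a + b + c) ^+ 2 <= 3 * (a ^+ 2 + b ^+ 2 + c ^+ 2).
Proof.
have h1 := sqr_ge0 (a - b); have h2 := sqr_ge0 (b - c); have h3 := sqr_ge0 (a - c).
have -> : 3 * (a ^+ 2 + b ^+ 2 + c ^+ 2) =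
  (a + b + c) ^+ 2 + ((a - b) ^+ 2 + (b - c) ^+ 2 + (a - c) ^+ 2) by ring.
by rewrite lerDl !addr_ge0.
Qed.

Lemma sqr_sum_ord3_le (a : 'I_3 -> R) : (\sum_i a i) ^+ 2 <= 3 * \sum_i a i ^+ 2.
Proof. by rewrite !sum_ord3; exact: sqr_sum3_le. Qed.

Lemma sqr_sub_le (a b : R) : (a - b) ^+ 2 <= 2 * (a ^+ 2 + b ^+ 2).
Proof.
have -> : 2 * (a ^+ 2 + b ^+ 2) = (a - b) ^+ 2 + (a + b) ^+ 2 by ring.
by rewrite lerDl sqr_ge0.
Qed.

End SmoothCalculus.

(** * Vorticity and pressure equations *)

Section NavierStokes.
Context {R : realType}.
Local Notation V := 'rV[R]_3.
Implicit Types (i j k a b : 'I_3).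
Context (u : 'I_3 -> V -> R) (p : V -> R).
Context (su : forall j, smooth (u j)) (sp : smooth p).

Definition advect j (x : V) : R := \sum_i u i x * partial i (u j) x.

Context (ns : forall j x, advect j x = - partial j p x + lap (u j) x).
Context (dv : forall x, \sum_i partial i (u i) x = 0).

Let cu j : C1 (u j) := smooth_C1 (su j).
Let cdu j i : C1 (partial i (u j)) := smooth_C1_partial (su j) i.
Let cddu j k i : C1 (partial i (partial k (u j))) := smooth_C1_partial (smooth_partial k (su j)) i.
Let cp : C1 p := smooth_C1 sp.
Let cdp i : C1 (partial i p) := smooth_C1_partial sp i.

Lemma C1_advectP j : C1 (advect j) /\ forall a, partial a (advect j) =
  fun x => \sum_i (u i x * partial a (partial i (u j)) x + partial i (u j) x * partial a (u i) x).
Proof.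
have m i := C1_mulP (cu i) (cdu j i).
have [c h] := C1_sumP (fun i => (m i).1).
split=> [|a]; first exact: c.
rewrite /advect h; apply/funext => x; apply: eq_bigr => i _.
by rewrite (m i).2.
Qed.

Lemma lap_velocity j : lap (u j) = fun x => advect j x + partial j p x.
Proof. by apply/funext => x; rewrite ns addrAC addNr add0r. Qed.

Lemma partial_div0 a x : \sum_i partial a (partial i (u i)) x = 0.
Proof.
have [_ h] := C1_sumP (fun i => cdu i i).
have := congr1 (@^~ x) (h a) => /= <-.
have -> : (fun x => \sum_k partial k (u k) x) = fun=> 0 by apply/funext => y; exact: dv.
by have [_ ->] := @C1_cstP R 0.
Qed.

Lemma lap_div0 x : \sum_i lap (partial i (u i)) x = 0.
Proof.
rewrite /lap exchange_big /=; apply: big1 => a _.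
have [_ h] := C1_sumP (fun i => cddu i i a).
have := congr1 (@^~ x) (h a) => /= <-.
have -> : (fun x => \sum_k partial a (partial k (u k)) x) = fun=> 0.
  by apply/funext => y; exact: partial_div0.
by have [_ ->] := @C1_cstP R 0.
Qed.

(** The antisymmetric matrix form of the curl: with arbitrary index pairs the Laplacian of the
    velocity becomes a plain divergence of its entries. *)
Definition vort a b (x : V) : R := partial a (u b) x - partial b (u a) x.

Lemma C1_vortP a b : C1 (vort a b) /\ forall i, partial i (vort a b) =
  fun x => partial i (partial a (u b)) x - partial i (partial b (u a)) x.
Proof.
have [c1 p1] := C1_oppP (cdu a b); have [c2 p2] := C1_addP (cdu b a) c1.
by split=> [|i]; [exact: c2|rewrite /vort p2 p1].
Qed.

(** The pressure cancels by symmetry of its second derivatives. The derivatives of [advect] are left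
    unexpanded because the Caccioppoli estimate wants divergence form with fields in L^2. *)
Lemma lap_vort a b x : lap (vort a b) x = partial a (advect b) x - partial b (advect a) x.
Proof.
have E c d y : partial c (lap (u d)) y = partial c (advect d) y + partial c (partial d p) y.
  by rewrite lap_velocity; have [_ ->] := C1_addP (C1_advectP d).1 (cdp d).
have -> : partial a (advect b) x - partial b (advect a) x =
    partial a (lap (u b)) x - partial b (lap (u a)) x.
  exact: sub_cancel (E a b x) (E b a x) (congr1 (@^~ x) (smooth_partialC a b sp)).
rewrite (C1_lapP (su b)).2 (C1_lapP (su a)).2 /lap -sumrB; apply: eq_bigr => i _.
rewrite (C1_vortP a b).2.
have [c1 p1] := C1_oppP (cddu a b i); have [c2 p2] := C1_addP (cddu b a i) c1.
by rewrite p2 p1.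
Qed.

(** The difference between the two sides is the k-th derivative of the divergence. *)
Lemma lap_eq_curl k x : lap (u k) x = \sum_i partial i (vort i k) x.
Proof.
have Z : \sum_i partial i (partial k (u i)) x = 0.
  rewrite -[RHS](partial_div0 k x); apply: eq_bigr => i _.
  by rewrite (smooth_partialC i k (su i)).
rewrite -[LHS]subr0 -[X in _ - X]Z /lap -sumrB; apply: eq_bigr => i _.
by rewrite (C1_vortP i k).2.
Qed.

(** Divergence of the momentum equation; incompressibility removes both the viscous term and the
    part of the transport term with second derivatives. *)
Lemma lap_pressure x : lap p x = - \sum_k \sum_i partial i (u k) x * partial k (u i) x.
Proof.
have E k : partial k (partial k p) x = partial k (lap (u k)) x - partial k (advect k) x.
  rewrite lap_velocity; have [_ ->] := C1_addP (C1_advectP k).1 (cdp k).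
  by rewrite addrAC subrr add0r.
have Z1 : \sum_k partial k (lap (u k)) x = 0.
  rewrite -[RHS](lap_div0 x); apply: eq_bigr => k _.
  by rewrite (C1_lapP (su k)).2.
have Z2 : \sum_k \sum_i u i x * partial k (partial i (u k)) x = 0.
  rewrite exchange_big /=; apply: big1 => i _.
  rewrite -mulr_sumr; apply: (etrans _ (mulr0 (u i x))); congr (_ * _).
  rewrite -[RHS](partial_div0 i x).
  by apply: eq_bigr => k _; rewrite (smooth_partialC k i (su k)).
apply: (sum_sub_zero Z1 Z2) => k; rewrite E (C1_advectP k).2.
by congr (_ - _); exact: big_split.
Qed.

End NavierStokes.
Arguments C1_advectP {R u} su j.
Arguments C1_vortP {R u} su a b.
Arguments C1_lapP {R f} _.

(** * Square integrability up to second derivatives of the pressure *)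

Section L2Bounds.
Context {R : realType}.
Local Notation V := 'rV[R]_3.
Implicit Types (i j k a b : 'I_3).

(** The field is [f] in slot [a] minus [g] in slot [b], the shape of the vorticity equation. The
    slots may coincide, which serves equations with a single derivative on the right. *)
Lemma caccioppoli2 (w f g : V -> R) a b : C1 w -> (forall i, C1 (partial i w)) ->
  C1 f -> C1 g -> (forall x, lap w x = partial a f x - partial b g x) ->
  bddint (fun x => w x ^+ 2) -> bddint (fun x => f x ^+ 2) -> bddint (fun x => g x ^+ 2) ->
  forall i, bddint (fun x => partial i w x ^+ 2).
Proof.
move=> cw cdw cf cg E bw bf bg.
pose F j x := (j == a)%:R * f x + - ((j == b)%:R * g x).
have cF j : C1 (F j) /\ partial j (F j) =
    fun x => (j == a)%:R * partial j f x - (j == b)%:R * partial j g x.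
  have [k1 k1p] := @C1_cstP R (j == a)%:R; have [k2 k2p] := @C1_cstP R (j == b)%:R.
  have [c1 p1] := C1_mulP k1 cf; have [c2 p2] := C1_mulP k2 cg.
  have [c3 p3] := C1_oppP c2; have [c4 p4] := C1_addP c1 c3.
  split; first exact: c4.
  by rewrite p4 p1 p3 p2 k1p k2p; apply/funext => x; rewrite !mulr0 !addr0.
apply: (caccioppoli cw cdw (fun j => (cF j).1)) => // [x|j].
  have sel (c : 'I_3) (h : 'I_3 -> R) : \sum_j (j == c)%:R * h j = h c.
    rewrite (bigD1 c) //= eqxx mul1r big1 ?addr0 // => i /negbTE ->; exact: mul0r.
  rewrite -/(lap w x) E -(sel a (fun j => partial j f x)) -(sel b (fun j => partial j g x)).
  by rewrite -sumrB; apply: eq_bigr => j _; rewrite (cF j).2.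
have cf' := C1_cont cf; have cg' := C1_cont cg.
have cFj : continuous (fun x => F j x ^+ 2).
  by have cc := C1_cont (cF j).1; solve_cont.
have cS : continuous (fun x => 2 * (f x ^+ 2 + g x ^+ 2)) by solve_cont.
apply: (@bddint_le _ _ (fun x => 2 * (f x ^+ 2 + g x ^+ 2))) => // [x|].
  apply: (le_trans (sqr_sub_le _ _)); rewrite ler_pM2l // lerD // exprMn ler_piMl ?sqr_ge0 //;
  by case: (j == _); rewrite ?expr1n ?expr0n.
by apply: bddintZ; [solve_cont|exact: ler0n|apply: bddintD; [solve_cont|solve_cont|..]].
Qed.

Lemma bddint0 : bddint (fun x : V => (0 : R) ^+ 2).
Proof.
exists 0 => r r1; have c0 : continuous (fun _ : V => 0 : R) by exact: cont_cst.
by have := boxintZ 0 (const_mx (- r)) (const_mx r) c0; rewrite expr0n !mul0r => H; rewrite /cubeint H.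
Qed.

Lemma caccioppoli1 (w f : V -> R) a : C1 w -> (forall i, C1 (partial i w)) ->
  C1 f -> (forall x, lap w x = partial a f x) ->
  bddint (fun x => w x ^+ 2) -> bddint (fun x => f x ^+ 2) ->
  forall i, bddint (fun x => partial i w x ^+ 2).
Proof.
move=> cw cdw cf E bw bf; have [c0 p0] := @C1_cstP R 0.
apply: (caccioppoli2 (a := a) (b := a) cw cdw cf c0) => //; last exact: bddint0.
by move=> x; rewrite E p0 subr0.
Qed.

Context (u : 'I_3 -> V -> R) (p : V -> R) (M : R).
Context (su : forall j, smooth (u j)) (sp : smooth p).
Context (ns : forall j x, advect u j x = - partial j p x + lap (u j) x).
Context (dv : forall x, \sum_i partial i (u i) x = 0).
Context (uM : forall j x, `|u j x| <= M).
Context (bD : forall i j, bddint (fun x => partial i (u j) x ^+ 2)).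

Let cu j : C1 (u j) := smooth_C1 (su j).
Let cdu j i : C1 (partial i (u j)) := smooth_C1_partial (su j) i.
Let cddu j k i : C1 (partial i (partial k (u j))) := smooth_C1_partial (smooth_partial k (su j)) i.
Let cp : C1 p := smooth_C1 sp.
Let cdp i : C1 (partial i p) := smooth_C1_partial sp i.

Let kdu j i : continuous (partial i (u j)) := C1_cont (cdu j i).
Arguments kdu : clear implicits.

Lemma bddint_advect j : bddint (fun x => advect u j x ^+ 2).
Proof.
have c2 i : continuous (fun x => M ^+ 2 * partial i (u j) x ^+ 2).
  by have k := kdu j i; solve_cont.
have cc := C1_cont (C1_advectP su j).1.
have cS : continuous (fun x => \sum_i M ^+ 2 * partial i (u j) x ^+ 2) by exact: cont_sum.
apply: (@bddint_le _ _ (fun x => 3 * \sum_i (M ^+ 2 * partial i (u j) x ^+ 2))); [by solve_cont|by solve_cont|..].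
  move=> x; apply: (le_trans (sqr_sum_ord3_le _)); rewrite ler_pM2l //.
  apply: ler_sum => i _; rewrite exprMn ler_wpM2r ?sqr_ge0 //.
  rewrite -real_normK ?num_real // lerXn2r ?nnegrE //.
  exact: le_trans (uM i x).
apply: bddintZ; [by []|exact: ler0n|].
apply: bddint_sum => // i; apply: bddintZ; [by have k := kdu j i; solve_cont|exact: sqr_ge0|exact: bD].
Qed.

Lemma bddint_vort a b : bddint (fun x => vort u a b x ^+ 2).
Proof.
have k1 := kdu b a; have k2 := kdu a b; have k3 := C1_cont (C1_vortP su a b).1.
apply: (@bddint_le _ _ (fun x => 2 * (partial a (u b) x ^+ 2 + partial b (u a) x ^+ 2)));
  [by solve_cont|by solve_cont|by move=> x; exact: sqr_sub_le|].
by apply: bddintZ; [solve_cont|exact: ler0n|apply: bddintD; [solve_cont|solve_cont|exact: bD|exact: bD]].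
Qed.

Lemma C1_partial_vort a b i : C1 (partial i (vort u a b)).
Proof.
rewrite (C1_vortP su a b).2.
have [c1 p1] := C1_oppP (cddu a b i).
by have [] := C1_addP (cddu b a i) c1.
Qed.

Lemma bddint_dvort i a b : bddint (fun x => partial i (vort u a b) x ^+ 2).
Proof.
apply: (caccioppoli2 (a := a) (b := b) (C1_vortP su a b).1 (C1_partial_vort a b)
  (C1_advectP su b).1 (C1_advectP su a).1).
- exact: (lap_vort su sp ns a b).
- exact: bddint_vort.
- exact: bddint_advect.
- exact: bddint_advect.
Qed.

Lemma bddint_lap k : bddint (fun x => lap (u k) x ^+ 2).
Proof.
have cl := C1_cont (C1_lapP (su k)).1.
have kv i : continuous (partial i (vort u i k)) by exact: C1_cont (C1_partial_vort _ _ _).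
have kv2 i : continuous (fun x => partial i (vort u i k) x ^+ 2) by have k0 := kv i; solve_cont.
have cS : continuous (fun x => \sum_i partial i (vort u i k) x ^+ 2) by exact: cont_sum.
apply: (@bddint_le _ _ (fun x => 3 * \sum_i partial i (vort u i k) x ^+ 2)); [by solve_cont|by solve_cont|..].
  by move=> x; rewrite (lap_eq_curl su dv k x); exact: sqr_sum_ord3_le.
apply: bddintZ; [by []|exact: ler0n|].
by apply: bddint_sum => // i; exact: bddint_dvort.
Qed.

(** The full Hessian is recovered from the Laplacian by the Caccioppoli estimate for
    [partial i (u k)], whose Laplacian is the i-th derivative of the square integrable [lap (u k)].
    The same device serves for the pressure below. *)
Lemma bddint_d2 l i k : bddint (fun x => partial l (partial i (u k)) x ^+ 2).
Proof.
apply: (caccioppoli1 (a := i) (cdu k i) (cddu k i) (C1_lapP (su k)).1) => //.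
  by move=> x; rewrite -(congr1 (@^~ x) ((C1_lapP (su k)).2 i)).
exact: bddint_lap.
Qed.

Lemma bddint_d4 i k : bddint (fun x => partial i (u k) x ^+ 4).
Proof.
exact: (gagliardo_nirenberg (cu k) (cdu k i) (uM k) (bD i k) (bddint_d2 i i k)).
Qed.

Lemma bddint_dp i : bddint (fun x => partial i p x ^+ 2).
Proof.
have cl := C1_cont (C1_lapP (su i)).1; have cc := C1_cont (C1_advectP su i).1.
have k := C1_cont (cdp i).
apply: (@bddint_le _ _ (fun x => 2 * (lap (u i) x ^+ 2 + advect u i x ^+ 2))); [by solve_cont|by solve_cont|..].
  move=> x; have -> : partial i p x = lap (u i) x - advect u i x.
    by rewrite ns opprD opprK addrCA addrN addr0.
  exact: sqr_sub_le.
apply: bddintZ; [by solve_cont|exact: ler0n|apply: bddintD; [solve_cont|solve_cont|exact: bddint_lap|exact: bddint_advect]].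
Qed.

(** The Laplacian of [p] is quadratic in the velocity gradient, so its square is dominated by fourth
    powers; 9 counts the products in the double sum. *)
Lemma bddint_lap_p : bddint (fun x => lap p x ^+ 2).
Proof.
have cl := C1_cont (C1_lapP sp).1.
have c4 k i : continuous (fun x => partial i (u k) x ^+ 4) by have k0 := kdu k i; solve_cont.
have cS k : continuous (fun x => \sum_i partial i (u k) x ^+ 4) by exact: cont_sum.
have cSS : continuous (fun x => \sum_k \sum_i partial i (u k) x ^+ 4) by exact: cont_sum.
apply: (@bddint_le _ _ (fun x => 9 * \sum_k \sum_i partial i (u k) x ^+ 4)); [by solve_cont|by solve_cont|..].
  move=> x; rewrite (lap_pressure su sp ns dv x) sqrrN.
  pose A k i := partial i (u k) x.
  have h1 : (\sum_k \sum_i A k i * A i k) ^+ 2 <= 9 * \sum_k \sum_i (A k i * A i k) ^+ 2.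
    apply: (le_trans (sqr_sum_ord3_le _)).
    have -> : 9 = 3 * 3 :> R by ring.
    rewrite -mulrA ler_pM2l // mulr_sumr; apply: ler_sum => k _.
    exact: sqr_sum_ord3_le.
  apply: (le_trans h1); rewrite ler_pM2l //.
  have h2 : \sum_k \sum_i (A k i * A i k) ^+ 2 <=
      \sum_k \sum_i (A k i ^+ 4 / 2 + A i k ^+ 4 / 2).
    apply: ler_sum => k _; apply: ler_sum => i _.
    have := sqr_ge0 (A k i ^+ 2 - A i k ^+ 2).
    have -> : (A k i ^+ 2 - A i k ^+ 2) ^+ 2 =
      2 * (A k i ^+ 4 / 2 + A i k ^+ 4 / 2 - (A k i * A i k) ^+ 2) by field.
    by rewrite pmulr_rge0 // subr_ge0.
  apply: (le_trans h2); under eq_bigr do rewrite big_split /=.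
  rewrite big_split /= [X in _ + X]exchange_big /= -big_split /=.
  under eq_bigr do rewrite -big_split /=.
  apply: ler_sum => k _; apply: ler_sum => i _; rewrite -splitr //.
apply: bddintZ; [by []|exact: ler0n|].
by apply: bddint_sum => // k; apply: bddint_sum => // i; exact: bddint_d4.
Qed.

Lemma bddint_d2p l i : bddint (fun x => partial l (partial i p) x ^+ 2).
Proof.
apply: (caccioppoli1 (a := i) (cdp i) (smooth_C1_partial (smooth_partial i sp)) (C1_lapP sp).1).
- by move=> x; rewrite -(congr1 (@^~ x) ((C1_lapP sp).2 i)).
- exact: bddint_dp.
- exact: bddint_lap_p.
Qed.

Lemma pressure_limit : exists c : R, p x @[x --> at_infinity] --> c.
Proof.
apply: (morrey_limit cp cdp) => i; first exact: bddint_dp.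
exact: bddint_d2p.
Qed.

End L2Bounds.

(** * Truncated logarithms of the head pressure *)

Section Truncation.
Context {R : realType}.

(** Extension by zero keeps differentiability when value and derivative vanish at [l]: there the
    difference quotient of the pasted function is either zero or that of [f]. *)
Lemma is_derive_paste (f df : R -> R) (l : R) :
  (forall s, l <= s -> is_derive s (1 : R) f (df s)) -> f l = 0 -> df l = 0 ->
  forall s, is_derive s (1 : R) (fun t => if t <= l then 0 else f t)
    (if s <= l then 0 else df s).
Proof.
move=> fd fl dfl s; case: (ltgtP s l) => [sl|ls|->].
- have H : \near s, (fun=> 0 : R) s = (fun t => if t <= l then 0 else f t) s.
    near=> t; rewrite ifT //; apply: ltW; near: t.
    exact: lt_nbhsl.
  exact: (near_eq_is_derive H (is_derive_cst _ _ _)).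
- have H : \near s, f s = (fun t => if t <= l then 0 else f t) s.
    near=> t; rewrite ifF //; apply/negbTE; rewrite -ltNge; near: t.
    exact: lt_nbhsr.
  exact: (near_eq_is_derive H (fd s (ltW ls))).
- have [ex val] := fd l (lexx l); rewrite dfl in val.
  have C : (h^-1 *: ((f \o shift l) (h *: 1) - f l)) @[h --> 0^'] --> 'D_1 f l.
    exact: ex.
  rewrite val in C.
  pose g t := if t <= l then 0 else f t.
  have G : (h^-1 *: ((g \o shift l) (h *: 1) - g l)) @[h --> 0^'] --> (0 : R).
    have N := cvg_norm C; rewrite normr0 in N.
    apply/cvgr0Pnorm_le => e e0.
    move/cvgr0Pnorm_le : C => /(_ e e0); apply: filterS => h hh.
    rewrite /g lexx subr0 /=; case: ifPn => _; first by rewrite scaler0 normr0 ltW.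
    by move: hh; rewrite fl subr0.
  apply: DeriveDef; first by apply/cvg_ex; exists 0.
  exact: cvg_lim G.
Unshelve. all: by end_near. Qed.

(* [trunc_log l] is a C^1 regularization of [ln^+ (s / l)], with derivative
   [trunc_dlog l] and primitive [trunc_log_prim l]; all three vanish for [s <= l]. *)
Definition trunc_dlog (l s : R) : R := if s <= l then 0 else s^-1 - l / s ^+ 2.
Definition trunc_log (l s : R) : R := if s <= l then 0 else ln (s / l) + l / s - 1.
Definition trunc_log_prim (l s : R) : R :=
  if s <= l then 0 else s * ln (s / l) + l * ln (s / l) - 2 * (s - l).

Lemma is_derive_ln_div (l s : R) : 0 < l -> 0 < s ->
  is_derive s (1 : R) (fun t => ln (t / l)) s^-1.
Proof.
move=> l0 s0.
have d1 : is_derive s (1 : R) (fun t : R => t / l) l^-1.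
  rewrite (_ : (fun t : R => t / l) = l^-1 *: id); last by apply/funext => t /=; rewrite mulrC.
  by apply: is_derive_eq; rewrite [_ *: _]mulr1.
have sl : 0 < s / l by rewrite divr_gt0.
have d2 := @is_derive1_comp R (@ln R) (fun t : R => t / l) s _ _ (is_derive1_ln sl) d1.
have -> : s^-1 = (s / l)^-1 * l^-1 by field; rewrite !gt_eqF.
exact: d2.
Qed.

Lemma is_derive_trunc_log (l s : R) : 0 < l ->
  is_derive s (1 : R) (trunc_log l) (trunc_dlog l s).
Proof.
move=> l0; apply: (@is_derive_paste (fun s => ln (s / l) + l / s - 1)
  (fun s => s^-1 - l / s ^+ 2)).
- move=> t lt; have t0 : 0 < t by apply: lt_le_trans lt.
  have d1 := is_derive_ln_div l0 t0.
  have d2 : is_derive t (1 : R) (fun s : R => s^-1) (- t ^- 2).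
    have tN : (id t : R) != 0 by rewrite gt_eqF.
    have dv := @derivableV R R id t 1 tN (@derivable_id R R t 1).
    have ev := @deriveV R R id t 1 tN (@derivable_id R R t 1).
    apply: DeriveDef; first exact: dv.
    by rewrite derive_id in ev; apply: (etrans ev); rewrite [_ *: _]mulr1.
  have H := is_deriveB (is_deriveD d1 (is_deriveZ l d2)) (is_derive_cst (1 : R) t (1 : R)).
  have E : t^-1 - l / t ^+ 2 = t^-1 + l *: (- t ^- 2) - 0.
    by rewrite subr0 /GRing.scale /= mulrN.
  by rewrite E; exact H.
- by rewrite divff ?gt_eqF // ln1 add0r subrr.
- by rewrite expr2 invfM mulrA divff ?gt_eqF // mul1r subrr.
Qed.

Lemma is_derive_trunc_log_prim (l s : R) : 0 < l ->
  is_derive s (1 : R) (trunc_log_prim l) (trunc_log l s).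
Proof.
move=> l0; apply: (@is_derive_paste (fun s => s * ln (s / l) + l * ln (s / l) - 2 * (s - l))
  (fun s => ln (s / l) + l / s - 1)).
- move=> t lt; have t0 : 0 < t by apply: lt_le_trans lt.
  have d1 := is_derive_ln_div l0 t0.
  have H := is_deriveB (is_deriveD (is_deriveM (is_derive_id t (1 : R)) d1) (is_deriveZ l d1))
    (is_deriveZ 2 (is_deriveB (is_derive_id t (1 : R)) (is_derive_cst l t (1 : R)))).
  have E : ln (t / l) + l / t - 1 =
      (t *: t^-1 + ln (t / l) *: (1 : R)) + l *: t^-1 - 2 *: ((1 : R) - 0).
    by rewrite /GRing.scale /=; field; rewrite gt_eqF.
  by rewrite E; exact H.
- by rewrite divff ?gt_eqF // ln1 !mulr0 subrr mulr0 addr0 subr0.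
- by rewrite divff ?gt_eqF // ln1 add0r subrr.
Qed.

Lemma cont_trunc_dlog (l : R) : 0 < l -> continuous (trunc_dlog l).
Proof.
move=> l0.
(* For [s <= l] the right side is 1/l - l/l^2 = 0, so a single continuous formula covers both
   branches. *)
have -> : trunc_dlog l = fun s => (Num.max s l)^-1 - l * ((Num.max s l)^-1) ^+ 2.
  apply/funext => s; rewrite /trunc_dlog exprVn; case: leP => // _.
  by rewrite expr2 invfM mulrA divff ?gt_eqF // mul1r subrr.
have cm : continuous (fun s : R => (Num.max s l)^-1).
  move=> s; apply: (@continuousV R R (fun s => Num.max s l) s).
    by rewrite gt_eqF // lt_max l0 orbT.
  apply: (@continuous_max R R id (fun=> l) s); first exact: cvg_id.
  exact: cvg_cst.
by apply: cont_add => //; apply: cont_opp; apply: cont_mul; [exact: cont_cst|exact: cont_sqr].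
Qed.

Lemma ln_div_ge (l s : R) : 0 < l -> 0 < s -> 1 - l / s <= ln (s / l).
Proof.
move=> l0 s0; have ls0 : 0 < l / s by rewrite divr_gt0.
have -> : s / l = (l / s)^-1 by rewrite invf_div.
rewrite lnV ?posrE // lerNr opprB.
have := @le_ln1Dx R (l / s - 1).
have -> : 1 + (l / s - 1) = l / s by ring.
by apply; rewrite ltrBrDl subrr.
Qed.

Lemma trunc_log_ge0 (l s : R) : 0 < l -> 0 <= trunc_log l s.
Proof.
move=> l0; rewrite /trunc_log; case: ifPn => //; rewrite -ltNge => ls.
by have := ln_div_ge l0 (lt_trans l0 ls); lra.
Qed.

Lemma trunc_log_ge (l s : R) : 0 < l -> 0 < s -> ln (s / l) - 1 <= trunc_log l s.
Proof.
move=> l0 s0; rewrite /trunc_log; case: ifPn => [sl|_].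
  have : ln (s / l) <= 0 by apply: ln_le0; rewrite ler_pdivrMr // mul1r.
  lra.
by rewrite lerD2r lerDl divr_ge0 // ltW.
Qed.

Lemma trunc_log_le (l s S : R) : 0 < l -> l <= 1 -> 1 <= S -> s <= S ->
  trunc_log l s <= ln (S / l).
Proof.
move=> l0 l1 S1 sS; rewrite /trunc_log; case: ifPn => [_|].
  by apply: ln_ge0; rewrite ler_pdivlMr // mul1r; lra.
rewrite -ltNge => ls; have s0 := lt_trans l0 ls.
have : ln (s / l) <= ln (S / l).
  rewrite ler_ln ?posrE ?divr_gt0 //; last by lra.
  by rewrite ler_pM2r ?invr_gt0.
have : l / s <= 1 by rewrite ler_pdivrMr // mul1r ltW.
lra.
Qed.

Lemma trunc_dlog_ge0 (l s : R) : 0 < l -> 0 <= trunc_dlog l s.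
Proof.
move=> l0; rewrite /trunc_dlog; case: ifPn => //; rewrite -ltNge => ls.
have s0 := lt_trans l0 ls.
have -> : s^-1 - l / s ^+ 2 = (s - l) / s ^+ 2 by field; rewrite gt_eqF.
by rewrite divr_ge0 ?sqr_ge0 // subr_ge0 ltW.
Qed.

Lemma trunc_dlog_le (l s : R) : 0 < l -> l < s -> trunc_dlog l s <= s^-1.
Proof.
move=> l0 ls; rewrite /trunc_dlog [s <= l]leNgt ls /= gerBl.
by rewrite divr_ge0 ?sqr_ge0 // ltW.
Qed.

(** The truncated derivative vanishes at its threshold and cannot dominate 1/s there. Lowering the
    threshold to [e * l] restores the comparison on [s > l] at the price of a factor [1 - e]. *)
Lemma trunc_dlog_ge (e l s : R) : 0 < e -> e < 1 -> 0 < l -> l < s ->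
  (1 - e) * s^-1 <= trunc_dlog (e * l) s.
Proof.
move=> e0 e1 l0 ls; have s0 := lt_trans l0 ls.
have els : e * l < s by apply: lt_trans ls; rewrite gtr_pMl.
rewrite /trunc_dlog [s <= _]leNgt els /= mulrBl mul1r lerD2l lerN2.
rewrite expr2 invfM mulrA ler_pM2r ?invr_gt0 // ler_pdivrMr // ler_pM2l //.
exact: ltW.
Qed.

End Truncation.

Section CurlAlgebra.
Context {R : realType}.

Lemma curl_sqr_sum (a : 'I_3 -> 'I_3 -> R) :
  \sum_k (a (k + 1) (k + 2%:R) - a (k + 2%:R) (k + 1)) ^+ 2 =
  \sum_i \sum_j a i j ^+ 2 - \sum_k \sum_i a i k * a k i.
Proof.
have e1 : (1 + 1 : 'I_3) = 2%:R by exact: val_inj.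
have e2 : (1 + 2%:R : 'I_3) = 0 by exact: val_inj.
have e3 : (2%:R + 1 : 'I_3) = 0 by exact: val_inj.
have e4 : (2%:R + 2%:R : 'I_3) = 1 by exact: val_inj.
rewrite !sum_ord3 e1 e2 e3 e4 !add0r.
move: (a _ _) (a 0 1) (a 0 2%:R) (a 1 0) (a 1 1) (a 1 2%:R) (a 2%:R 0) (a 2%:R 1) (a 2%:R 2%:R).
move=> *; ring.
Qed.

(** Pointwise reading: [U] is the velocity, [P] the pressure gradient, [q] the pure second
    derivatives of the pressure, and [a i j], [b i j] the first and pure second i-derivatives of the
    j-th velocity component. The hypotheses are the momentum equation and the pressure equation. *)
Lemma head_pressure_algebra (U P q : 'I_3 -> R) (a b : 'I_3 -> 'I_3 -> R) :
  (forall j, \sum_i b i j = \sum_i U i * a i j + P j) ->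
  \sum_i q i = - \sum_k \sum_i a i k * a k i ->
  \sum_i (\sum_j (U j * b i j + a i j * a i j) + q i) -
    \sum_i U i * (\sum_j U j * a i j + P i) =
  \sum_k (a (k + 1) (k + 2%:R) - a (k + 2%:R) (k + 1)) ^+ 2.
Proof.
move=> hb hq; rewrite curl_sqr_sum.
have := hb 0; have := hb 1; have := hb 2%:R; move: hq; rewrite !sum_ord3 {hb}.
move: (a 0 0) (a 0 1) (a 0 2%:R) (a 1 0) (a 1 1) (a 1 2%:R) (a 2%:R 0) (a 2%:R 1) (a 2%:R 2%:R).
move: (b 0 0) (b 0 1) (b 0 2%:R) (b 1 0) (b 1 1) (b 1 2%:R) (b 2%:R 0) (b 2%:R 1) (b 2%:R 2%:R).
move: (U 0) (U 1) (U 2%:R) (P 0) (P 1) (P 2%:R) (q 0) (q 1) (q 2%:R).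
move=> U0 U1 U2 P0 P1 P2 q0 q1 q2 b00 b01 b02 b10 b11 b12 b20 b21 b22.
move=> a00 a01 a02 a10 a11 a12 a20 a21 a22 hq h2 h1 h0.
have k (x y z w : R) : x + y + z = w -> z = w - x - y by move=> <-; ring.
rewrite (k _ _ _ _ hq) (k _ _ _ _ h0) (k _ _ _ _ h1) (k _ _ _ _ h2) {k hq h0 h1 h2}.
ring.
Qed.

End CurlAlgebra.

(** * Equation and sign of the head pressure *)

Section HeadPressure.
Context {R : realType}.
Local Notation V := 'rV[R]_3.
Implicit Types (i j k a b : 'I_3).
Context (u : 'I_3 -> V -> R) (p : V -> R) (c : R).
Context (su : forall j, smooth (u j)) (sp : smooth p).

Definition head (x : V) : R := 2^-1 * \sum_j u j x ^+ 2 + p x - c.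
Definition enstrophy (x : V) : R := \sum_k vort u (k + 1) (k + 2%:R) x ^+ 2.

Let cu j : C1 (u j) := smooth_C1 (su j).
Let cdu j i : C1 (partial i (u j)) := smooth_C1_partial (su j) i.
Let cp : C1 p := smooth_C1 sp.
Let cdp i : C1 (partial i p) := smooth_C1_partial sp i.

Lemma C1_headP : C1 head /\
  forall i, partial i head = fun x => \sum_j u j x * partial i (u j) x + partial i p x.
Proof.
have m j := C1_mulP (cu j) (cu j).
have [c1 p1] := C1_sumP (fun j => (m j).1).
have [k1 k1p] := @C1_cstP R 2^-1; have [k2 k2p] := @C1_cstP R (- c).
have [c2 p2] := C1_mulP k1 c1.
have [c3 p3] := C1_addP c2 cp; have [c4 p4] := C1_addP c3 k2.
have -> : head = fun x => 2^-1 * (\sum_j u j x * u j x) + p x + - c by [].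
split=> [|i]; first exact: c4.
rewrite p4 p3 p2 p1 k1p k2p; apply/funext => x.
rewrite mulr0 !addr0; congr (_ + _); rewrite mulr_sumr; apply: eq_bigr => j _.
rewrite (m j).2; move: (u j x) (partial i (u j) x) => s t; by field.
Qed.

Lemma C1_partial_headP i : C1 (partial i head) /\
  forall k, partial k (partial i head) = fun x =>
    \sum_j (u j x * partial k (partial i (u j)) x + partial i (u j) x * partial k (u j) x)
    + partial k (partial i p) x.
Proof.
have m j := C1_mulP (cu j) (cdu j i).
have [c1 p1] := C1_sumP (fun j => (m j).1).
have [c2 p2] := C1_addP c1 (cdp i).
rewrite (C1_headP.2 i); split=> [|k]; first exact: c2.
rewrite p2 p1; apply/funext => x; congr (_ + _).
by apply: eq_bigr => j _; rewrite (m j).2.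
Qed.

Lemma cont_enstrophy : continuous enstrophy.
Proof.
apply: (@cont_sum _ _ 3 (fun k x => vort u (k + 1) (k + 2%:R) x ^+ 2)) => k.
by apply: cont_sqr; exact: C1_cont (C1_vortP su _ _).1.
Qed.

Lemma enstrophy_ge0 x : 0 <= enstrophy x.
Proof. by apply: sumr_ge0 => k _; exact: sqr_ge0. Qed.

Context (ns : forall j x, advect u j x = - partial j p x + lap (u j) x).
Context (dv : forall x, \sum_i partial i (u i) x = 0).

Lemma lap_head x : \sum_i partial i (partial i head) x - \sum_i u i x * partial i head x =
  enstrophy x.
Proof.
have H := @head_pressure_algebra R (fun j => u j x) (fun j => partial j p x)
  (fun i => partial i (partial i p) x) (fun i j => partial i (u j) x)
  (fun i j => partial i (partial i (u j)) x).
apply: etrans; last apply: H.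
- congr (_ - _); apply: eq_bigr => i _.
    by rewrite ((C1_partial_headP i).2 i).
  by rewrite (C1_headP.2 i).
- by move=> j; have := congr1 (@^~ x) (lap_velocity ns j).
- exact: (lap_pressure su sp ns dv x).
Qed.

Context (M : R) (uM : forall j x, `|u j x| <= M).
Context (head_decay : forall e, 0 < e -> exists N, forall x, N < `|x| -> `|head x| <= e).

Lemma head_le0 x : head x <= 0.
Proof.
apply: (@maximum_principle _ head u M) => [|i|//|y|e e0].
- exact: C1_headP.1.
- exact: (C1_partial_headP i).1.
- by rewrite lap_head; exact: enstrophy_ge0.
- have [N hN] := head_decay e0; exists N => y yN.
  by apply: le_trans (hN y yN); exact: ler_norm.
Qed.

(** A zero of [head] is a global maximum, so the gradient vanishes and the Laplacian is nonpositive
    there; but by [lap_head] that Laplacian is the enstrophy. *)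
Lemma head0_enstrophy x : head x = 0 -> enstrophy x = 0.
Proof.
move=> h0; apply: le_anti; rewrite enstrophy_ge0 andbT.
have hmax (y : V) : `|y - x| < 1 -> head y <= head x by rewrite h0 => _; exact: head_le0.
have d0 i : partial i head x = 0.
  apply: le_anti; rewrite (max_partial_le0 i C1_headP.1 ltr01 hmax).
  exact: (max_partial_ge0 i C1_headP.1 ltr01 hmax).
rewrite -lap_head [X in _ - X]big1 ?subr0; last by move=> i _; rewrite d0 mulr0.
apply: sumr_le0 => i _.
exact: (max_partial2_le0 C1_headP.1 (C1_partial_headP i).1 ltr01 hmax).
Qed.

End HeadPressure.

(** * Energy identity with logarithmic weight *)

Section TruncatedIdentity.
Context {R : realType}.
Local Notation V := 'rV[R]_3.
Implicit Types (i j k a b : 'I_3).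

Lemma cubeint_supp (r : R) (f : V -> R) : continuous f ->
  (forall x, ~ cube r x -> f x = 0) -> integral3 setT f = (cubeint r f)%:E.
Proof.
move=> cf f0; rewrite /cubeint boxint_patch // /integral3.
apply: eq_integral => t _; rewrite patchE; case: ifPn => //= /negP h.
by rewrite f0 // => hh; apply: h; rewrite inE.
Qed.

Context (u : 'I_3 -> V -> R) (p : V -> R) (c : R).
Context (su : forall j, smooth (u j)) (sp : smooth p).
Context (ns : forall j x, advect u j x = - partial j p x + lap (u j) x).
Context (dv : forall x, \sum_i partial i (u i) x = 0).
Local Notation Q := (head u p c).
Context (head_decay : forall e, 0 < e -> exists N, forall x, N < `|x| -> `|Q x| <= e).

Definition gradsq (x : V) : R := \sum_i partial i Q x ^+ 2.
Definition dlog_gradsq l (x : V) : R := trunc_dlog l (- Q x) * gradsq x.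
Definition log_enstrophy l (x : V) : R := trunc_log l (- Q x) * enstrophy u x.

Let cu j : C1 (u j) := smooth_C1 (su j).
Let cQ : C1 Q := (C1_headP c su sp).1.
Let cdQ i : C1 (partial i Q) := (C1_partial_headP c su sp i).1.

Lemma cont_gradsq : continuous gradsq.
Proof.
apply: (@cont_sum _ _ 3 (fun i x => partial i Q x ^+ 2)) => i.
by apply: cont_sqr; exact: C1_cont (cdQ i).
Qed.

Lemma gradsq_ge0 x : 0 <= gradsq x.
Proof. by apply: sumr_ge0 => i _; exact: sqr_ge0. Qed.

Lemma cont_oppQ : continuous (fun x => - Q x).
Proof. by apply: cont_opp; exact: C1_cont cQ. Qed.

Lemma cont_dlog_gradsq l : 0 < l -> continuous (dlog_gradsq l).
Proof.
move=> l0; apply: cont_mul; last exact: cont_gradsq.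
exact: (cont_comp cont_oppQ (cont_trunc_dlog l0)).
Qed.

Lemma cont_log_enstrophy l : 0 < l -> continuous (log_enstrophy l).
Proof.
move=> l0; apply: cont_mul; last exact: (cont_enstrophy su).
apply: (cont_comp cont_oppQ).
exact: is_derive_continuous (fun s => is_derive_trunc_log s l0).
Qed.

Lemma identity_algebra (f df F : R) (q d d2 U dU : 'I_3 -> R) :
  \sum_i (f * d2 i + d i * (df * - d i) + (U i * (f * - d i) + F * dU i)) =
  f * (\sum_i d2 i - \sum_i U i * d i) + - (df * \sum_i d i ^+ 2) + F * \sum_i dU i.
Proof. rewrite !sum_ord3; ring. Qed.

(* Divergence theorem for [trunc_log l (- Q) * grad Q + trunc_log_prim l (- Q) * u],
   which has compact support because [Q] vanishes at infinity. *)
Lemma cubeint_identity (r l : R) : 0 < r -> 0 < l ->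
  (forall x : V, (exists i, x 0 i = - r \/ x 0 i = r) -> - Q x <= l) ->
  cubeint r (dlog_gradsq l) = cubeint r (log_enstrophy l).
Proof.
move=> r0 l0 hl.
have [cN pN] := C1_oppP cQ.
have ctl := is_derive_continuous (fun s => is_derive_trunc_log s l0).
have [c1 p1] := C1_compP cN (fun s => is_derive_trunc_log s l0) (cont_trunc_dlog l0).
have [c2 p2] := C1_compP cN (fun s => is_derive_trunc_log_prim s l0) ctl.
have m1 i := C1_mulP c1 (cdQ i).
have m2 i := C1_mulP (cu i) c2.
have a3 i := C1_addP (m1 i).1 (m2 i).1.
have cs i : continuous (partial i (fun x => trunc_log l (- Q x) * partial i Q x +
    u i x * trunc_log_prim l (- Q x))) by exact: C1_partial (a3 i).1 i.
have E x : \sum_i partial i (fun x => trunc_log l (- Q x) * partial i Q x +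
    u i x * trunc_log_prim l (- Q x)) x = log_enstrophy l x + - dlog_gradsq l x.
  transitivity (\sum_i (trunc_log l (- Q x) * partial i (partial i Q) x +
     partial i Q x * (trunc_dlog l (- Q x) * - partial i Q x) +
     (u i x * (trunc_log l (- Q x) * - partial i Q x) +
      trunc_log_prim l (- Q x) * partial i (u i) x))).
    by apply: eq_bigr => i _; rewrite (a3 i).2 (m1 i).2 (m2 i).2 p1 p2 pN.
  (* The primitive turns the transport term into a divergence: the derivative of [trunc_log_prim]
     supplies the missing u . grad Q term, and its undifferentiated occurrence multiplies div u =
     0. *)
  rewrite identity_algebra //.
  rewrite (lap_head c su sp ns dv) dv mulr0 addr0.
  by [].
have ce := cont_log_enstrophy l0; have cd := cont_dlog_gradsq l0.
have S : cubeint r (fun x => log_enstrophy l x + - dlog_gradsq l x) = 0.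
  rewrite /cubeint -(boxint_eq (fun x _ => E x)) boxint_sum //; apply: big1 => i _.
  apply: (cubeint_partial0 r0 (a3 i).1) => x hx.
  have h : - Q x <= l by apply: hl; exists i.
  by rewrite /trunc_log /trunc_log_prim h mulr0 mul0r addr0.
move: S; rewrite /cubeint boxintD //; last exact: cont_opp.
have -> : boxint (const_mx (- r)) (const_mx r) (fun x => - dlog_gradsq l x) =
    - cubeint r (dlog_gradsq l).
  rewrite /cubeint -[RHS]mulN1r -boxintZ //; apply: boxint_eq => x _; by rewrite mulN1r.
by move/subr0_eq.
Qed.

Lemma integral_identity (l : R) : 0 < l ->
  integral3 setT (dlog_gradsq l) = integral3 setT (log_enstrophy l).
Proof.
move=> l0; have [N hN] := head_decay l0.
pose r := Num.max 0 N + 1.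
have r0 : 0 < r by rewrite /r ltr_wpDl // le_max lexx.
have Nr : N < r by rewrite /r ltr_pwDr // le_max lexx orbT.
have small (x : V) i : r <= `|x 0 i| -> - Q x <= l.
  move=> h; have : `|Q x| <= l.
    by apply: hN; apply: lt_le_trans Nr _; apply: le_trans h _; exact: norm_coord_le.
  by rewrite ler_norml => /andP[h1 _]; rewrite lerNl.
have off (x : V) : ~ cube r x -> - Q x <= l.
  move=> h; have [i hi] : exists i, ~ (- r <= x 0 i <= r).
    by apply/not_existsP => H; apply: h; apply/cubeP => i; exact: (contrapT (H i)).
  apply: (small x i); rewrite leNgt; apply/negP => h'; apply: hi.
  by rewrite -ler_norml ltW.
rewrite (@cubeint_supp r); last 2 first.
- exact: cont_dlog_gradsq.
- by move=> x /off h; rewrite /dlog_gradsq /trunc_dlog h mul0r.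
rewrite (@cubeint_supp r); last 2 first.
- exact: cont_log_enstrophy.
- by move=> x /off h; rewrite /log_enstrophy /trunc_log h mul0r.
congr EFin; apply: cubeint_identity => // x [i hi]; apply: (small x i).
by case: hi => ->; rewrite ?normrN ger0_norm // ltW.
Qed.

End TruncatedIdentity.

(** * Asymptotics of the superlevel integrals *)

Section Integral3.
Context {R : realType}.
Local Notation V := 'rV[R]_3.
Local Notation mR := (measurableTypeR R).
Local Notation T := (mR * mR * mR)%type.
Local Notation mu := (@lebesgue3 R).
Implicit Types (f g : V -> R) (D E : set V).

Definition measurable3 D := measurable (vec3 @^-1` D : set T).

Lemma measurable3T : measurable3 setT.
Proof. by rewrite /measurable3 preimage_setT; exact: measurableT. Qed.

Lemma measurable_fun3 f (A : set T) : continuous f ->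
  measurable_fun A (fun t => (f (vec3 t))%:E).
Proof.
move=> cf; apply/measurable_EFinP.
exact: measurable_funTS (measurable_vec3_fun cf).
Qed.

Lemma measurable3_gt f l : continuous f -> measurable3 [set x | l < f x].
Proof.
move=> cf; apply: measurable_vec3_open.
have -> : [set x | l < f x] = f @^-1` [set` `]l, +oo[].
  by apply/seteqP; split=> x /=; rewrite in_itv /= andbT.
by apply: open_comp => [x _|]; [exact: cf|exact: interval_open].
Qed.

Lemma integral3_eq D f g : (forall x, D x -> f x = g x) -> integral3 D f = integral3 D g.
Proof. by move=> fg; apply: eq_integral => t; rewrite inE => Dt; rewrite fg. Qed.

Lemma integral3_le D f g : measurable3 D -> continuous f -> continuous g ->
  (forall x, D x -> 0 <= f x) -> (forall x, D x -> f x <= g x) ->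
  (integral3 D f <= integral3 D g)%E.
Proof.
move=> mD cf cg f0 fg; apply: (@ge0_le_integral _ _ _ mu) => //.
- by move=> t Dt; rewrite lee_fin; exact: f0.
- exact: measurable_fun3.
- exact: measurable_fun3.
- by move=> t Dt; rewrite lee_fin; exact: fg.
Qed.

Lemma integral3_subset D E f : measurable3 D -> measurable3 E -> continuous f ->
  (forall x, E x -> 0 <= f x) -> D `<=` E -> (integral3 D f <= integral3 E f)%E.
Proof.
move=> mD mE cf f0 DE; apply: (@ge0_subset_integral _ _ _ mu) => //.
- exact: measurable_fun3.
- by move=> t Et; rewrite lee_fin; exact: f0.
- by move=> t Dt; exact: DE.
Qed.

Lemma integral3_ge0 D f : (forall x, D x -> 0 <= f x) -> (0 <= integral3 D f)%E.
Proof. by move=> f0; apply: integral_ge0 => t Dt; rewrite lee_fin; exact: f0. Qed.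

Lemma integral3Z D f (k : R) : measurable3 D -> continuous f ->
  (forall x, D x -> 0 <= f x) -> 0 <= k ->
  integral3 D (fun x => k * f x) = (k%:E * integral3 D f)%E.
Proof.
move=> mD cf f0 k0.
rewrite /integral3 -(@ge0_integralZl _ _ _ mu) //; first exact: measurable_fun3.
by move=> t Dt; rewrite lee_fin; exact: f0.
Qed.

Lemma integral3_supp D f : (forall x, ~ D x -> f x = 0) ->
  integral3 setT f = integral3 D f.
Proof.
move=> f0; rewrite /integral3 [RHS](integral_mkcond (mu := mu)).
apply: eq_integral => t _; rewrite patchE; case: ifPn => // /negP h.
by rewrite f0 // => hh; apply: h; rewrite inE.
Qed.

Lemma cubeint_le_integral3 (r : R) f : continuous f -> (forall x, 0 <= f x) ->
  ((cubeint r f)%:E <= integral3 setT f)%E.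
Proof.
move=> cf f0; rewrite /cubeint EFin_boxint //.
by apply: integral3_subset => //; [exact: measurable_box|exact: measurable3T].
Qed.

(** Monotone convergence; the increasing sets have to exhaust only the region where [f] is
    positive. *)
Lemma integral3_cvg (D : (set V)^nat) f : continuous f -> (forall x, 0 <= f x) ->
  (forall n, measurable3 (D n)) -> (forall m n, (m <= n)%N -> D m `<=` D n) ->
  (forall x, 0 < f x -> exists n, D n x) ->
  integral3 (D n) f @[n --> \oo] --> integral3 setT f.
Proof.
move=> cf f0 mD nD Df.
rewrite (@integral3_supp (\bigcup_n D n)); last first.
  move=> x h; apply/eqP; rewrite eq_le f0 andbT leNgt; apply/negP => /Df[n Dn].
  by apply: h; exists n.
have H := @ge0_nondecreasing_set_cvg_integral _ T R (fun n => vec3 @^-1` D n)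
   (fun t => (f (vec3 t))%:E) mu.
rewrite {2}/integral3 preimage_bigcup; apply: H.
- by move=> m n mn; apply/subsetPset => t; exact: (nD _ _ mn).
- exact: mD.
- by move=> n; exact: measurable_fun3.
- by move=> n t _; rewrite lee_fin.
Qed.

End Integral3.

(** * Two-sided bounds for the superlevel integrals *)

Section LogBounds.
Context {R : realType}.
Local Notation V := 'rV[R]_3.
Implicit Types (i j k a b : 'I_3).
Context (u : 'I_3 -> V -> R) (p : V -> R) (c : R).
Context (su : forall j, smooth (u j)) (sp : smooth p).
Context (ns : forall j x, advect u j x = - partial j p x + lap (u j) x).
Context (dv : forall x, \sum_i partial i (u i) x = 0).
Context (M : R) (uM : forall j x, `|u j x| <= M).
Local Notation Q := (head u p c).
Local Notation gradQ2 := (gradsq u p c).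
Local Notation dlogQ := (dlog_gradsq u p c).
Local Notation logQ := (log_enstrophy u p c).
Context (head_decay : forall e, 0 < e -> exists N, forall x, N < `|x| -> `|Q x| <= e).

Definition superlevel l := [set x : V | l < `|Q x|].
Definition superlevel_int l := integral3 (superlevel l) (fun x => gradQ2 x / `|Q x|).

Let cQ : continuous Q := C1_cont (C1_headP c su sp).1.

Lemma cont_normQ : continuous (fun x => `|Q x|).
Proof. exact: (cont_comp cQ (@norm_continuous R R)). Qed.

Lemma measurable_superlevel l : measurable3 (superlevel l).
Proof. exact: (measurable3_gt l cont_normQ). Qed.

Lemma normQ x : `|Q x| = - Q x.
Proof. by rewrite ler0_norm // (head_le0 su sp ns dv uM head_decay). Qed.

(** The maximum leaves the integrand unchanged on the superlevel set and makes it continuous on the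
    whole space, including the zeros of [Q]. *)
Definition gradsq_max l (x : V) : R := gradQ2 x * (Num.max `|Q x| l)^-1.

Lemma cont_gradsq_max l : 0 < l -> continuous (gradsq_max l).
Proof.
move=> l0; apply: cont_mul; first exact: (@cont_gradsq R u p c su sp).
move=> x; apply: (@continuousV R V (fun x => Num.max `|Q x| l) x).
  by rewrite gt_eqF // lt_max l0 orbT.
apply: (@continuous_max R V (fun x => `|Q x|) (fun=> l) x); first exact: cont_normQ.
exact: cst_continuous.
Qed.

Lemma superlevel_int_max l : superlevel_int l = integral3 (superlevel l) (gradsq_max l).
Proof.
apply: integral3_eq => x; rewrite /superlevel /= /gradsq_max => lx.
by rewrite max_l // ltW.
Qed.

Lemma superlevel_int_ge l : 0 < l ->
  (integral3 setT (logQ l) <= superlevel_int l)%E.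
Proof.
move=> l0; rewrite -(integral_identity su sp ns dv head_decay l0) superlevel_int_max.
rewrite (@integral3_supp _ (superlevel l)); last first.
  move=> x /negP; rewrite -leNgt normQ => h.
  by rewrite /dlog_gradsq /trunc_dlog h mul0r.
apply: integral3_le.
- exact: measurable_superlevel.
- exact: (@cont_dlog_gradsq R u p c su sp _ l0).
- exact: cont_gradsq_max.
- by move=> x _; apply: mulr_ge0; [exact: trunc_dlog_ge0|exact: gradsq_ge0].
- move=> x; rewrite /superlevel /= => lx; rewrite /dlog_gradsq /gradsq_max (max_l (ltW lx)) mulrC.
  rewrite ler_wpM2l ?gradsq_ge0 //; move: lx; rewrite normQ; exact: trunc_dlog_le.
Qed.

Lemma superlevel_int_le (e l : R) : 0 < e -> e < 1 -> 0 < l ->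
  ((1 - e)%:E * superlevel_int l <= integral3 setT (logQ (e * l)))%E.
Proof.
move=> e0 e1 l0; have el0 : 0 < e * l by rewrite mulr_gt0.
rewrite -(integral_identity su sp ns dv head_decay el0) superlevel_int_max.
have g0 x : superlevel l x -> 0 <= gradsq_max l x.
  move=> _; rewrite /gradsq_max mulr_ge0 ?gradsq_ge0 // invr_ge0 le_max.
  by rewrite normr_ge0.
have ms := measurable_superlevel l.
have cm := cont_gradsq_max l0; have cd := @cont_dlog_gradsq R u p c su sp _ el0.
have e1' : 0 <= 1 - e by rewrite subr_ge0 ltW.
rewrite -integral3Z //.
apply: (@le_trans _ _ (integral3 (superlevel l) (dlogQ (e * l)))).
  apply: integral3_le => //.
  - by apply: cont_mul => //; exact: cont_cst.
  - by move=> x lx; apply: mulr_ge0 => //; exact: g0.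
  - move=> x; rewrite /superlevel /= => lx; rewrite /dlog_gradsq /gradsq_max (max_l (ltW lx)).
    rewrite mulrCA mulrC ler_wpM2r ?gradsq_ge0 //; move: lx; rewrite normQ.
    exact: trunc_dlog_ge.
apply: integral3_subset => //; first exact: measurable3T.
by move=> x _; apply: mulr_ge0; [exact: trunc_dlog_ge0|exact: gradsq_ge0].
Qed.

(** On a fixed level set [|Q| > d] the weight is at least [ln (d / l) - 1], which is asymptotic to
    ln (1 / l) as [l] tends to 0. *)
Lemma log_enstrophy_ge (d l : R) : 0 < d -> 0 < l -> 1 <= ln (d / l) ->
  ((ln (d / l) - 1)%:E * integral3 (superlevel d) (enstrophy u) <=
   integral3 setT (logQ l))%E.
Proof.
move=> d0 l0 dl; have ms := measurable_superlevel d.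
have ce := cont_enstrophy su; have cl := @cont_log_enstrophy R u p c su sp _ l0.
have k0 : 0 <= ln (d / l) - 1 by rewrite subr_ge0.
have e0 (x : V) : superlevel d x -> 0 <= enstrophy u x by move=> _; exact: enstrophy_ge0.
rewrite -integral3Z //.
apply: (@le_trans _ _ (integral3 (superlevel d) (logQ l))).
  apply: integral3_le => //.
  - by apply: cont_mul => //; exact: cont_cst.
  - by move=> x lx; apply: mulr_ge0 => //; exact: e0.
  - move=> x; rewrite /superlevel /= normQ => lx.
    rewrite /log_enstrophy ler_wpM2r ?enstrophy_ge0 //.
    have q0 := lt_trans d0 lx.
    apply: (le_trans _ (trunc_log_ge l0 q0)); rewrite lerD2r.
    by rewrite ler_ln ?posrE ?divr_gt0 // ler_pM2r ?invr_gt0 // ltW.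
apply: integral3_subset => //; first exact: measurable3T.
by move=> x _; apply: mulr_ge0; [exact: trunc_log_ge0|exact: enstrophy_ge0].
Qed.

Lemma log_enstrophy_le (B l : R) : 0 < l -> l <= 1 -> 1 <= B -> (forall x, `|Q x| <= B) ->
  (integral3 setT (logQ l) <= (ln (B / l))%:E * integral3 setT (enstrophy u))%E.
Proof.
move=> l0 l1 B1 QB; have ce := cont_enstrophy su; have cl := @cont_log_enstrophy R u p c su sp _ l0.
have mT := @measurable3T R.
have k0 : 0 <= ln (B / l) by apply: ln_ge0; rewrite ler_pdivlMr // mul1r; apply: le_trans B1.
rewrite -integral3Z //; last by move=> x _; exact: enstrophy_ge0.
apply: integral3_le => //.
- by apply: cont_mul => //; exact: cont_cst.
- by move=> x _; apply: mulr_ge0; [exact: trunc_log_ge0|exact: enstrophy_ge0].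
- move=> x _; rewrite /log_enstrophy ler_wpM2r ?enstrophy_ge0 //; apply: trunc_log_le => //.
  by rewrite -normQ.
Qed.

Lemma enstrophy_exhaustion :
  integral3 (superlevel n.+1%:R^-1) (enstrophy u) @[n --> \oo] --> integral3 setT (enstrophy u).
Proof.
apply: (@integral3_cvg _ (fun n => superlevel n.+1%:R^-1)).
- exact: (cont_enstrophy su).
- exact: enstrophy_ge0.
- by move=> n; exact: measurable_superlevel.
- move=> m n mn x; rewrite /superlevel /=; apply: le_lt_trans.
  by rewrite lef_pV2 ?posrE ?ltr0n // ler_nat.
- move=> x ex; have Q0 : 0 < `|Q x|.
    rewrite normr_gt0; apply/eqP => h.
    by move: ex; rewrite (head0_enstrophy su sp ns dv uM head_decay h) ltxx.
  have [n _ hn] := near_infty_natSinv_lt (PosNum Q0).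
  by exists n; exact: (hn n (leqnn n)).
Qed.

End LogBounds.

(** * Passage to the limit in the logarithmic averages *)

Section LogAverage.
Context {R : realType}.
Implicit Types (F : R -> \bar R) (f : R -> R).

Lemma near_ln_ge (K : R) : \forall l \near (0 : R)^'+,
  [/\ 0 < l, l <= 1, 1 <= ln (1 / l) & K <= ln (1 / l)].
Proof.
pose m := expR (- Num.max 1 K).
near=> l; have l0 : 0 < l by near: l; exact: nbhs_right_gt.
have lm : l < m by near: l; apply: nbhs_right_lt; exact: expR_gt0.
have L : Num.max 1 K <= ln (1 / l).
  by rewrite div1r lnV ?posrE // lerNr -[leRHS]expRK ler_ln ?posrE ?expR_gt0 // ltW.
move: L; rewrite ge_max => /andP[L1 LK]; split=> //.
apply: (le_trans (ltW lm)); rewrite -expR0 /m ler_expR oppr_le0.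
by rewrite le_max ler01.
Unshelve. all: by end_near. Qed.

(** Divided by ln (1 / l), the bounds tend to [wd n] and [w / (1 - e)] for fixed [n] and [e]; these
    are fixed first, then [l] is taken small. *)
Lemma log_average_real f (wd : nat -> R) (w B : R) : 1 <= B -> 0 <= w ->
  (forall n, 0 <= wd n) -> wd n @[n --> \oo] --> w ->
  (forall n l, 0 < l -> l <= 1 -> 1 <= ln (n.+1%:R^-1 / l) ->
     (ln (n.+1%:R^-1 / l) - 1) * wd n <= f l) ->
  (forall e l, 0 < e -> e < 1 -> 0 < l -> l <= 1 ->
     (1 - e) * f l <= ln (B / (e * l)) * w) ->
  (ln (1 / l))^-1 * f l @[l --> (0 : R)^'+] --> w.
Proof.
move=> B1 w0 wd0 wdw hge hle; apply/cvgrPdist_le => h h0.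
have B0 : 0 < B by exact: lt_le_trans B1.
have h20 : 0 < h / 2 by rewrite divr_gt0.
have [n _ hn] := (cvgrPdist_le _ _).1 wdw _ h20.
have {}hn : w - wd n <= h / 2 by apply: le_trans (ler_norm _) _; exact: (hn n (leqnn n)).
have d0 : 0 < n.+1%:R^-1 :> R by rewrite invr_gt0.
set d := n.+1%:R^-1 in d0 hge.
(* Chosen so that [(1 - e) * (w + h) = w + h / 2], which leaves [h / 2] for the constant
   [ln (B / e)]. *)
pose e := h / (2 * (w + h)).
have wh0 : 0 < w + h by rewrite ltr_wpDl.
have e0 : 0 < e by rewrite divr_gt0 // mulr_gt0.
have e1 : e < 1 by rewrite ltr_pdivrMr ?mulr_gt0 //; lra.
have ewh : (1 - e) * (w + h) = w + h / 2 by rewrite /e; field; rewrite gt_eqF.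
clearbody e.
(* Above [K], ln (1 / l) validates the lower bound and makes each additive constant at most [h / 2]
   times ln (1 / l). *)
pose K := Num.max (Num.max (2 - ln d) ((1 - ln d) * wd n / (h / 2)))
   (ln (B / e) * w / (h / 2)).
near=> l.
have [l0 l1 L1] : [/\ 0 < l, l <= 1, 1 <= ln (1 / l) & K <= ln (1 / l)].
  by near: l; exact: near_ln_ge.
rewrite /K !ge_max => /andP[/andP[La Lb] Lc].
have E1 : ln (d / l) = ln d + ln (1 / l).
  by rewrite -lnM ?posrE ?divr_gt0 // div1r.
have E2 : ln (B / (e * l)) = ln (B / e) + ln (1 / l).
  rewrite -lnM ?posrE ?divr_gt0 //.
  by rewrite div1r invfM mulrA.
have G : (ln d + ln (1 / l) - 1) * wd n <= f l.
  by rewrite -E1; apply: hge => //; rewrite E1; move: La; move: (ln d) (ln _) => *; lra.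
have H : (1 - e) * f l <= (ln (B / e) + ln (1 / l)) * w by rewrite -E2; exact: hle.
move: Lb Lc; rewrite !ler_pdivrMr // => Lb Lc.
have L0 : 0 < ln (1 / l) by apply: lt_le_trans L1.
rewrite mulrC ler_distlC; apply/andP; split.
  rewrite ler_pdivlMr //; apply: le_trans G.
  move: Lb hn L0; move: (ln d) (ln (1 / l)) (wd n) => a L x Lb hn L0.
  have : (w - x) * L <= h / 2 * L by exact: (ler_wpM2r (ltW L0) hn).
  lra.
rewrite ler_pdivrMr // -(ler_pM2l (x := 1 - e)) ?subr_gt0 //.
rewrite mulrA ewh; apply: (le_trans H); move: Lc {H}.
move: (ln (B / e)) (ln (1 / l)) => b L Lc; lra.
Unshelve. all: by end_near. Qed.

Lemma log_average F (Wd : nat -> \bar R) (W : \bar R) (B : R) : 1 <= B ->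
  (W < +oo)%E -> (forall n, (0 <= Wd n)%E) -> (forall n, (Wd n <= W)%E) ->
  (forall l, (0 <= F l)%E) -> Wd n @[n --> \oo] --> W ->
  (forall n l, 0 < l -> 1 <= ln (n.+1%:R^-1 / l) ->
     ((ln (n.+1%:R^-1 / l) - 1)%:E * Wd n <= F l)%E) ->
  (forall e l, 0 < e -> e < 1 -> 0 < l -> l <= 1 ->
     ((1 - e)%:E * F l <= (ln (B / (e * l)))%:E * W)%E) ->
  (((ln (1 / l))^-1)%:E * F l)%E @[l --> (0 : R)^'+] --> W.
Proof.
move=> B1 Wfin Wd0 WdW F0 cW hge hle.
have W0 : (0 <= W)%E by apply: le_trans (WdW 0%N).
have fW : W \is a fin_num by rewrite ge0_fin_numE.
have fWd n : Wd n \is a fin_num by rewrite ge0_fin_numE //; apply: le_lt_trans Wfin.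
have fF l : 0 < l -> l <= 1 -> F l \is a fin_num.
  move=> l0 l1; rewrite ge0_fin_numE // ltey; apply/eqP => Fy.
  have h0 : 0 < 2^-1 :> R by rewrite invr_gt0.
  have h1 : 2^-1 < 1 :> R by rewrite invf_lt1 // ltr1n.
  (* The upper bound with [e = 1 / 2] already excludes an infinite value. *)
  have := hle _ _ h0 h1 l0 l1; rewrite Fy -(fineK fW) -EFinM.
  by rewrite gt0_muley ?lte_fin ?subr_gt0 // leye_eq.
pose f l := fine (F l); pose wd n := fine (Wd n).
have cw : wd n @[n --> \oo] --> fine W by apply: fine_cvg; rewrite fineK.
have C : (ln (1 / l))^-1 * f l @[l --> (0 : R)^'+] --> fine W.
  apply: (@log_average_real f wd (fine W) B) => //.
  - exact: fine_ge0.
  - by move=> n; exact: fine_ge0.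
  - move=> n l l0 l1 h; have := hge n l l0 h.
    by rewrite -(fineK (fF l l0 l1)) -(fineK (fWd n)) -EFinM lee_fin.
  - move=> e l e0 e1 l0 l1; have := hle e l e0 e1 l0 l1.
    by rewrite -(fineK (fF l l0 l1)) -(fineK fW) -!EFinM lee_fin.
have near01 : \forall l \near (0 : R)^'+, F l \is a fin_num.
  by near=> l; have [l0 l1 _ _] : [/\ 0 < l, l <= 1, 1 <= ln (1 / l) & 1 <= ln (1 / l)];
    [near: l; exact: near_ln_ge|exact: fF].
rewrite -(fineK fW); apply: cvg_EFin.
  by apply: filterS near01 => l h; rewrite fin_numM.
apply: cvg_trans C; apply: near_eq_cvg; apply: filterS near01 => l h /=.
by rewrite fineM.
Unshelve. all: by end_near. Qed.

Lemma log_average_littleo F (W : \bar R) : (0 <= W)%E -> (W < +oo)%E ->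
  (((ln (1 / l))^-1)%:E * F l)%E @[l --> (0 : R)^'+] --> W ->
  littleo_right0 F (fun l => ln (1 / l)) -> W = 0%E.
Proof.
have A (w : R) : 0 < w -> w - w / 4 <= w / 4 -> False by lra.
move=> W0 Wfin; have fW : W \is a fin_num by rewrite ge0_fin_numE.
rewrite -(fineK fW) => /fine_cvgP[nf cF] oF.
congr EFin; apply/eqP; rewrite eq_le fine_ge0 // andbT leNgt; apply/negP => w0.
have w4 : 0 < fine W / 4 by rewrite divr_gt0.
have H1 : \forall l \near (0 : R)^'+,
    `|fine W - fine (((ln (1 / l))^-1)%:E * F l)%E| <= fine W / 4.
  exact: (cvgrPdist_le _ _).1 cF _ w4.
have H2 := oF _ w4.
have [l [h1 [h2 [h3 [l0 l1 L1 _]]]]] := filter_ex (filterI H1 (filterI H2 (filterI nf (near_ln_ge 1)))).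
have L0 : 0 < ln (1 / l) by apply: lt_le_trans L1.
have {}h2 : (F l <= (fine W / 4 * ln (1 / l))%:E)%E.
  by apply: le_trans (lee_abs _) _; move: h2; rewrite (gtr0_norm L0).
have h4 : (((ln (1 / l))^-1)%:E * F l <= (fine W / 4)%:E)%E.
  apply: (le_trans (lee_wpmul2l _ h2)); first by rewrite lee_fin invr_ge0 ltW.
  by rewrite -EFinM lee_fin mulrCA mulVf ?gt_eqF // mulr1.
have h5 : fine (((ln (1 / l))^-1)%:E * F l)%E <= fine W / 4.
  by rewrite -lee_fin fineK.
move: h1; rewrite ler_distlC => /andP[h6 _].
exact: A w0 (le_trans h6 h5).
Qed.

End LogAverage.

(** * Irrotational decaying flows *)

Section Liouville.
Context {R : realType}.
Local Notation V := 'rV[R]_3.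
Implicit Types (i j k a b : 'I_3).

Lemma integral3_eq0 (f : V -> R) : continuous f -> (forall x, 0 <= f x) ->
  integral3 setT f = 0%E -> forall x, f x = 0.
Proof.
move=> cf f0 If x; apply/eqP; rewrite eq_le f0 andbT leNgt; apply/negP => fx.
have h : f x / 2 < f x by lra.
have [d d0 hd] := cont_gt_near cf h.
pose s : V := const_mx (d / 2).
have ab i : (x - s) 0 i <= (x + s) 0 i by rewrite !mxE; lra.
have mb := @measurable_box R (x - s) (x + s).
have c2 : continuous (fun _ : V => f x / 2) by exact: cont_cst.
have : ((boxint (x - s) (x + s) (fun=> f x / 2))%:E <= integral3 setT f)%E.
  apply: (@le_trans _ _ (integral3 (box (x - s) (x + s)) f)).
    rewrite EFin_boxint //; apply: (@integral3_le R (box (x - s) (x + s)) (fun=> f x / 2)) => // y.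
      by move=> _; rewrite divr_ge0 // ltW.
    move=> hy; apply: ltW; apply: hd.
    apply: (@le_lt_trans _ _ (d / 2)); last by lra.
    apply: norm_le_coord => [|i]; first by lra.
    by have := hy i; rewrite !mxE ler_norml => /andP[h1 h2]; apply/andP; split; lra.
  by apply: integral3_subset => //; exact: measurable3T.
rewrite If boxint_cst // lee_fin leNgt => /negP; apply.
apply: mulr_gt0; first by rewrite divr_gt0.
by apply: prodr_gt0 => i _; rewrite !mxE; lra.
Qed.

(** The difference of the two sides is a sum of squares, built from the symmetric part of the
    matrix. It makes the enstrophy finite under a finite Dirichlet integral. *)
Lemma curl_sqr_le (a : 'I_3 -> 'I_3 -> R) :
  \sum_k (a (k + 1) (k + 2%:R) - a (k + 2%:R) (k + 1)) ^+ 2 <=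
  2 * \sum_i \sum_j a i j ^+ 2.
Proof.
rewrite curl_sqr_sum !sum_ord3.
move: (a 0 0) (a 0 1) (a 0 2%:R) (a 1 0) (a 1 1) (a 1 2%:R) (a 2%:R 0) (a 2%:R 1) (a 2%:R 2%:R).
move=> a00 a01 a02 a10 a11 a12 a20 a21 a22.
have h1 := sqr_ge0 (a01 + a10); have h2 := sqr_ge0 (a02 + a20); have h3 := sqr_ge0 (a12 + a21).
have h4 := sqr_ge0 a00; have h5 := sqr_ge0 a11; have h6 := sqr_ge0 a22.
rewrite -subr_ge0; set E := (X in 0 <= X).
have -> : E = (a01 + a10) ^+ 2 + (a02 + a20) ^+ 2 + (a12 + a21) ^+ 2
   + 2 * a00 ^+ 2 + 2 * a11 ^+ 2 + 2 * a22 ^+ 2 by rewrite /E; ring.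
by clear E; rewrite !addr_ge0 // mulr_ge0.
Qed.

Context (u : 'I_3 -> V -> R) (su : forall j, smooth (u j)).
Context (dv : forall x, \sum_i partial i (u i) x = 0).

Lemma irrotational_vort : (forall x, enstrophy u x = 0) -> forall a b, vort u a b = fun=> 0.
Proof.
move=> e0 a b; apply/funext => x.
have v0 k : vort u (k + 1) (k + 2%:R) x = 0.
  have /eqP := e0 x; rewrite psumr_eq0 => [|i _]; last exact: sqr_ge0.
  by move/allP => /(_ k); rewrite mem_index_enum sqrf_eq0 => /(_ isT)/eqP.
have e1 : (1 + 1 : 'I_3) = 2%:R by exact: val_inj.
have e2 : (1 + 2%:R : 'I_3) = 0 by exact: val_inj.
have e3 : (2%:R + 1 : 'I_3) = 0 by exact: val_inj.
have e4 : (2%:R + 2%:R : 'I_3) = 1 by exact: val_inj.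
have := v0 0; have := v0 1; have := v0 2%:R; rewrite e1 e2 e3 e4 !add0r => h2 h1 h0.
have D i : vort u i i x = 0 by rewrite /vort subrr.
have N i j : vort u j i x = 0 -> vort u i j x = 0.
  by move=> h; rewrite -[LHS]opprK -[RHS]oppr0 -h /vort !opprB.
move: a b; apply: ord3P; apply: ord3P.
1,5,9: exact: D.
1: exact: h2.
1: exact: N h1.
1: exact: N h2.
1: exact: h0.
1: exact: h1.
exact: N h0.
Qed.

Context (u_decay : forall j e, 0 < e -> exists N, forall x, N < `|x| -> `|u j x| <= e).

(** Each component is harmonic by [lap_eq_curl]; the maximum principle with zero drift applies to it
    and to its opposite. *)
Lemma irrotational_eq0 : (forall x, enstrophy u x = 0) -> forall j x, u j x = 0.
Proof.
move=> /irrotational_vort v0 k.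
have L x : \sum_i partial i (partial i (u k)) x = 0.
  rewrite -/(lap (u k) x) (lap_eq_curl su dv); apply: big1 => i _.
  by rewrite v0 (C1_cstP _).2.
have [cN pN] := C1_oppP (smooth_C1 (su k)).
have cdN i : C1 (partial i (fun x => - u k x)).
  by rewrite pN; exact: (C1_oppP (smooth_C1_partial (su k) i)).1.
have Z (i : 'I_3) (x : V) : `|(fun _ _ => 0) i x : R| <= 0 by rewrite normr0.
have up : forall x, u k x <= 0.
  apply: (maximum_principle (smooth_C1 (su k)) (smooth_C1_partial (su k)) Z) => [x|e e0].
    by rewrite L big1 ?subrr // => i _; rewrite mul0r.
  have [N hN] := u_decay k e0; exists N => x /hN; apply: le_trans; exact: ler_norm.
have dn : forall x, - u k x <= 0.
  apply: (maximum_principle cN cdN Z) => [x|e e0].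
    rewrite [X in _ - X]big1 ?subr0; last by move=> i _; rewrite mul0r.
    rewrite (eq_bigr (fun i => - partial i (partial i (u k)) x)).
      by rewrite sumrN L oppr0.
    by move=> i _; rewrite pN (C1_oppP (smooth_C1_partial (su k) i)).2.
  have [N hN] := u_decay k e0; exists N => x /hN; apply: le_trans.
  by rewrite -normrN; exact: ler_norm.
by move=> x; apply: le_anti; rewrite up -oppr_le0 dn.
Qed.

End Liouville.

(** * The main theorem *)

Section Components.
Context {R : realType}.
Local Notation V := 'rV[R]_3.
Implicit Types (i j k : 'I_3).
Context (v : V -> V) (p : V -> R).
Context (v_smooth : smooth v).

Definition component j (y : V) : R := v y 0 j.
Local Notation u := component.

Lemma smooth_component j : smooth (u j).
Proof. exact: smooth_coord. Qed.

Lemma partial_component i j : partial i (u j) = fun x => partial i v x 0 j.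
Proof. by apply: partial_coord => x; have [_] := v_smooth [::]; exact. Qed.

Lemma partial2_component k i j : partial k (partial i (u j)) =
  fun x => partial k (partial i v) x 0 j.
Proof.
rewrite partial_component; apply: partial_coord => x.
by have [_] := smooth_partial i v_smooth [::]; exact.
Qed.

Lemma stationary_NS_component j x : stationary_NS v p ->
  advect u j x = - partial j p x + lap (u j) x.
Proof.
move=> /(_ x)[/(congr1 (fun y : V => y 0 j)) + _].
rewrite !mxE /convection /laplacian !summxE => E.
rewrite /advect /lap (eq_bigr (fun i => (v x 0 i *: partial i v x) 0 j)).
  rewrite E; congr (_ + _); apply: eq_bigr => i _.
  by rewrite partial2_component.
by move=> i _; rewrite partial_component mxE.
Qed.

Lemma sqnorm_curl x : sqnorm (curl v x) = enstrophy u x.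
Proof. by apply: eq_bigr => i _; rewrite mxE. Qed.

Lemma enstrophy_le x : enstrophy u x <= 2 * sqnorm_grad v x.
Proof. exact: (curl_sqr_le (fun i j => partial i (u j) x)). Qed.

Lemma cont_sqnorm_grad : continuous (sqnorm_grad v).
Proof.
apply: (@cont_sum _ _ 3 (fun i x => \sum_j partial i (u j) x ^+ 2)) => i.
apply: (@cont_sum _ _ 3 (fun j x => partial i (u j) x ^+ 2)) => j.
by apply: cont_sqr; exact: C1_cont (smooth_C1_partial (smooth_component j) i).
Qed.

Lemma sqnorm_grad_ge0 x : 0 <= sqnorm_grad v x.
Proof. by do 2!(apply: sumr_ge0 => ? _); exact: sqr_ge0. Qed.

Lemma bddint_partial_component i j : (integral3 setT (sqnorm_grad v) < +oo)%E ->
  bddint (fun x => partial i (u j) x ^+ 2).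
Proof.
move=> If.
have k1 : continuous (fun x => partial i (u j) x ^+ 2).
  by apply: cont_sqr; exact: C1_cont (smooth_C1_partial (smooth_component j) i).
apply: (bddint_le k1 cont_sqnorm_grad) => [x|].
  rewrite /sqnorm_grad (bigD1 i) //= (bigD1 j) //= -addrA lerDl addr_ge0 ?sumr_ge0 //.
    by move=> a _; exact: sqr_ge0.
  by move=> a _; apply: sumr_ge0 => b _; exact: sqr_ge0.
exists (fine (integral3 setT (sqnorm_grad v))) => r _.
have I0 : (0 <= integral3 setT (sqnorm_grad v))%E.
  by apply: integral3_ge0 => x _; exact: sqnorm_grad_ge0.
have fI : integral3 setT (sqnorm_grad v) \is a fin_num by rewrite ge0_fin_numE.
rewrite -lee_fin (fineK fI).
exact: cubeint_le_integral3 cont_sqnorm_grad sqnorm_grad_ge0.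
Qed.

Lemma enstrophy_lty : (integral3 setT (sqnorm_grad v) < +oo)%E ->
  (integral3 setT (enstrophy u) < +oo)%E.
Proof.
move=> If; have ck : continuous (fun x => 2 * sqnorm_grad v x).
  by apply: cont_mul; [exact: cont_cst|exact: cont_sqnorm_grad].
apply: (@le_lt_trans _ _ (integral3 setT (fun x => 2 * sqnorm_grad v x))).
  apply: integral3_le => // [||x _|x _].
  - exact: measurable3T.
  - exact: (cont_enstrophy smooth_component).
  - exact: enstrophy_ge0.
  - exact: enstrophy_le.
rewrite integral3Z //; last 3 first.
- exact: measurable3T.
- exact: cont_sqnorm_grad.
- by move=> x _; exact: sqnorm_grad_ge0.
by rewrite lte_mul_pinfty // ?lee_fin.
Qed.

Context (v_decay : v x @[x --> at_infinity] --> (0 : V)).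

Lemma component_decay j e : 0 < e -> exists N, forall x, N < `|x| -> `|u j x| <= e.
Proof.
have pf := @at_infinity_proper R.
move=> e0; have /at_infinityP[N hN] : \forall x \near at_infinity, `|0 - v x| <= e.
  exact: (cvgrPdist_le _ _).1 v_decay _ e0.
exists N => x /hN; rewrite sub0r normrN; apply: le_trans; exact: norm_coord_le.
Qed.

Lemma component_bounded : exists M, forall j x, `|u j x| <= M.
Proof.
have b j : exists M, forall x, `|u j x| <= M.
  apply: bounded_decay (C1_cont (smooth_C1 (smooth_component j))) _.
  exact: component_decay.
have /choice[M hM] := b; exists (\sum_j `|M j|) => j x.
apply: (le_trans (hM j x)); rewrite (bigD1 j) //=.
by apply: (le_trans (ler_norm _)); rewrite lerDl sumr_ge0.
Qed.

Context (c : R) (p_lim : p x @[x --> at_infinity] --> c).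

Lemma head_pressureE : head_pressure v p = head u p c.
Proof.
have pf := @at_infinity_proper R.
apply/funext => x; rewrite /head_pressure /head.
by rewrite (cvg_lim _ p_lim).
Qed.

Lemma head_decay e : 0 < e -> exists N, forall x, N < `|x| -> `|head u p c x| <= e.
Proof.
have pf := @at_infinity_proper R.
move=> e0; have e20 : 0 < e / 2 by rewrite divr_gt0.
pose d := Num.min 1 (e / 3).
have d0 : 0 < d by rewrite lt_min ltr01 divr_gt0.
have /choice[N hN] := fun j => component_decay j d0.
have /at_infinityP[K hK] : \forall x \near at_infinity, `|c - p x| <= e / 2.
  exact: (cvgrPdist_le _ _).1 p_lim _ e20.
exists (`|K| + \sum_j `|N j|) => x xN.
have S0 : 0 <= \sum_j `|N j| by apply: sumr_ge0.
have hp : `|c - p x| <= e / 2.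
  apply: hK; apply: le_lt_trans xN; apply: (le_trans (ler_norm _)); by rewrite lerDl.
have hu j : u j x ^+ 2 <= e / 3.
  have h : `|u j x| <= d.
    apply: hN; apply: le_lt_trans xN; apply: (le_trans (ler_norm _)).
    by rewrite (bigD1 j) //= addrCA lerDl addr_ge0 // sumr_ge0.
  move: h; rewrite /d le_min => /andP[h1 h3].
  rewrite -real_normK ?num_real // expr2.
  by apply: le_trans h3; rewrite ler_piMl.
have s : \sum_j u j x ^+ 2 <= e.
  have := hu 0; have := hu 1; have := hu 2%:R; rewrite sum_ord3.
  by move: (u _ _ ^+ 2) (u 0 x ^+ 2) (u 1 x ^+ 2) => ? ? ? ? ? ?; lra.
have s0 : 0 <= \sum_j u j x ^+ 2 by apply: sumr_ge0 => j _; exact: sqr_ge0.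
move: hp; rewrite /head !ler_norml; move: (\sum_j _) s s0 => S s s0 /andP[h1 h2].
by apply/andP; split; lra.
Qed.

End Components.

Theorem corollary1p1 (R : realType)
    (v : 'rV[R]_3 -> 'rV[R]_3) (p : 'rV[R]_3 -> R)
    (v_smooth : smooth v) (p_smooth : smooth p)
    (NS : stationary_NS v p)
    (v_decay : v x @[x --> at_infinity] --> (0 : 'rV[R]_3))
    (dirichlet : (integral3 setT (sqnorm_grad v) < +oo)%E) :
  (((ln (1 / lam))^-1)%:E * superlevel_integral (head_pressure v p) lam)%E
      @[lam --> 0^'+]
    --> integral3 setT (fun x => sqnorm (curl v x))
  /\
  (littleo_right0 (superlevel_integral (head_pressure v p))
     (fun lam => ln (1 / lam)) ->
   forall x, v x = 0).
Proof.
pose u := component v.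
have su j : smooth (u j) by exact: smooth_component.
have ns j x : advect u j x = - partial j p x + lap (u j) x.
  exact: stationary_NS_component.
have dv x : \sum_i partial i (u i) x = 0 by exact: (NS x).2.
have [M uM] := component_bounded v_smooth v_decay.
have bD i j := bddint_partial_component v_smooth i j dirichlet.
(* From here on the [lim] in [head_pressure] can be replaced by the number [c]. *)
have [c pc] := pressure_limit su p_smooth ns dv uM bD.
have hd := head_decay v_decay pc.
have cQ := C1_cont (C1_headP c su p_smooth).1.
have [B [B1 QB]] : exists B, 1 <= B /\ forall x, `|head u p c x| <= B.
  have [K hK] := bounded_decay cQ (hd 1 ltr01).
  by exists (Num.max 1 K); split=> [|x]; rewrite le_max ?lexx // hK orbT.
have FE l : superlevel_integral (head_pressure v p) l = superlevel_int u p c l.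
  rewrite (head_pressureE v pc); apply: integral3_eq => x _.
  by congr (_ / _); apply: eq_bigr => i _; rewrite mxE.
have WE : integral3 setT (fun x => sqnorm (curl v x)) = integral3 setT (enstrophy u).
  by apply: integral3_eq => x _; rewrite (sqnorm_curl v).
have ce := cont_enstrophy su.
have W0 : (0 <= integral3 setT (enstrophy u))%E.
  by apply: integral3_ge0 => x _; exact: enstrophy_ge0.
have Wfin : (integral3 setT (enstrophy u) < +oo)%E by exact: enstrophy_lty.
have lim : (((ln (1 / l))^-1)%:E * superlevel_int u p c l)%E @[l --> 0^'+]
    --> integral3 setT (enstrophy u).
  apply: (@log_average R (superlevel_int u p c)
    (fun n => integral3 (superlevel u p c n.+1%:R^-1) (enstrophy u)) _ B B1 Wfin).
  - by move=> n; apply: integral3_ge0 => x _; exact: enstrophy_ge0.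
  - move=> n; apply: integral3_subset => //.
    + exact: (measurable_superlevel c su p_smooth).
    + exact: measurable3T.
    + by move=> x _; exact: enstrophy_ge0.
  - move=> l; apply: integral3_ge0 => x _; apply: divr_ge0; last exact: normr_ge0.
    exact: gradsq_ge0.
  - exact: (enstrophy_exhaustion su p_smooth ns dv uM hd).
  - move=> n l l0 h; have d0 : 0 < n.+1%:R^-1 :> R by rewrite invr_gt0.
    apply: (le_trans (log_enstrophy_ge su p_smooth ns dv uM hd d0 l0 h)).
    exact: (superlevel_int_ge su p_smooth ns dv uM hd l0).
  - move=> e l e0 e1 l0 l1.
    apply: (le_trans (superlevel_int_le su p_smooth ns dv uM hd e0 e1 l0)).
    apply: (log_enstrophy_le su p_smooth ns dv uM hd _ _ B1 QB).
      by rewrite mulr_gt0.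
    by rewrite mulr_ile1 // ltW.
split.
  rewrite WE; have -> : superlevel_integral (head_pressure v p) = superlevel_int u p c.
    exact/funext.
  exact: lim.
have -> : superlevel_integral (head_pressure v p) = superlevel_int u p c by exact/funext.
move=> /(log_average_littleo W0 Wfin lim) Wz x.
have e0 := integral3_eq0 ce (enstrophy_ge0 u) Wz.
have u0 := irrotational_eq0 su dv (component_decay v_decay) e0.
by apply/rowP => j; rewrite mxE; exact: u0.
Qed.
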